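(* Let $T>0$ and $\alpha,\beta>0$. The total generalized variation $\mathrm{TGV}$ is an equivalent norm on the quotient space $\mathrm{BV}(0,T)/\mathcal{L}$, which admits the dual representation $$\mathrm{BV}(0,T)/\mathcal{L}=\big(C_{0,a}(0,T)\big)^*,\qquad C_{0,a}(0,T):=\left\{p\in C_0(0,T)\;\middle|\;\int_0^T p\,dx=0\right\},$$ with duality pairing $\langle u+\mathcal{L},p\rangle=\int_{(0,T)}p\,dDu$ for $u\in\mathrm{BV}(0,T)$, $p\in C_{0,a}(0,T)$. In particular, the unit ball $\mathcal{B}:=\{u+\mathcal{L}\in\mathrm{BV}(0,T)/\mathcal{L}\;|\;\mathrm{TGV}(u)\le1\}$ is sequentially compact with respect to the corresponding weak-* topology in $\mathrm{BV}(0,T)/\mathcal{L}$.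
   Context: $C_0(0,T)$ is the space of continuous functions on $(0,T)$ vanishing at the boundary, with uniform norm $\|\cdot\|_C$; $M(0,T)=C_0(0,T)^*$ is the space of Radon measures with dual norm $\|\cdot\|_M$. $\mathrm{BV}(0,T)$ is the space of $u\in L^1(0,T)$ with distributional derivative $Du\in M(0,T)$, with norm $\|u\|_{\mathrm{BV}}=\|u\|_{L^1}+\|Du\|_M$. For $u\in\mathrm{BV}(0,T)$, $$\mathrm{TGV}(u)=\sup\left\{\int_0^T u\,v''\;\middle|\;v\in C_c^\infty(0,T),\ \|v\|_C\le\alpha,\ \|v'\|_C\le\beta\right\}=\inf_{w\in\mathrm{BV}(0,T)}\alpha\|Du-w\|_M+\beta\|Dw\|_M,$$ where $w$ is identified with the measure $w\,dx$. $\mathcal{L}$ is the space of affine functions $x\mapsto cx+d$, $c,d\in\mathbb{R}$; $\mathrm{TGV}(u+\ell)=\mathrm{TGV}(u)$ for $\ell\in\mathcal{L}$, so $\mathrm{TGV}$ is well defined on $\mathrm{BV}(0,T)/\mathcal{L}$. The quotient carries the norm $\|u+\mathcal{L}\|_{\mathrm{BV}/\mathcal{L}}=\inf_{\ell\in\mathcal{L}}\|u-\ell\|_{\mathrm{BV}}$. The identification with the dual space is understood as an isomorphism of Banach spaces (up to equivalent norms) given by the stated pairing. *)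

(* Defs.v *)
From HB Require Import structures.
From mathcomp Require Import all_boot all_order all_algebra.
From mathcomp Require Import generic_quotient ring_quotient.
From mathcomp Require Import all_classical all_reals all_analysis.
From mathcomp Require Import measurable_realfun ring lra.

Set Implicit Arguments.
Unset Strict Implicit.
Unset Printing Implicit Defensive.

Import Order.TTheory GRing.Theory Num.Theory.
Import numFieldNormedType.Exports.

Local Open Scope ring_scope.
Local Open Scope classical_set_scope.

Section charge_integral.
Context d (X : measurableType d) (R : realType).
Implicit Types (nu : {charge set X -> \bar R}) (D : set X) (f : X -> R).

(* A Hahn decomposition of nu, chosen arbitrarily: the resulting Jordan
   decomposition and charge_integral do not depend on it. *)
Definition hahn_pos nu : set X := projT1 (cid (Hahn_decomposition nu)).

Definition hahn_neg nu : set X := projT1 (cid (projT2 (cid (Hahn_decomposition nu)))).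

Lemma hahnP nu : hahn_decomposition nu (hahn_pos nu) (hahn_neg nu).
Proof. exact: (projT2 (cid (projT2 (cid (Hahn_decomposition nu))))). Qed.

Definition charge_integral nu D f : R :=
  \int[jordan_pos (hahnP nu)]_(x in D) f x -
  \int[jordan_neg (hahnP nu)]_(x in D) f x.

Lemma Rintegral_measure_add (m1 m2 : {finite_measure set X -> \bar R}) D f :
  measurable D -> measurable_fun D f -> [bounded f x | x in D] ->
  \int[measure_add m1 m2]_(x in D) f x =
  \int[m1]_(x in D) f x + \int[m2]_(x in D) f x.
Proof.
move=> mD mf bf.
have fi (m : {finite_measure set X -> \bar R}) : m.-integrable D (EFin \o f).
  by apply: measurable_bounded_integrable => //; rewrite ltey_eq fin_num_measure.
have mf' : measurable_fun D (EFin \o f) by exact/measurable_EFinP.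
rewrite /Rintegral (integral_measure_add mD (fi m1) (fi m2)).
by rewrite fineD//; exact: (integrable_fin_num mD (fi _)).
Qed.

Lemma Rintegral_mscale (k : {nonneg R}) (m : {finite_measure set X -> \bar R}) D f :
  measurable D -> measurable_fun D f -> [bounded f x | x in D] ->
  \int[mscale k m]_(x in D) f x = k%:num * \int[m]_(x in D) f x.
Proof.
move=> mD mf bf.
have fi : m.-integrable D (EFin \o f).
  by apply: measurable_bounded_integrable => //; rewrite ltey_eq fin_num_measure.
have mf' : measurable_fun D (EFin \o f) by exact/measurable_EFinP.
rewrite /Rintegral integralE.
rewrite !ge0_integral_mscale//; [|exact: measurable_funeneg|exact: measurable_funepos].
rewrite -muleBr; last 2 first.
- by [].
- apply: fin_num_adde_defr; apply: integrable_pos_fin_num => //.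
by rewrite -integralE fineM//; exact: (integrable_fin_num mD fi).
Qed.

Lemma hahn_jordanE nu A : measurable A ->
  nu A = (jordan_pos (hahnP nu) A - jordan_neg (hahnP nu) A)%E.
Proof. by move=> mA; rewrite (jordan_decomp (hahnP nu) mA) /cadd/= cscaleN1. Qed.

Lemma charge_integralE nu (m1 m2 : {finite_measure set X -> \bar R}) D f :
  measurable D -> measurable_fun D f -> [bounded f x | x in D] ->
  (forall A, measurable A -> nu A = (m1 A - m2 A)%E) ->
  charge_integral nu D f = \int[m1]_(x in D) f x - \int[m2]_(x in D) f x.
Proof.
move=> mD mf bf nuE.
pose P := jordan_pos (hahnP nu); pose N := jordan_neg (hahnP nu).
suff : \int[P]_(x in D) f x + \int[m2]_(x in D) f x =
       \int[m1]_(x in D) f x + \int[N]_(x in D) f x.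
  rewrite /charge_integral -/P -/N => /eqP.
  by rewrite -subr_eq -addrA (addrC (\int[m2]_(x in D) f x)) addrA => /eqP h;
     apply/eqP; rewrite subr_eq -h; apply/eqP; ring.
rewrite -!Rintegral_measure_add// /Rintegral; congr fine.
apply: eq_measure_integral => A mA _.
transitivity (P A + m2 A)%E; first exact: measure_addE.
transitivity (m1 A + N A)%E; last exact/esym/measure_addE.
have aux (a b c e : \bar R) : a \is a fin_num -> b \is a fin_num ->
    c \is a fin_num -> e \is a fin_num -> (a - b = c - e -> c + b = a + e)%E.
  case: a b c e => [a||] [b||] [c||] [e||] //= _ _ _ _.
  by rewrite -!EFinB -!EFinD => -[h]; congr EFin; lra.
apply: aux; try by rewrite fin_num_measure.
by rewrite -nuE// -hahn_jordanE.
Qed.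

End charge_integral.

Section measure_add_finite.
Context d (X : measurableType d) (R : realType).
Variables m1 m2 : {finite_measure set X -> \bar R}.

Let fin_measure_add : fin_num_fun (measure_add m1 m2).
Proof.
move=> A mA; rewrite (_ : measure_add m1 m2 A = (m1 A + m2 A)%E); last exact: measure_addE.
by rewrite fin_numD !fin_num_measure.
Qed.

HB.instance Definition _ := Measure.on (measure_add m1 m2).
HB.instance Definition _ :=
  @Measure_isFinite.Build _ _ _ (measure_add m1 m2) fin_measure_add.

End measure_add_finite.

Section charge_integral_linear.
Context d (X : measurableType d) (R : realType).

Lemma charge_integral_linear (a : R) (n1 n2 : {charge set X -> \bar R})
    (D : set X) (f : X -> R) :
  measurable D -> measurable_fun D f -> [bounded f x | x in D] ->
  charge_integral (cadd (cscale a n1) n2) D f =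
  a * charge_integral n1 D f + charge_integral n2 D f.
Proof.
move=> mD mf bf.
have [a0|a0] := leP 0 a.
- rewrite (@charge_integralE _ _ _ _
    (measure_add (mscale (NngNum a0) (jordan_pos (hahnP n1))) (jordan_pos (hahnP n2)))
    (measure_add (mscale (NngNum a0) (jordan_neg (hahnP n1))) (jordan_neg (hahnP n2)))) //.
    by rewrite !Rintegral_measure_add// !Rintegral_mscale//= /charge_integral; ring.
  move=> A mA.
  transitivity (a%:E * n1 A + n2 A)%E => //.
  rewrite (hahn_jordanE n1 mA) (hahn_jordanE n2 mA).
  transitivity ((a%:E * jordan_pos (hahnP n1) A + jordan_pos (hahnP n2) A)
    - (a%:E * jordan_neg (hahnP n1) A + jordan_neg (hahnP n2) A))%E; last first.
    by congr (_ - _)%E; apply/esym; exact: measure_addE.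
  have aux (x y z t : \bar R) : x \is a fin_num -> y \is a fin_num ->
    z \is a fin_num -> t \is a fin_num ->
    (a%:E * (x - y) + (z - t) = (a%:E * x + z) - (a%:E * y + t))%E.
    case: x y z t => [x||] [y||] [z||] [t||] //= _ _ _ _.
    by rewrite -!EFinB -!EFinM -!EFinD; congr EFin; ring.
  by apply: aux; rewrite fin_num_measure.
- have a0' : 0 <= - a by rewrite oppr_ge0 ltW.
  rewrite (@charge_integralE _ _ _ _
    (measure_add (mscale (NngNum a0') (jordan_neg (hahnP n1))) (jordan_pos (hahnP n2)))
    (measure_add (mscale (NngNum a0') (jordan_pos (hahnP n1))) (jordan_neg (hahnP n2)))) //.
    by rewrite !Rintegral_measure_add// !Rintegral_mscale//= /charge_integral; ring.
  move=> A mA.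
  transitivity (a%:E * n1 A + n2 A)%E => //.
  rewrite (hahn_jordanE n1 mA) (hahn_jordanE n2 mA).
  transitivity (((- a)%:E * jordan_neg (hahnP n1) A + jordan_pos (hahnP n2) A)
    - ((- a)%:E * jordan_pos (hahnP n1) A + jordan_neg (hahnP n2) A))%E; last first.
    by congr (_ - _)%E; apply/esym; exact: measure_addE.
  have aux (x y z t : \bar R) : x \is a fin_num -> y \is a fin_num ->
    z \is a fin_num -> t \is a fin_num ->
    (a%:E * (x - y) + (z - t) = ((- a)%:E * y + z) - ((- a)%:E * x + t))%E.
    case: x y z t => [x||] [y||] [z||] [t||] //= _ _ _ _.
    by rewrite -!EFinB -!EFinM -!EFinD; congr EFin; ring.
  by apply: aux; rewrite fin_num_measure.
Qed.

Lemma charge_integral_czero (D : set X) (f : X -> R) :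
  measurable D -> measurable_fun D f -> [bounded f x | x in D] ->
  charge_integral czero D f = 0.
Proof.
move=> mD mf bf; rewrite (@charge_integralE _ _ _ _ mzero mzero)// ?subrr//.
by move=> A mA; rewrite /czero/= /mzero sube0.
Qed.

End charge_integral_linear.

Section interval.
Context {R : realType} (T : R).

Definition Omega : set R := `]0, T[%classic.

Definition supnorm (f : R -> R) : R := sup [set `|f x| | x in Omega].

Definition test_function (v : R -> R) : Prop :=
  [/\ forall n x, derivable v^`(n) x 1,
      compact (closure [set x | v x != 0]) &
      closure [set x | v x != 0] `<=` Omega].

Lemma measurable_Omega : measurable Omega.
Proof. exact: measurable_itv. Qed.

Lemma segment_bounded (f : R -> R) :
  {within `[0, T], continuous f} -> [bounded f x | x in Omega].
Proof.
move=> cf.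
have /compact_bounded[M [Mr bf]] := continuous_compact cf (@segment_compact R 0 T).
exists M; split => // x Mx y; rewrite /Omega/= in_itv/= => /andP[y0 yT].
by apply: bf => //; exists y => //=; rewrite in_itv/= !ltW.
Qed.

Lemma segment_measurable (f : R -> R) :
  {within `[0, T], continuous f} -> measurable_fun Omega f.
Proof.
move=> cf; apply: (measurable_funS (E := `[0, T]%classic)) => //.
  by apply: subset_itv_oo_cc.
exact: subspace_continuous_measurable_fun.
Qed.

Lemma segment_integrable (f : R -> R) :
  {within `[0, T], continuous f} ->
  lebesgue_measure.-integrable Omega (EFin \o f).
Proof.
move=> cf; apply: (@integrableS _ (measurableTypeR R) R lebesgue_measure `[0, T]%classic) => //.
  exact: measurable_Omega.
  by apply: subset_itv_oo_cc.
by apply: continuous_compact_integrable => //; exact: segment_compact.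
Qed.

Lemma test_continuous (v : R -> R) n :
  test_function v -> {within `[0, T], continuous v^`(n)}.
Proof.
by case=> dv _ _; apply: derivable_within_continuous => x _; exact: dv.
Qed.

Lemma supnorm_ge0 f : 0 <= supnorm f.
Proof.
have [[x Ox]|/set0P/negP/negPn/eqP O0] := pselect (Omega !=set0); last first.
  by rewrite /supnorm O0 image_set0 sup0.
rewrite /supnorm; have [ub|/sup_out ->//] := pselect (has_sup [set `|f x| | x in Omega]).
by apply: le_trans (sup_upper_bound ub _); last by exists x; [exact: Ox|reflexivity].
Qed.

Lemma le_supnorm f x : [bounded f x | x in Omega] -> Omega x -> `|f x| <= supnorm f.
Proof.
move=> [M [_ bf]] Ox; apply: ub_le_sup; last by exists x.
by exists (M + 1) => _ [y Oy <-]; apply: bf => //; rewrite ltrDl.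
Qed.

Lemma supnorm_le f M : 0 <= M -> (forall x, Omega x -> `|f x| <= M) -> supnorm f <= M.
Proof.
move=> M0 fM; have [[x Ox]|/set0P/negP/negPn/eqP O0] := pselect (Omega !=set0).
  by apply: ge_sup; [exists `|f x|, x|move=> _ [y Oy <-]; exact: fM].
by rewrite /supnorm O0 image_set0 sup0.
Qed.

End interval.

Section C0.
Context {R : realType} (T : R).

(* An element of C_0(0, T) is represented by its extension by 0 to R. *)
Definition C0_pred : {pred R -> R^o} := mem [set p : R -> R^o |
  [/\ {in Omega T, continuous p}, p x @[x --> 0^'+] --> 0,
      p x @[x --> T^'-] --> 0 & forall x, ~ Omega T x -> p x = 0]].

Lemma C0_submod_closed : submod_closed C0_pred.
Proof.
split; first by rewrite inE; split => //= ; [move=> x _; exact: cst_continuous|exact: cvg_cst|exact: cvg_cst].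
move=> a p q; rewrite !inE => -[cp p0 pT pO] [cq q0 qT qO]; split.
- move=> x xO; apply: (@continuousD _ _ _ (a *: p) q).
    by apply: continuousM; [exact: cst_continuous|exact: cp].
  exact: cq.
- rewrite -[X in _ --> X]addr0 -[X in _ --> X + _](mulr0 a).
  by apply: cvgD => //; apply: cvgM => //; exact: cvg_cst.
- rewrite -[X in _ --> X]addr0 -[X in _ --> X + _](mulr0 a).
  by apply: cvgD => //; apply: cvgM => //; exact: cvg_cst.
- by move=> x xO; rewrite /= !fctE pO// qO// scaler0 addr0.
Qed.

HB.instance Definition _ :=
  GRing.isSubmodClosed.Build R (R -> R^o) C0_pred C0_submod_closed.

Record C0 := MkC0 { C0_fun :> R -> R^o ; _ : C0_fun \in C0_pred }.

HB.instance Definition _ := [isSub for C0_fun].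
HB.instance Definition _ := [Choice of C0 by <:].
HB.instance Definition _ := [SubChoice_isSubLmodule of C0 by <:].

Lemma C0_within (p : C0) : {within `[0, T], continuous (p : R -> R)}.
Proof.
case: p => p/=; rewrite inE => -[cp p0 pT pO].
have [T0|T0] := ltP 0 T.
  have e0 : p 0 = 0 by apply: pO; rewrite /Omega/= in_itv/= ltxx.
  have eT : p T = 0 by apply: pO; rewrite /Omega/= in_itv/= ltxx andbF.
  apply/(continuous_within_itvP _ T0).
  by rewrite e0 eT; split => // x xO; apply: cp; rewrite inE.
have pE : p = cst 0.
  apply/funext => x; apply: pO; rewrite /Omega/= in_itv/= => /andP[x0 xT].
  by have := lt_le_trans (lt_trans x0 xT) T0; rewrite ltxx.
rewrite pE; apply: (@continuous_subspaceT _ _ _ (cst 0)).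
by move=> x; exact: cst_continuous.
Qed.

Let norm (p : C0) := supnorm T p.

Let norm_triangle (p q : C0) : norm (p + q) <= norm p + norm q.
Proof.
apply: supnorm_le => [|x Ox]; first by rewrite addr_ge0// supnorm_ge0.
apply: le_trans (ler_normD (p x) (q x)) _.
by apply: lerD; apply: le_supnorm => //; exact/segment_bounded/C0_within.
Qed.

Let normZ_le (a : R) (p : C0) : norm (a *: p) <= `|a| * norm p.
Proof.
apply: supnorm_le => [|x Ox]; first by rewrite mulr_ge0// supnorm_ge0.
rewrite [`|_|](normrM a (p x)) ler_wpM2l//.
by apply: le_supnorm => //; exact/segment_bounded/C0_within.
Qed.

Let normZ (a : R) (p : C0) : norm (a *: p) = `|a| * norm p.
Proof.
have [->|a0] := eqVneq a 0.
  rewrite normr0 mul0r; apply/eqP; rewrite eq_le supnorm_ge0 andbT.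
  by have := normZ_le 0 p; rewrite normr0 mul0r.
apply/eqP; rewrite eq_le normZ_le/=.
have := normZ_le a^-1 (a *: p).
by rewrite scalerK// normfV ler_pdivlMl// normr_gt0.
Qed.

Let norm0_eq0 (p : C0) : norm p = 0 -> p = 0.
Proof.
move=> p0; apply/val_inj/funext => x /=.
have [Ox|Ox] := pselect (Omega T x); last first.
  by case: p {p0} => p /=; rewrite inE => -[_ _ _]; exact.
apply/normr0_eq0/eqP; rewrite eq_le normr_ge0 andbT -p0.
by apply: le_supnorm => //; exact/segment_bounded/C0_within.
Qed.

HB.instance Definition _ :=
  Lmodule_isNormed.Build R C0 norm_triangle normZ norm0_eq0.

Definition C0a_pred : {pred C0} :=
  mem [set p : C0 | \int[lebesgue_measure]_(x in Omega T) p x = 0].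

Lemma C0a_submod_closed : submod_closed C0a_pred.
Proof.
split.
  rewrite inE/=; transitivity (\int[lebesgue_measure]_(x in Omega T) (0 : R)) => //.
  by rewrite Rintegral_cst ?mul0r//; exact: measurable_Omega.
move=> a p q; rewrite !inE /= => p0 q0.
have ip : lebesgue_measure.-integrable (Omega T) (EFin \o p).
  exact/segment_integrable/C0_within.
have iq : lebesgue_measure.-integrable (Omega T) (EFin \o q).
  exact/segment_integrable/C0_within.
have iap : lebesgue_measure.-integrable (Omega T) (EFin \o (fun x => a * p x)).
  exact: (@integrableZl _ (measurableTypeR R) R lebesgue_measure _ (measurable_Omega T) a (EFin \o p)).
transitivity (\int[lebesgue_measure]_(x in Omega T) (a * p x + q x)) => //.
rewrite RintegralD//; [|exact: measurable_Omega].
by rewrite RintegralZl// ?p0 ?q0 ?mulr0 ?addr0//; exact: measurable_Omega.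
Qed.

HB.instance Definition _ :=
  GRing.isSubmodClosed.Build R C0 C0a_pred C0a_submod_closed.

Record C0a := MkC0a { C0a_C0 :> C0 ; _ : C0a_C0 \in C0a_pred }.

HB.instance Definition _ := [isSub for C0a_C0].
HB.instance Definition _ := [Choice of C0a by <:].
HB.instance Definition _ := [SubChoice_isSubLmodule of C0a by <:].

Let norma (p : C0a) : R := `|C0a_C0 p|.

Let norma_triangle (p q : C0a) : norma (p + q) <= norma p + norma q.
Proof. exact: ler_normD. Qed.

Let normaZ (a : R) (p : C0a) : norma (a *: p) = `|a| * norma p.
Proof. exact: normrZ. Qed.

Let norma0_eq0 (p : C0a) : norma p = 0 -> p = 0.
Proof. by move=> /normr0_eq0 p0; exact: val_inj. Qed.

HB.instance Definition _ :=
  Lmodule_isNormed.Build R C0a norma_triangle normaZ norma0_eq0.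

End C0.

Section quot_lmod.
Context (K : nzRingType) (V : lmodType K) (W : submodClosed V).
Local Open Scope quotient_scope.

(* The quotient of a zmodType requires a zmodClosed predicate, which the
   library does not infer from submodClosed. *)
Definition submod_mem : {pred V} := fun u => u \in W.

Lemma submod_mem_zmod_closed : zmod_closed submod_mem.
Proof.
split; first exact: (rpred0 W).
move=> u v uW vW; rewrite -scaleN1r.
by apply: (rpredD (S := W)) => //; exact: (rpredZ (s := W)).
Qed.

HB.instance Definition _ :=
  GRing.isZmodClosed.Build V submod_mem submod_mem_zmod_closed.

Definition quot_lmod : Type := Quotient.quot submod_mem.

HB.instance Definition _ := EqQuotient.on quot_lmod.
HB.instance Definition _ := GRing.Zmodule.on quot_lmod.

Definition quot_pi (u : V) : quot_lmod := \pi_(Quotient.quot submod_mem) u.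

Lemma quot_piP (u v : V) : reflect (quot_pi u = quot_pi v) (u - v \in W).
Proof. by rewrite (Quotient.idealrBE submod_mem); exact: eqP. Qed.

Lemma quot_piK (x : quot_lmod) : quot_pi (repr x) = x.
Proof. exact: reprK. Qed.

Let quot_piD (u v : V) : quot_pi (u + v) = quot_pi u + quot_pi v.
Proof. by rewrite /quot_pi raddfD. Qed.

Definition quot_scale (a : K) (x : quot_lmod) : quot_lmod :=
  quot_pi (a *: repr x).

Let quot_piZ a u : quot_pi (a *: u) = quot_scale a (quot_pi u).
Proof.
apply/quot_piP; rewrite -scalerBr rpredZ//; apply/quot_piP.
by rewrite quot_piK.
Qed.

Let quot_scaleA a b x : quot_scale a (quot_scale b x) = quot_scale (a * b) x.
Proof. by rewrite -[x]quot_piK -!quot_piZ scalerA. Qed.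

Let quot_scale1 : left_id 1 quot_scale.
Proof. by move=> x; rewrite -[x]quot_piK -!quot_piZ scale1r. Qed.

Let quot_scaleDr : right_distributive quot_scale +%R.
Proof.
by move=> a x y; rewrite -[x]quot_piK -[y]quot_piK -quot_piD -!quot_piZ scalerDr quot_piD.
Qed.

Let quot_scaleDl x : {morph quot_scale^~ x : a b / a + b}.
Proof.
by move=> a b; rewrite -[x]quot_piK -!quot_piZ scalerDl quot_piD.
Qed.

HB.instance Definition _ := GRing.Zmodule_isLmodule.Build K quot_lmod
  quot_scaleA quot_scale1 quot_scaleDr quot_scaleDl.

Lemma quot_pi_is_linear : linear quot_pi.
Proof. by move=> a u v; rewrite quot_piD quot_piZ. Qed.

HB.instance Definition _ :=
  GRing.isLinear.Build K V quot_lmod _ quot_pi quot_pi_is_linear.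

End quot_lmod.

Section BV.
Context {R : realType} (T : R).
Local Notation mu := (@lebesgue_measure R).

Definition distributional_derivative (u : R -> R)
    (nu : {charge set (measurableTypeR R) -> \bar R}) : Prop :=
  forall phi, test_function T phi ->
    \int[mu]_(x in Omega T) (u x * phi^`()%classic x) =
    - charge_integral nu (Omega T) phi.

Definition BV_pred : {pred R -> R^o} := mem [set u : R -> R^o |
  mu.-integrable (Omega T) (EFin \o u) /\
  exists nu, distributional_derivative u nu].

Let mO : measurable (Omega T : set (measurableTypeR R)) := measurable_Omega T.

Lemma BV_test_integrable (u phi : R -> R) n :
  mu.-integrable (Omega T) (EFin \o u) -> test_function T phi ->
  mu.-integrable (Omega T) (EFin \o (fun x => u x * phi^`(n)%classic x)).
Proof.
move=> iu tphi; have c := test_continuous (n := n) tphi.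
exact: (@integrableMl _ (measurableTypeR R) R lebesgue_measure _ mO (EFin \o u)
  phi^`(n) iu (segment_measurable c) (segment_bounded c)).
Qed.

Lemma distributional_derivative_linear (a : R) (u v : R -> R) nu nv :
  mu.-integrable (Omega T) (EFin \o u) -> mu.-integrable (Omega T) (EFin \o v) ->
  distributional_derivative u nu -> distributional_derivative v nv ->
  distributional_derivative (fun x => a * u x + v x) (cadd (cscale a nu) nv).
Proof.
move=> iu iv Du Dv phi tphi; have c := test_continuous (n := 0) tphi.
have := BV_test_integrable 1 iv tphi; have := BV_test_integrable 1 iu tphi.
rewrite derive1n1 => iup ivp.
have iaup : mu.-integrable (Omega T) (EFin \o (fun x => a * (u x * phi^`()%classic x))).
  exact: (@integrableZl _ (measurableTypeR R) R mu _ mO a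
    (EFin \o (fun x => u x * phi^`()%classic x))).
rewrite (charge_integral_linear _ _ _ mO (segment_measurable c) (segment_bounded c)).
transitivity (\int[mu]_(x in Omega T) (a * (u x * phi^`()%classic x) + v x * phi^`()%classic x)).
  by apply: eq_Rintegral => x _; ring.
rewrite (@RintegralD _ (measurableTypeR R) R mu _
  (fun x => a * (u x * phi^`()%classic x)) (fun x => v x * phi^`()%classic x) mO iaup ivp).
rewrite (@RintegralZl _ (measurableTypeR R) R mu _ (fun x => u x * phi^`()%classic x) a mO iup).
by rewrite (Du _ tphi) (Dv _ tphi); ring.
Qed.

Lemma BV_submod_closed : submod_closed BV_pred.
Proof.
split.
  rewrite inE/=; split; first exact: (@integrable0 _ (measurableTypeR R)).
  exists czero => phi tphi; have c := test_continuous (n := 0) tphi.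
  rewrite (charge_integral_czero mO (segment_measurable c) (segment_bounded c)) oppr0.
  transitivity (\int[mu]_(x in Omega T) (0 : R)).
    by apply: eq_Rintegral => x _; rewrite [X in X * _](_ : _ = 0)// mul0r.
  by rewrite Rintegral_cst ?mul0r.
move=> a u v; rewrite !inE/= => -[iu [nu Du]] [iv [nv Dv]].
split.
  have iau : mu.-integrable (Omega T) (EFin \o (fun x => a * u x)).
    exact: (@integrableZl _ (measurableTypeR R) R lebesgue_measure _ mO a (EFin \o u)).
  exact: (@integrableD _ (measurableTypeR R) R lebesgue_measure _ mO _ _ iau iv).
exists (cadd (cscale a nu) nv).
exact: (distributional_derivative_linear a iu iv Du Dv).
Qed.

HB.instance Definition _ :=
  GRing.isSubmodClosed.Build R (R -> R^o) BV_pred BV_submod_closed.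

Record BV := MkBV { BV_fun :> R -> R^o ; _ : BV_fun \in BV_pred }.

HB.instance Definition _ := [isSub for BV_fun].
HB.instance Definition _ := [Choice of BV by <:].
HB.instance Definition _ := [SubChoice_isSubLmodule of BV by <:].

Lemma BV_derivative (u : BV) : exists nu, distributional_derivative u nu.
Proof. by case: u => u /=; rewrite inE => -[]. Qed.

(* Finite signed Borel measures on R stand for elements of M(0, T): only their
   restriction to (0, T), where the derivative is unique, is ever used. *)
Definition BV_deriv (u : BV) : {charge set (measurableTypeR R) -> \bar R} :=
  projT1 (cid (BV_derivative u)).

Definition normM (nu : {charge set (measurableTypeR R) -> \bar R}) : \bar R :=
  ereal_sup [set (charge_integral nu (Omega T) p)%:E |
    p in [set p : C0 T | `|p| <= 1]].

Definition normBV (u : BV) : \bar R :=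
  (\int[mu]_(x in Omega T) `|u x|%:E + normM (BV_deriv u))%E.

Definition TGV (alpha beta : R) (u : BV) : \bar R :=
  ereal_sup [set (\int[mu]_(x in Omega T) (u x * v^`(2)%classic x))%:E |
    v in [set v : R -> R | [/\ test_function T v,
      supnorm T v <= alpha & supnorm T v^`() <= beta]]].

(* Functions equal to an affine function almost everywhere on (0, T): since
   elements of BV are functions rather than a.e. classes, quotienting by this
   subspace performs the passage to a.e. classes as well. *)
Definition affine_pred : {pred BV} := mem [set u : BV | exists c d : R,
  {ae mu, forall x, Omega T x -> u x = c * x + d}].

Lemma affine_submod_closed : submod_closed affine_pred.
Proof.
split; first by rewrite inE; exists 0, 0; apply: aeW => x _ /=; rewrite mul0r addr0.
move=> a u v; rewrite !inE => -[c [d ul]] [c' [d' vl]].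
exists (a * c + c'), (a * d + d').
apply: (@filterS2 _ _ (ae_filter_ringOfSetsType mu) _ _ _ _ ul vl) => x u_x v_x Ox.
rewrite -[LHS]/(a * u x + v x) (u_x Ox) (v_x Ox); ring.
Qed.

HB.instance Definition _ :=
  GRing.isSubmodClosed.Build R BV affine_pred affine_submod_closed.

Definition BVL : Type := quot_lmod affine_pred.

HB.instance Definition _ := GRing.Lmodule.on BVL.
HB.instance Definition _ := EqQuotient.on BVL.

Definition BVL_class : BV -> BVL := quot_pi affine_pred.

Definition normBVL (x : BVL) : \bar R :=
  ereal_inf [set normBV u | u in [set u : BV | BVL_class u = x]].

Definition TGVL (alpha beta : R) (x : BVL) : \bar R := TGV alpha beta (repr x).

Definition pairing (x : BVL) (p : C0a T) : R :=
  charge_integral (BV_deriv (repr x)) (Omega T) p.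

End BV.

Section norms_and_duality.
Context {R : realType}.

(* Nonnegativity and N 0 = 0 follow from the clauses. *)
Definition is_norm (V : lmodType R) (N : V -> \bar R) : Prop :=
  [/\ forall x, N x \is a fin_num,
      forall x y, (N (x + y)%R <= N x + N y)%E,
      forall (a : R) x, N (a *: x) = (`|a|%:E * N x)%E &
      forall x, N x = 0%E -> x = 0].

Definition equivalent_norms (V : Type) (N1 N2 : V -> \bar R) : Prop :=
  exists c C : R, [/\ 0 < c, 0 < C &
    forall x, (c%:E * N2 x <= N1 x)%E /\ (N1 x <= C%:E * N2 x)%E].

Definition dual_norm (E : normedModType R) (f : E -> R) : \bar R :=
  ereal_sup [set `|f p|%:E | p in [set p : E | `|p| <= 1]].

(* x |-> b x is a linear bijection from (V, N) onto the topological dual of E,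
   bounded in both directions for N and the dual norm. *)
Definition dual_representation (V : lmodType R) (N : V -> \bar R)
    (E : normedModType R) (b : V -> E -> R) : Prop :=
  [/\ forall p, linear (fun x => b x p : R^o),
      forall x, linear (b x : E -> R^o) /\ continuous (b x),
      forall f : E -> R, linear (f : E -> R^o) -> continuous f ->
        exists! x, b x = f &
      equivalent_norms (fun x => dual_norm (b x)) N].

End norms_and_duality.

Section weak_star.
Context {R : realType} (V : choiceType) (E : Type) (b : V -> E -> R).

Definition weak_star : Type := initial_topology (b : V -> {ptws E -> R}).

HB.instance Definition _ :=
  Topological.copy weak_star (initial_topology (b : V -> {ptws E -> R})).

End weak_star.

Definition sequentially_compact (X : topologicalType) (A : set X) : Prop :=
  forall u : nat -> X, (forall n, A (u n)) ->
  exists s : nat -> nat, {homo s : m n / (m < n)%N} /\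
  exists2 x, A x & u (s n) @[n --> \oo] --> x.

(* Main.v *)
Require Import Defs.
From HB Require Import structures.
From mathcomp Require Import all_boot all_order all_algebra.
From mathcomp Require Import generic_quotient ring_quotient.
From mathcomp Require Import all_classical all_reals all_analysis.
From mathcomp Require Import measurable_realfun ring lra.

Set Implicit Arguments.
Unset Strict Implicit.
Unset Printing Implicit Defensive.

Import Order.TTheory GRing.Theory Num.Theory.
Import numFieldNormedType.Exports.

Local Open Scope ring_scope.
Local Open Scope classical_set_scope.

(* A class u + L is determined by the functional p |-> \int p dDu on C_{0,a}: if it
   vanishes, the lemma of du Bois-Reymond makes u affine. Test functions v have
   v' in C_{0,a}, and conversely derivatives of test functions are dense in
   C_{0,a}; as |v| <= T |v'|, the supremum defining TGV is comparable to the norm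
   of this functional, up to the factors beta and min(beta, alpha/T). Conversely a
   bounded functional on C_{0,a} extends to C_0 through a projection C_0 -> C_{0,a},
   is a signed measure by the Riesz representation theorem, and the distribution
   function u(x) = nu(]0, x]) of that measure is a preimage with |u| <= K, which
   bounds the quotient norm. Sequential compactness is Banach-Alaoglu for the dual
   of the separable space C_{0,a}. *)

(** * Smooth cutoff functions *)

(** Norms are compared through real upper bounds: [dual_bound x C] and [TGV_bound x t] say that a
    real number bounds the dual norm or TGV, and each equivalence is a transfer of such bounds with
    an explicit constant. Surjectivity of the pairing and the estimate of the quotient norm come
    from one construction: the preimage of a functional bounded by C has BV norm at most (k T + k)
    C, where k bounds the projection onto C_{0,a}. Mean-zero functions appear because the derivative
    of c x + d is c dx, which they integrate to 0. The obstacle in the Riesz step is the open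
    interval: the cutoffs that approximate half-lines equal 1 near 0 and so lie outside C_0. The
    positive part of a functional is therefore taken on bounded nonnegative continuous functions, as
    a supremum over the C_0 functions below them. Elsewhere, a mean-zero condition is enforced by
    subtracting a multiple of a bump of unit mass, and the explicit bumps are linear combinations of
    differences of two cutoffs. *)

Section smooth.
Context {R : realType}.
Implicit Types f g : R -> R.

(* [Ck n f]: f is n+1 times differentiable. *)
Inductive Ck : nat -> (R -> R) -> Prop :=
| Ck0 f : (forall x, derivable f x 1) -> Ck 0 f
| CkS n f : (forall x, derivable f x 1) -> Ck n f^`() -> Ck n.+1 f.

Lemma Ck_derivable n f : Ck n f -> forall x, derivable f x 1.
Proof. by case. Qed.

Lemma Ck_derive n f : Ck n.+1 f -> Ck n f^`().
Proof. by move=> c; inversion c. Qed.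

Lemma Ck_pred n f : Ck n.+1 f -> Ck n f.
Proof.
elim: n f => [|n IH] f cf; first exact: (Ck0 (Ck_derivable cf)).
by apply: (CkS (Ck_derivable cf)); apply/IH/Ck_derive.
Qed.

Lemma Ck_all f : (forall n, Ck n f) <-> forall n x, derivable f^`(n) x 1.
Proof.
split=> [sf n|df n].
  have := sf n; elim: n f {sf} => [|n IH] f cf x; first exact: (Ck_derivable cf).
  by rewrite derive1Sn; exact/IH/Ck_derive.
elim: n f df => [|n IH] f df; first exact: (Ck0 (df 0%N)).
by apply: (CkS (df 0%N)); apply: IH => m x; rewrite -derive1Sn; exact: df.
Qed.

Lemma Ck_ext n f g : f =1 g -> Ck n f -> Ck n g.
Proof. by move=> /funext ->. Qed.

Lemma Ck_cst n (a : R) : Ck n (fun=> a).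
Proof.
elim: n a => [|n IH] a; first by constructor => x; exact: derivable_cst.
constructor; first by move=> x; exact: derivable_cst.
by apply: Ck_ext (IH 0) => x; rewrite [RHS](derive1_cst a x).
Qed.

Lemma CkD n f g : Ck n f -> Ck n g -> Ck n (f \+ g).
Proof.
elim: n f g => [|n IH] f g cf cg; have df := Ck_derivable cf;
  have dg := Ck_derivable cg.
  by constructor => x; exact: derivableD (df x) (dg x).
constructor; first by move=> x; exact: derivableD (df x) (dg x).
apply: Ck_ext (IH _ _ (Ck_derive cf) (Ck_derive cg)) => x.
by rewrite /= !derive1E; exact/esym/(deriveD (df x) (dg x)).
Qed.

Lemma CkM n f g : Ck n f -> Ck n g -> Ck n (f \* g).
Proof.
elim: n f g => [|n IH] f g cf cg; have df := Ck_derivable cf;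
  have dg := Ck_derivable cg.
  by constructor => x; exact: derivableM (df x) (dg x).
constructor; first by move=> x; exact: derivableM (df x) (dg x).
have h := CkD (IH _ _ (Ck_pred cf) (Ck_derive cg)) (IH _ _ (Ck_pred cg) (Ck_derive cf)).
apply: Ck_ext h => x.
by rewrite /= !derive1E; exact/esym/(deriveM (df x) (dg x)).
Qed.

Lemma CkV n f : (forall x, f x != 0) -> Ck n f -> Ck n (fun x => (f x)^-1).
Proof.
move=> f0; elim: n => [|n IH] cf; have df := Ck_derivable cf.
  by constructor => x; exact: derivableV (f0 x) (df x).
constructor; first by move=> x; exact: derivableV (f0 x) (df x).
have cfV := IH (Ck_pred cf).
apply: Ck_ext (CkM (CkM (Ck_cst n (-1)) (CkM cfV cfV)) (Ck_derive cf)) => x.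
rewrite !derive1E (deriveV (f0 x) (df x)) -derive1E [RHS]/( _ * _) /=.
by congr (_ * _); rewrite expr2 invfM mulN1r.
Qed.

Lemma is_derive_affine (a b x : R) : is_derive x (1 : R) (fun x => a * x + b) a.
Proof.
have := is_deriveD (is_deriveZ a (is_derive_id x (1 : R))) (is_derive_cst b x (1 : R)).
by rewrite addr0 /GRing.scale/= mulr1.
Qed.

Lemma Ck_affine n f (a b : R) : Ck n f -> Ck n (fun x => f (a * x + b)).
Proof.
have dc g x : (forall x, derivable g x 1) -> is_derive x (1 : R) (fun x => g (a * x + b)) ('D_1 g (a * x + b) * a).
  move=> dg; apply: (@is_derive1_comp _ g (fun x => a * x + b)); last exact: is_derive_affine.
  exact: DeriveDef.
elim: n f => [|n IH] f cf; have df := Ck_derivable cf.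
  by constructor => x; case: (dc f x df).
constructor; first by move=> x; case: (dc f x df).
apply: Ck_ext (CkM (IH _ (Ck_derive cf)) (Ck_cst n a)) => x.
by rewrite /= !derive1E; case: (dc f x df) => _ ->.
Qed.

(* The powers x^-k make this family closed under differentiation up to linear
   combinations; its value at x <= 0 does not depend on k. *)
Definition flat (k : nat) (x : R) : R := if 0 < x then x^-1 ^+ k * expR (- x^-1) else 0.

Lemma flat_le0 k x : x <= 0 -> flat k x = 0.
Proof. by rewrite /flat leNgt => /negbTE ->. Qed.

Lemma flat_gt0 k x : 0 < x -> 0 < flat k x.
Proof.
by move=> x0; rewrite /flat x0 mulr_gt0 ?expR_gt0// exprn_gt0// invr_gt0.
Qed.

Lemma flat_ge0 k x : 0 <= flat k x.
Proof. by have [/flat_le0->|/(flat_gt0 k)/ltW] := leP x 0. Qed.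

(** From exp y >= y^(k+1) / (k+1)! at y = 1/x: the one spare power of x makes [flat k] tend to 0 at
    0. *)
Lemma flat_bound k x : 0 < x -> flat k x <= (k.+1)`!%:R * x.
Proof.
move=> x0; rewrite /flat x0 expRN ler_pdivrMr ?expR_gt0//.
have y0 : 0 <= x^-1 by rewrite invr_ge0 ltW.
have := @expR_ge1Dxn _ x^-1 k y0 => h.
have {h} : x^-1 ^+ k.+1 / (k.+1)`!%:R <= expR x^-1 by apply: le_trans h; rewrite lerDr.
rewrite ler_pdivrMr ?ltr0n ?fact_gt0// => h.
have := ler_wpM2l (ltW x0) h.
rewrite exprS mulrA divff ?gt_eqF// mul1r => /le_trans; apply.
by rewrite le_eqVlt; apply/orP; left; apply/eqP; ring.
Qed.

Lemma flat_cvg0 k : {for (0 : R), continuous (flat k)}.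
Proof.
rewrite /prop_for /continuous_at (flat_le0 _ (lexx 0)).
apply/cvgr0Pnorm_lt => e e0; near=> x.
have [x0|x0] := leP x 0; first by rewrite flat_le0// normr0.
rewrite ger0_norm ?flat_ge0//; apply: le_lt_trans (flat_bound k x0) _.
rewrite -ltr_pdivlMl ?ltr0n ?fact_gt0//.
suff : `|0 - x| < k.+1`!%:R^-1 * e by rewrite sub0r normrN gtr0_norm.
near: x; apply: (@nbhsx_ballx R R 0).
by rewrite mulr_gt0// invr_gt0 ltr0n fact_gt0.
Unshelve. all: by end_near. Qed.

Lemma flat_is_derive k (x : R) :
  is_derive x (1 : R) (flat k) (- k%:R * flat k.+1 x + flat k.+2 x).
Proof.
have [x0|x0|->] := ltgtP x 0.
- rewrite !(flat_le0 _ (ltW x0)) mulr0 addr0.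
  apply: (near_eq_is_derive _ (is_derive_cst (0 : R) x (1 : R))).
  by near=> y; rewrite flat_le0// ltW//; near: y; exact: lt_nbhsl.
- have xn0 : x != 0 by rewrite gt_eqF.
  have dV : is_derive x (1 : R) (fun y : R => y^-1) (- (x ^- 2)).
    have := @is_deriveV _ (@id R) x 1 1 xn0 (is_derive_id _ _).
    by rewrite /GRing.scale/= mulr1.
  have d1 : is_derive x (1 : R) (fun y : R => y^-1 ^+ k) (k%:R * x^-1 ^+ k.-1 * (- (x ^- 2))).
    rewrite (_ : (fun y : R => y^-1 ^+ k) = (fun y : R => y^-1) ^+ k).
      exact: (@is_deriveX _ _ (fun y : R => y^-1) k x 1 _ dV).
    by apply/funext => y; rewrite exprfctE.
  have d2 : is_derive x (1 : R) (fun y : R => expR (- y^-1)) (expR (- x^-1) * x ^- 2).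
    have := @is_derive1_comp _ expR (fun y : R => - y^-1) x _ _ (is_derive_expR _) (is_deriveN dV).
    by rewrite opprK.
  have d3 : is_derive x (1 : R) (fun y : R => y^-1 ^+ k * expR (- y^-1))
      (x^-1 ^+ k * (expR (- x^-1) * x ^- 2) + expR (- x^-1) * (k%:R * x^-1 ^+ k.-1 * (- (x ^- 2)))).
    exact: is_deriveM d1 d2.
  apply: (@is_derive_eq _ _ _ _ _ _ _ _ (near_eq_is_derive _ d3)).
    by near=> y; rewrite /flat ifT//; near: y; exact: lt_nbhsr.
  rewrite /flat x0 -exprVn; case: (k) => [|k']; first by rewrite !expr0 !expr2; ring.
  by rewrite /= !exprS expr0; ring.
- rewrite !(flat_le0 _ (lexx 0)) mulr0 addr0.
  (* The slope of [flat k] at 0 is [flat k.+1], since division by z adds one power of 1/z; its value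
     at 0 is 0. *)
  apply/is_derive1_caratheodory; exists (flat k.+1); split; [|exact: flat_cvg0|exact: flat_le0].
  move=> z; rewrite (flat_le0 _ (lexx 0)) !subr0 /flat; case: ifPn => z0; last by rewrite mul0r.
  rewrite exprS -!mulrA mulrC mulrA mulrAC; congr (_ * _).
  by rewrite mulrCA mulVf ?gt_eqF// mulr1.
Unshelve. all: by end_near. Qed.

Lemma Ck_flat n k : Ck n (flat k).
Proof.
elim: n k => [|n IH] k; first by constructor => x; case: (flat_is_derive k x).
constructor; first by move=> x; case: (flat_is_derive k x).
apply: Ck_ext (CkD (CkM (Ck_cst n (- k%:R)) (IH k.+1)) (IH k.+2)) => x.
by rewrite derive1E; case: (flat_is_derive k x) => _ ->.
Qed.

(** The usual smooth transition from 0 on x <= 0 to 1 on x >= 1; the denominator is positive because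
    x and 1 - x are never both nonpositive. *)
Definition sstep (x : R) : R := flat 0 x / (flat 0 x + flat 0 (1 - x)).

Let sstep_den x : 0 < flat 0 x + flat 0 (1 - x).
Proof.
have [x0|x0] := leP x 0; last by rewrite ltr_wpDr ?flat_ge0 ?flat_gt0.
by rewrite ltr_wpDl ?flat_ge0 ?flat_gt0// subr_gt0 (le_lt_trans x0).
Qed.

Lemma sstep_le0 x : x <= 0 -> sstep x = 0.
Proof. by move=> x0; rewrite /sstep flat_le0// mul0r. Qed.

Lemma sstep_ge1 x : 1 <= x -> sstep x = 1.
Proof.
move=> x1; rewrite /sstep (flat_le0 _ (_ : 1 - x <= 0)) ?subr_le0// addr0 divff//.
by rewrite gt_eqF// flat_gt0// (lt_le_trans ltr01).
Qed.

Lemma sstep_itv x : 0 <= sstep x <= 1.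
Proof.
rewrite /sstep ler_pdivlMr ?sstep_den// ler_pdivrMr ?sstep_den// mul0r mul1r flat_ge0/=.
by rewrite lerDl flat_ge0.
Qed.

Lemma Ck_sstep n : Ck n sstep.
Proof.
have c1 : Ck n (fun x => flat 0 (1 - x)).
  apply: Ck_ext (Ck_affine (-1) 1 (Ck_flat n 0)) => x.
  by congr (flat 0 _); ring.
apply: CkM (Ck_flat n 0) (CkV _ (CkD (Ck_flat n 0) c1)) => x.
by rewrite gt_eqF// sstep_den.
Qed.

(** Smooth stand-in for the indicator of a half-line: 1 up to a, 0 from b on. *)
Definition cut (a b x : R) : R := sstep ((b - x) / (b - a)).

Lemma cut_left a b x : a < b -> x <= a -> cut a b x = 1.
Proof. by move=> ab xa; rewrite /cut sstep_ge1// ler_pdivlMr ?subr_gt0//; lra. Qed.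

Lemma cut_right a b x : a < b -> b <= x -> cut a b x = 0.
Proof. by move=> ab xa; rewrite /cut sstep_le0// ler_pdivrMr ?subr_gt0//; lra. Qed.

Lemma cut_itv a b x : 0 <= cut a b x <= 1.
Proof. exact: sstep_itv. Qed.

Lemma Ck_cut n a b : Ck n (cut a b).
Proof.
apply: Ck_ext (Ck_affine (- (b - a)^-1) (b / (b - a)) (Ck_sstep n)) => x.
by rewrite /cut; congr sstep; ring.
Qed.

Lemma Ck_continuous n f : Ck n f -> continuous f.
Proof.
by move=> /Ck_derivable df x; apply/differentiable_continuous/derivable1_diffP.
Qed.

End smooth.

(** * Functions vanishing at the boundary *)

Lemma compact_uniform_continuity {R : realType} (K : set R) (f : R -> R) (e : R) :
  compact K -> continuous f -> 0 < e ->
  exists2 d, 0 < d & forall x y, K x -> `|x - y| < d -> `|f x - f y| < e.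
Proof.
move=> /compact_near_coveringP cK cf e0.
pose P (d x : R) := forall y, `|x - y| < d -> `|f x - f y| < e.
have : \forall d \near 0^'+, K `<=` P d.
  apply: cK => x Kx.
  have e20 : 0 < e / 2 by rewrite divr_gt0.
  have /cvgrPdist_lt/(_ _ e20) := cf x.
  move=> /nbhs_ballP[r /= r0 rP].
  have r20 : 0 < r / 2 by rewrite divr_gt0.
  near=> z d => y zy.
  have zx : ball x (r / 2) z by near: z; apply: nbhsx_ballx.
  have dr : d < r / 2 by near: d; exact: nbhs_right_lt.
  have h1 : `|f x - f z| < e / 2.
    by apply: rP; apply: le_ball zx; move: r0; lra.
  have h2 : `|f x - f y| < e / 2.
    apply: rP; rewrite /ball/= (splitr r) (_ : x - y = (x - z) + (z - y)); last ring.
    by rewrite (le_lt_trans (ler_normD _ _))// ltrD// (lt_trans zy).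
  rewrite (splitr e) (_ : f z - f y = (f z - f x) + (f x - f y)); last ring.
  by rewrite (le_lt_trans (ler_normD _ _))// ltrD// distrC.
move=> h.
near (0 : R)^'+ => d; exists d => //.
by move=> x y Kx; apply: (near h d).
Unshelve. all: by end_near. Qed.

Section C0_facts.
Context {R : realType} (T : R) (T0 : 0 < T).
Local Notation Om := (Omega T).

Lemma C0_out (p : C0 T) x : ~ Om x -> p x = 0.
Proof. by case: p => p /=; rewrite inE => -[_ _ _]; exact. Qed.

(** The limits 0 at the two endpoints glue the function to its extension by 0, so members of C_0 can
    be treated as continuous functions on the whole line. *)
Lemma C0_continuous (p : C0 T) : continuous (p : R -> R).
Proof.
case: p => p/=; rewrite inE => -[cp p0 pT pO] x.
have out0 y : y <= 0 -> p y = 0.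
  by move=> y0; apply: pO; rewrite /Omega/= in_itv/= => /andP[]; rewrite ltNge y0.
have outT y : T <= y -> p y = 0.
  by move=> y0; apply: pO; rewrite /Omega/= in_itv/= => /andP[_]; rewrite ltNge y0.
have [x0|x0|->] := ltgtP x 0.
- rewrite /continuous_at out0 ?ltW//; apply: cvg_near_cst.
  by near=> y; apply: out0; rewrite ltW//; near: y; exact: lt_nbhsl.
- have [xT|xT|->] := ltgtP x T.
  + by apply: cp; rewrite inE /Omega/= in_itv/= x0.
  + rewrite /continuous_at outT ?ltW//; apply: cvg_near_cst.
    by near=> y; apply: outT; rewrite ltW//; near: y; exact: lt_nbhsr.
  + apply/left_right_continuousP; rewrite outT//; split => //.
    by apply: cvg_near_cst; near=> y; apply: outT; near: y; exact: nbhs_right_ge.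
- apply/left_right_continuousP; rewrite out0//; split => //.
  by apply: cvg_near_cst; near=> y; apply: out0; near: y; exact: nbhs_left_le.
Unshelve. all: by end_near. Qed.

Lemma C0_predI (f : R -> R) : continuous f -> (forall x, ~ Om x -> f x = 0) ->
  f \in C0_pred T.
Proof.
move=> cf f0; rewrite inE; split => //.
- rewrite -[X in _ --> X](f0 0); first exact/cvg_at_right_filter/cf.
  by rewrite /Omega/= in_itv/= ltxx.
- rewrite -[X in _ --> X](f0 T); first exact/cvg_at_left_filter/cf.
  by rewrite /Omega/= in_itv/= ltxx andbF.
Qed.

Definition toC0 (f : R -> R) (cf : continuous f) (f0 : forall x, ~ Om x -> f x = 0) : C0 T :=
  MkC0 (C0_predI cf f0).

Lemma C0_le_norm (p : C0 T) x : `|p x| <= `|p|.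
Proof.
have [Ox|Ox] := pselect (Om x); last by rewrite C0_out// normr0.
by apply: le_supnorm => //; exact/segment_bounded/C0_within.
Qed.

Lemma C0_norm_le (p : C0 T) M : 0 <= M -> (forall x, Om x -> `|p x| <= M) -> `|p| <= M.
Proof. exact: supnorm_le. Qed.

Definition node (N i : nat) : R := i%:R * T / N%:R.

(** Differences of consecutive cutoffs sum to 1 minus the first cutoff, which lives near 0 where p
    is small; each is supported within one mesh of the node that carries its coefficient. The
    transition points stay free because three choices are made later: fixed ones for density,
    shrinking ones for step functions, nearly optimal ones for the Riesz measure. *)
Lemma partition_of_unity_approx (p : C0 T) (e : R) : 0 < e ->
  exists2 N0 : nat, (0 < N0)%N & forall N (a b : nat -> R), (N0 <= N)%N ->
    (forall i, node N i < a i /\ a i < b i /\ b i < node N i.+1) ->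
    forall y, Om y ->
    `|p y - \sum_(i < N) p (node N i.+1) * (cut (a i.+1) (b i.+1) y - cut (a i) (b i) y)| <= e.
Proof.
move=> e0.
have [d d0 dP] := compact_uniform_continuity (@segment_compact R 0 T) (@C0_continuous p) e0.
pose N0 := (Num.truncn (T / d)).+1.
exists N0 => // N a b NN0 abP y; rewrite /Omega/= in_itv/= => /andP[y0 yT].
have N0' : 0 < N%:R :> R by rewrite ltr0n; exact: leq_trans NN0.
have stepd : T / N%:R < d.
  rewrite ltr_pdivrMr// mulrC -ltr_pdivrMr//.
  by apply: (lt_le_trans (truncnS_gt _)); rewrite ler_nat.
have nodeS i : node N i.+1 = node N i + T / N%:R.
  by rewrite /node -addn1 natrD mulrDl mul1r mulrDl.
have node_le i j : (i <= j)%N -> node N i <= node N j.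
  by move=> ij; rewrite /node ler_wpM2r ?invr_ge0 ?ler0n// ler_wpM2r ?ler_nat// ltW.
have node0 : node N 0 = 0 by rewrite /node !mul0r.
have nodeN : node N N = T by rewrite /node mulrAC divff ?mul1r// gt_eqF.
pose k i := cut (a i) (b i) y.
(* The last cutoff is 1 at y, as its transition starts beyond T. *)
have tele : \sum_(i < N) (k i.+1 - k i) = 1 - k 0%N.
  rewrite -(big_mkord xpredT (fun i => k i.+1 - k i)) telescope_sumr//; congr (_ - _).
  have [aN [aN' _]] := abP N.
  by rewrite /k cut_left//; move: aN; rewrite nodeN; lra.
(* The transition zones are disjoint and ordered: at y, either cutoff i has already dropped to 0 or
   cutoff i + 1 is still 1. *)
have th0 i : 0 <= k i.+1 - k i.
  have [ai [abi bi]] := abP i; have [ai' [abi' _]] := abP i.+1.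
  have := cut_itv (a i) (b i) y; have := cut_itv (a i.+1) (b i.+1) y.
  have [yb|yb] := leP (b i) y; first by rewrite /k (cut_right abi yb); lra.
  rewrite /k [cut (a i.+1) _ _]cut_left//; lra.
have thsupp i : k i.+1 - k i != 0 -> `|y - node N i.+1| < d.
  have [ai [abi bi]] := abP i; have [ai' [abi' bi']] := abP i.+1.
  move=> h; rewrite ltr_norml; apply/andP; split.
    rewrite ltNge; apply: contra h => h; rewrite /k !cut_left ?subrr//; last first.
      by move: (nodeS i); lra.
    by move: (nodeS i); lra.
  rewrite ltNge; apply: contra h => h; rewrite /k !cut_right ?subrr//.
    by move: (nodeS i); lra.
  by move: (nodeS i.+1); lra.
(* Where the first cutoff is nonzero, y is within d of 0, and p vanishes at 0. *)
have pk0 : `|p y * k 0%N| <= e * k 0%N.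
  have /andP[k00 k01] : 0 <= k 0%N <= 1 := cut_itv _ _ _.
  rewrite normrM (ger0_norm k00).
  have [a0 [ab0 b0]] := abP 0%N; move: (nodeS 0%N) => n1; rewrite node0 add0r in n1.
  have [yb|yb] := leP (b 0%N) y; first by rewrite /k cut_right// !mulr0.
  apply: ler_wpM2r => //.
  have -> : p y = p y - p 0.
    by rewrite (C0_out p (x := 0)) ?subr0// /Omega/= in_itv/= ltxx.
  apply: ltW; apply: dP; first by rewrite /= in_itv/= !ltW.
  by rewrite subr0 gtr0_norm//; lra.
have -> : p y - \sum_(i < N) p (node N i.+1) * (k i.+1 - k i) =
    p y * k 0%N + \sum_(i < N) (p y - p (node N i.+1)) * (k i.+1 - k i).
  transitivity (p y * k 0%N + (p y * (\sum_(i < N) (k i.+1 - k i)) -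
     \sum_(i < N) p (node N i.+1) * (k i.+1 - k i))); first by rewrite tele; ring.
  by rewrite mulr_sumr -sumrB; congr (_ + _); apply: eq_bigr => i _; ring.
apply: le_trans (ler_normD _ _) _.
have -> : e = e * k 0%N + e * \sum_(i < N) (k i.+1 - k i) by rewrite tele; ring.
apply: lerD => //; rewrite mulr_sumr.
apply: le_trans (ler_norm_sum _ _ _) _; apply: ler_sum => i _.
rewrite normrM (ger0_norm (th0 i)).
have [->|h] := eqVneq (k i.+1 - k i) 0; first by rewrite !mulr0.
apply: ler_wpM2r => //; apply: ltW; apply: dP; last exact: thsupp.
by rewrite /= in_itv/= !ltW.
Qed.

End C0_facts.

(** * Test functions *)

Section calculus.
Context {R : realType}.
Local Notation mu := (@lebesgue_measure R).

Lemma continuous_integrable_itv (f : R -> R) (i : interval R) (a b : R) :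
  continuous f -> [set` i] `<=` `[a, b]%classic ->
  mu.-integrable [set` i] (EFin \o f).
Proof.
move=> cf iab.
apply: (@integrableS _ (measurableTypeR R) R mu `[a, b]%classic) => //.
apply: continuous_compact_integrable; first exact: segment_compact.
exact: continuous_subspaceT.
Qed.

Lemma Rintegral_derive (F f : R -> R) (a b : R) : a <= b ->
  (forall x, is_derive x (1 : R) F (f x)) -> continuous f ->
  \int[mu]_(x in `]a, b[) f x = F b - F a.
Proof.
rewrite le_eqVlt => /predU1P[<- _ _|ab dF cf].
  by rewrite set_itv_ge ?bnd_simp ?lexx// Rintegral_set0 subrr.
have fi (i : interval R) : [set` i] `<=` `[a, b]%classic -> mu.-integrable [set` i] (EFin \o f).
  exact: continuous_integrable_itv.
rewrite Rintegral_itv_bndo_bndc; last by apply: fi; exact: subset_itv_oo_cc.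
rewrite Rintegral_itv_obnd_cbnd; last by apply: fi; exact: subset_itv_oc_cc.
have cF : continuous F.
  move=> x; apply/differentiable_continuous/derivable1_diffP.
  by case: (dF x).
rewrite /Rintegral (@continuous_FTC2 R f F a b)//.
- exact: continuous_subspaceT.
- split; [by move=> x _; case: (dF x)| |].
  + exact/cvg_at_right_filter/cF.
  + exact/cvg_at_left_filter/cF.
- by move=> x _; rewrite derive1E; case: (dF x).
Qed.

Lemma derive_out (v : R -> R) (x : R) :
  ~ closure [set y | v y != 0] x -> v^`()%classic x = 0.
Proof.
move=> nx; rewrite derive1E.
have [] := near_eq_is_derive (f := cst (0 : R)) (g := v) (a := x) (v := (1 : R)) (df := 0).
- have := open_nbhs_nbhs (conj (closed_openC (@closed_closure _ [set y | v y != 0])) nx).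
  apply: filterS => y ny /=; apply/esym/eqP/negPn/negP => vy.
  by apply: ny; exact: subset_closure.
- by [].
Qed.

End calculus.

Section test_functions.
Context {R : realType} (T : R) (T0 : 0 < T).
Local Notation mu := (@lebesgue_measure R).
Local Notation Om := (Omega T).
Implicit Types v q : R -> R.

Lemma lebesgue_Omega : mu Om = T%:E.
Proof. by rewrite [LHS](lebesgue_measure_itv `]0, T[%R)/= lte_fin T0 -EFinB subr0. Qed.

Lemma test_out v x : test_function T v -> ~ Om x -> v x = 0.
Proof.
move=> [_ _ sv] nx; apply/eqP/negPn/negP => vx; apply: nx; apply: sv.
exact: subset_closure.
Qed.

Lemma test_is_derive v x : test_function T v -> is_derive x (1 : R) v (v^`()%classic x).
Proof. by move=> [dv _ _]; rewrite derive1E; apply: DeriveDef => //; exact: (dv 0%N). Qed.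

Lemma test_derive v : test_function T v -> test_function T v^`()%classic.
Proof.
move=> [dv cv sv].
have svv : closure [set x | v^`()%classic x != 0] `<=` closure [set x | v x != 0].
  rewrite [X in _ `<=` X](closure_id _).1; last exact: closed_closure.
  apply: closure_subset => x /= /eqP v'x; apply: contrapT => nx; apply: v'x.
  exact: derive_out.
split; first by move=> n x; rewrite -derive1Sn.
  by apply: (subclosed_compact _ cv) => //; exact: closed_closure.
exact: subset_trans sv.
Qed.

Lemma test_continuousT v : test_function T v -> continuous v.
Proof.
by move=> tv x; apply/differentiable_continuous/derivable1_diffP;
  case: (test_is_derive x tv).
Qed.

Definition test_C0 v (tv : test_function T v) : C0 T :=
  toC0 (test_continuousT tv) (fun x => test_out tv).

Lemma Rintegral_test_derive v : test_function T v ->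
  \int[mu]_(x in Om) v^`()%classic x = 0.
Proof.
move=> tv; rewrite (Rintegral_derive (ltW T0) (fun x => test_is_derive x tv)).
  by rewrite !(test_out tv) ?subrr// /Omega/= in_itv/= ltxx ?andbF.
exact/test_continuousT/test_derive.
Qed.

(** Integration by parts: the distributional derivative of c x + d is c dx. This is what makes the
    pairing with mean-zero functions blind to affine terms. *)
Lemma Rintegral_affine_test_derive (c d : R) v : test_function T v ->
  \int[mu]_(x in Om) ((c * x + d) * v^`()%classic x) = - (c * \int[mu]_(x in Om) v x).
Proof.
move=> tv.
have caff : continuous (fun x : R => c * x + d).
  by move=> x; apply/differentiable_continuous/derivable1_diffP; case: (is_derive_affine c d x).
have cv := test_continuousT tv; have cv' := test_continuousT (test_derive tv).
have c1 : continuous (fun x : R => (c * x + d) * v^`()%classic x).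
  by move=> x; exact: continuousM (caff x) (cv' x).
have c2 : continuous (fun x : R => c * v x).
  by move=> x; exact: continuousM (@cst_continuous R R c x) (cv x).
have : \int[mu]_(x in Om) ((c * x + d) * v^`()%classic x + c * v x) = 0.
  have dF (x : R) : is_derive x (1 : R) (fun x => (c * x + d) * v x)
      ((c * x + d) * v^`()%classic x + c * v x).
    have := is_deriveM (is_derive_affine c d x) (test_is_derive x tv).
    by rewrite /GRing.scale/= [v x * c]mulrC.
  rewrite (Rintegral_derive (ltW T0) dF); last first.
    by move=> x; exact: continuousD (c1 x) (c2 x).
  by rewrite !(test_out tv) ?mulr0 ?subrr// /Omega/= in_itv/= ltxx ?andbF.
rewrite (@RintegralD _ _ _ mu)//; last 3 first.
- exact: measurable_Omega.
- by apply: continuous_integrable_itv c1 _; exact: subset_itv_oo_cc.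
- by apply: continuous_integrable_itv c2 _; exact: subset_itv_oo_cc.
rewrite (@RintegralZl _ _ _ mu)//; last 2 first.
- exact: measurable_Omega.
- by apply: continuous_integrable_itv cv _; exact: subset_itv_oo_cc.
by move=> /eqP; rewrite addr_eq0 => /eqP.
Qed.

(* Smooth functions with an explicit compact support, easier to combine than
   [test_function] with its closure. *)
Definition bump v := (forall n, Ck n v) /\
  exists a b, [/\ 0 < a, b < T & forall x, ~~ (a <= x <= b) -> v x = 0].

Lemma bump_test v : bump v -> test_function T v.
Proof.
move=> [cv [a [b [a0 bT vab]]]].
have vS : closure [set x | v x != 0] `<=` `[a, b]%classic.
  rewrite [X in _ `<=` X](closure_id _).1; last exact: itv_closed.
  apply: closure_subset => x /= vx; rewrite in_itv/=.
  by apply/negPn/negP => /vab v0; move: vx; rewrite v0 eqxx.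
split.
- exact/Ck_all.
- by apply: (subclosed_compact _ (@segment_compact R a b)) => //; exact: closed_closure.
- move=> x /vS; rewrite /Omega/= !in_itv/= => /andP[ax xb].
  by rewrite (lt_le_trans a0 ax) (le_lt_trans xb bT).
Qed.

Lemma bump_linear (c : R) v q : bump v -> bump q -> bump (fun x => c * v x + q x).
Proof.
move=> [cv [a [b [a0 bT vab]]]] [cq [a' [b' [a'0 bT' qab]]]]; split.
  by move=> n; exact: CkD (CkM (Ck_cst n c) (cv n)) (cq n).
exists (Num.min a a'), (Num.max b b'); split.
- by rewrite lt_min a0.
- by rewrite gt_max bT.
- move=> x; rewrite ge_min le_max => h.
  rewrite vab ?qab ?mulr0 ?addr0//; apply: contra h => /andP[-> ->]; rewrite ?orbT//.
Qed.

Lemma bump0 : bump (fun=> 0).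
(* Swapped endpoints describe an empty support interval. *)
Proof. by split; [move=> n; exact: Ck_cst|exists T, 0]. Qed.

Lemma bump_sum n (c : nat -> R) (f : nat -> R -> R) : (forall i, (i < n)%N -> bump (f i)) ->
  bump (fun x => \sum_(i < n) c i * f i x).
Proof.
elim: n => [|n IH] bf.
  rewrite (_ : (fun x => _) = fun=> 0); first exact: bump0.
  by apply/funext => x; rewrite big_ord0.
rewrite (_ : (fun x => _) = (fun x => c n * f n x + \sum_(i < n) c i * f i x)).
  by apply: bump_linear; [exact: bf|apply: IH => i ni; exact/bf/ltnW].
by apply/funext => x; rewrite big_ord_recr/= addrC.
Qed.

Lemma bump_cutB (a b c d : R) : 0 < a -> a < b -> b < T -> 0 < c -> c < d -> d < T ->
  bump (fun x => cut c d x - cut a b x).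
Proof.
move=> a0 ab bT c0 cd dT; split.
  move=> n; apply: Ck_ext (CkD (Ck_cut n c d) (CkM (Ck_cst n (-1)) (Ck_cut n a b))) => x /=.
  by rewrite mulN1r.
exists (Num.min a c), (Num.max b d); split.
- by rewrite lt_min a0.
- by rewrite gt_max bT.
- move=> x; rewrite negb_and -!ltNge lt_min gt_max => /orP[] /andP[h1 h2].
    by rewrite !cut_left ?subrr// ltW.
  by rewrite !cut_right ?subrr// ltW.
Qed.

(** A countable family whose finite combinations approximate C_0; it serves density here and
    separability at the end. The hat vanishes below node i + h/4 and above node (i+1) + h/2. *)
Definition hat (N i : nat) (x : R) : R :=
  let h := T / N%:R in
  cut (node T N i.+1 + h / 4) (node T N i.+1 + h / 2) x -
  cut (node T N i + h / 4) (node T N i + h / 2) x.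

Lemma hat_bump N i : (i.+1 < N)%N -> bump (hat N i).
Proof.
move=> iN; have N0 : (0 < N)%N by case: N iN.
pose h := T / N%:R; have h0 : 0 < h by rewrite divr_gt0// ltr0n.
have nodeE j : node T N j = j%:R * h by rewrite /node mulrA.
have Th : T = N%:R * h by rewrite /h mulrCA divff ?mulr1// pnatr_eq0 -lt0n.
have i0 : 0 <= i%:R * h by rewrite mulr_ge0// ltW.
have iT : (i.+2)%:R * h <= T.
  by rewrite [leRHS]Th; apply: ler_wpM2r; [exact: ltW|rewrite ler_nat].
apply: bump_cutB; rewrite -/h.
all: by move: iT; rewrite !nodeE -(natr1 i.+1) -(natr1 i) !mulrDl !mul1r; lra.
Qed.

Lemma hat_dense (p : C0 T) (e : R) : 0 < e ->
  exists N, forall x, Om x ->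
    `|p x - \sum_(i < N.-1) p (node T N i.+1) * hat N i x| <= e.
Proof.
move=> e0; have [N0 N00 /(_ N0)] := partition_of_unity_approx T0 p e0.
pose h := T / N0%:R.
have h0 : 0 < h by rewrite divr_gt0// ltr0n.
have nodeE i : node T N0 i = i%:R * h by rewrite /node mulrA.
have Th : T = N0%:R * h by rewrite /h mulrCA divff ?mulr1// pnatr_eq0 -lt0n.
move=> /(_ (fun i => node T N0 i + h / 4) (fun i => node T N0 i + h / 2) (leqnn _)) H.
exists N0 => x Ox; apply: le_trans (H _ x Ox); last first.
  by move=> i; rewrite !nodeE -(natr1 i) mulrDl mul1r; split; [|split]; lra.
rewrite le_eqVlt; apply/orP; left; apply/eqP; congr (`|_ - _|).
(* The last hat would reach beyond T, but its coefficient is p(T) = 0; dropping it leaves bumps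
   only. *)
rewrite -[in RHS](prednK N00) big_ord_recr/= prednK//.
rewrite [X in _ = _ + X * _](_ : _ = 0) ?mul0r ?addr0//.
by apply: C0_out; rewrite nodeE -Th /Omega/= in_itv/= ltxx andbF.
Qed.

Lemma bump_dense (p : C0 T) (e : R) : 0 < e ->
  exists2 q, bump q & forall x, Om x -> `|p x - q x| <= e.
Proof.
move=> e0; have [N pN] := hat_dense p e0.
exists (fun x => \sum_(i < N.-1) p (node T N i.+1) * hat N i x) => //.
apply: (bump_sum (fun i => p (node T N i.+1))) => i iN.
by apply: hat_bump; rewrite -ltn_predRL.
Qed.

(** The tool for correcting means: f minus its integral times this bump has mean zero. *)
Lemma exists_bump_unit : exists2 v, bump v & \int[mu]_(x in Om) v x = 1.
Proof.
pose f x := cut (4 * T / 6) (5 * T / 6) x - cut (T / 6) (2 * T / 6) x.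
have T0' := T0; have bf : bump f by apply: bump_cutB; lra.
have f0 x : 0 <= f x.
  have /andP[? ?] := cut_itv (4 * T / 6) (5 * T / 6) x.
  have /andP[? ?] := cut_itv (T / 6) (2 * T / 6) x.
  have [h|h] := leP (2 * T / 6) x.
    by rewrite /f [cut (T / 6) _ _]cut_right ?subr0//; lra.
  by rewrite /f [cut (4 * T / 6) _ _]cut_left; lra.
have cf := test_continuousT (bump_test bf).
pose A := `[2 * T / 6, 4 * T / 6]%classic.
  have muA : mu A = (2 * T / 6)%:E.
    by rewrite /A lebesgue_measure_itv/= lte_fin ifT; [rewrite -EFinB; congr EFin|]; lra.
have A0 : 0 < \int[mu]_(x in Om) f x.
  apply: (@lt_le_trans _ _ (\int[mu]_(x in Om) \1_A x)).
    rewrite /Rintegral integral_indic; [|exact: measurable_Omega|exact: measurable_itv].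
    have -> : A `&` Om = A.
      by apply/setIidl => x; rewrite /A /Omega/= !in_itv/= => /andP[? ?]; lra.
    by rewrite -[X in fine X]/(mu A) muA/=; lra.
  apply: le_Rintegral.
  - exact: measurable_Omega.
  - apply: measurable_bounded_integrable.
    + exact: measurable_Omega.
    + by rewrite [X in (X < _)%E]lebesgue_Omega ltry.
    + by apply: measurable_indic; exact: measurable_itv.
    + exists 1; split => // M M1 x _ /=; rewrite (le_trans _ (ltW M1))//.
      by rewrite indicE; case: (x \in A); rewrite ?normr1 ?normr0.
  - by apply: continuous_integrable_itv cf _; exact: subset_itv_oo_cc.
  - move=> x _; rewrite indicE; have [xA|xA] := boolP (x \in A); last exact: f0.
    move: xA; rewrite inE /A/= in_itv/= => /andP[h1 h2].
    by rewrite /f cut_left ?cut_right ?subr0//; lra.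
exists (fun x => (\int[mu]_(x in Om) f x)^-1 * f x + 0).
  exact: bump_linear bf bump0.
under eq_Rintegral do rewrite addr0.
rewrite (@RintegralZl _ _ _ mu); last 2 first.
- exact: measurable_Omega.
- by apply: continuous_integrable_itv cf _; exact: subset_itv_oo_cc.
by rewrite mulVf// gt_eqF.
Qed.

(** The primitive from 0 vanishes to the right of the support because q has mean zero. The integral
    formula is kept for the bound of |v| by T times a bound of |q|. *)
Lemma bump_primitive q : bump q -> \int[mu]_(x in Om) q x = 0 ->
  exists v, [/\ bump v, v^`()%classic = q & forall x, Om x -> v x = \int[mu]_(y in `]0, x[) q y].
Proof.
move=> bq q0; have [Cq [a [b [a0 bT qab]]]] := bq.
have cq := Ck_continuous (Cq 0%N).
have qi (i : interval R) c d : [set` i] `<=` `[c, d]%classic -> mu.-integrable [set` i] (EFin \o q).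
  exact: continuous_integrable_itv.
pose v x := \int[mu]_(t in `[0, x]) q t.
have vlea x : x < a -> v x = 0.
  move=> xa; rewrite /v (@eq_Rintegral _ _ _ mu _ (cst 0)); first by rewrite Rintegral_cst// mul0r.
  by move=> y; rewrite inE/= in_itv/= => /andP[_ yx]; apply: qab; rewrite negb_and -!ltNge (le_lt_trans yx xa).
have vgeb x : b < x -> v x = 0.
  move=> bx; rewrite -q0 /v Rintegral_mkcond [RHS]Rintegral_mkcond; congr Rintegral.
  apply/funext => y; rewrite !patchE.
  case: ifPn => y1; case: ifPn => y2 //; [|apply/esym]; apply: qab; rewrite negb_and -!ltNge.
    move: y1 y2; rewrite notin_setE inE /Omega/= !in_itv/= => /andP[y0 yx] /negP.
    by rewrite negb_and -!leNgt => /orP[|]; [lra|move=> ?; apply/orP; right; lra].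
  move: y1 y2; rewrite notin_setE inE /Omega/= !in_itv/= => /negP + /andP[y0 yx].
  by rewrite negb_and -!ltNge => /orP[|]; [lra|move=> ?; apply/orP; right; lra].
have dv x : is_derive x (1 : R) v (q x).
  have [xa|ax] := ltP x a.
    rewrite qab; last by rewrite negb_and -!ltNge xa.
    apply: (near_eq_is_derive _ (is_derive_cst (0 : R) x (1 : R))).
    by near=> y; rewrite vlea//; near: y; exact: lt_nbhsl.
  have xx1 : x < x + 1 by rewrite ltrDl.
  have [dv v'] := @continuous_FTC1_closed R q 0 x (x + 1) xx1 (qi _ _ _ (@subset_refl _ _)) (lt_le_trans a0 ax) (cq x).
  by rewrite -v' derive1E; apply: DeriveDef.
have v'q : v^`()%classic = q by apply/funext => x; rewrite derive1E; case: (dv x).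
exists v; split => //.
  split; last first.
    exists a, b; split => // x; rewrite negb_and -!ltNge => /orP[]; [exact: vlea|exact: vgeb].
  have dv' : forall x, derivable v x 1 by move=> x; case: (dv x).
  by case=> [|n]; [exact: Ck0|apply: CkS => //; rewrite v'q].
move=> x; rewrite /Omega/= in_itv/= => /andP[x0 xT].
rewrite /v Rintegral_itv_bndo_bndc; last by apply: (qi _ 0 x); exact: subset_itv_oo_cc.
by rewrite Rintegral_itv_obnd_cbnd//; apply: (qi _ 0 x); exact: subset_itv_oc_cc.
Unshelve. all: by end_near. Qed.

End test_functions.

(** * Integration against charges *)

Section charge_integral_facts.
Context {R : realType} (T : R) (T0 : 0 < T).
Local Notation mu := (@lebesgue_measure R).
Local Notation Om := (Omega T).
Implicit Types (nu : {charge set (measurableTypeR R) -> \bar R}) (f g : R -> R).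

Lemma continuous_bounded f : continuous f -> [bounded f x | x in Om].
Proof. by move=> cf; apply/segment_bounded/continuous_subspaceT. Qed.

Lemma continuous_measurable f : continuous f -> measurable_fun (Om : set (measurableTypeR R)) f.
Proof. by move=> cf; have := segment_measurable (T := T) (continuous_subspaceT cf). Qed.

Lemma finite_measure_integrable (m : {finite_measure set (measurableTypeR R) -> \bar R}) f :
  continuous f -> m.-integrable Om (EFin \o f).
Proof.
move=> cf; apply: measurable_bounded_integrable.
- exact: measurable_Omega.
- by rewrite ltey_eq fin_num_measure//; exact: measurable_Omega.
- exact: continuous_measurable.
- exact: continuous_bounded.
Qed.

Lemma RintegralZD (m : {finite_measure set (measurableTypeR R) -> \bar R}) (a : R) f g :
  continuous f -> continuous g ->
  \int[m]_(x in Om) (a * f x + g x) = a * \int[m]_(x in Om) f x + \int[m]_(x in Om) g x.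
Proof.
move=> cf cg.
have caf : continuous (fun x => a * f x).
  by move=> x; exact: continuousM (@cst_continuous R R a x) (cf x).
rewrite (@RintegralD _ _ _ m)//; last 3 first.
- exact: measurable_Omega.
- exact: finite_measure_integrable.
- exact: finite_measure_integrable.
rewrite (@RintegralZl _ _ _ m)//.
- exact: measurable_Omega.
- exact: finite_measure_integrable.
Qed.

Lemma charge_integralZD nu (a : R) f g : continuous f -> continuous g ->
  charge_integral nu Om (fun x => a * f x + g x) =
  a * charge_integral nu Om f + charge_integral nu Om g.
Proof. by move=> cf cg; rewrite /charge_integral !RintegralZD//; ring. Qed.

Lemma Rintegral_norm_le (m : {finite_measure set (measurableTypeR R) -> \bar R}) f M :
  continuous f -> (forall x, Om x -> `|f x| <= M) ->
  `|\int[m]_(x in Om) f x| <= M * fine (m Om).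
Proof.
move=> cf fM; have mO : measurable (Om : set (measurableTypeR R)) := measurable_Omega T.
apply: le_trans (le_normr_Rintegral mO (finite_measure_integrable m cf)) _.
rewrite -Rintegral_cst//; apply: le_Rintegral => //.
- by apply: finite_measure_integrable => x; apply: continuous_comp; [exact: cf|exact: norm_continuous].
- by apply: finite_measure_integrable => x; exact: cst_continuous.
Qed.

(** The total variation of nu on (0, T). *)
Definition charge_mass nu : R :=
  fine (jordan_pos (hahnP nu) Om) + fine (jordan_neg (hahnP nu) Om).

Lemma charge_mass_ge0 nu : 0 <= charge_mass nu.
Proof. by rewrite addr_ge0// fine_ge0. Qed.

Lemma charge_integral_norm_le nu f M :
  continuous f -> (forall x, Om x -> `|f x| <= M) ->
  `|charge_integral nu Om f| <= M * charge_mass nu.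
Proof.
move=> cf fM; apply: le_trans (ler_normB _ _) _.
by rewrite mulrDr lerD// Rintegral_norm_le.
Qed.

Lemma eq_charge_integral nu f g : (forall x, Om x -> f x = g x) ->
  charge_integral nu Om f = charge_integral nu Om g.
Proof.
move=> fg; rewrite /charge_integral.
by congr (_ - _); apply: eq_Rintegral => x; rewrite inE; exact: fg.
Qed.

End charge_integral_facts.

(** * Integration by parts against a finite measure *)

Section by_parts.
Context {R : realType} (T : R) (T0 : 0 < T).
Local Notation mu := (@lebesgue_measure R).
Local Notation Om := (Omega T).

(* Fubini for the indicator of 0 < y <= x times v'(x). *)
Lemma finite_measure_by_parts (m : {finite_measure set (measurableTypeR R) -> \bar R}) v :
  test_function T v ->
  \int[mu]_(x in Om) (fine (m `]0, x]%classic) * v^`()%classic x) = - \int[m]_(x in Om) v x.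
Proof.
move=> tv; set g := v^`()%classic.
have tg : test_function T g := test_derive tv.
have cg := test_continuousT tg; have cv := test_continuousT tv.
have bg := continuous_bounded T cg.
pose M := supnorm T g.
have gM x : `|g x| <= M.
  have [Ox|Ox] := pselect (Om x); first exact: le_supnorm.
  by rewrite (test_out tg Ox) normr0 supnorm_ge0.
have M0 : 0 <= M by exact: supnorm_ge0.
pose D : set (measurableTypeR R * measurableTypeR R) := [set z | 0 < z.1 <= z.2].
have mD : measurable D.
  have -> : D = (setT `&` fst @^-1` `]0, +oo[%classic) `&` (setT `&` [set z | z.1 <= z.2]).
    rewrite !setTI; apply/seteqP; split => z; rewrite /D/= in_itv/= andbT.
      by move=> /andP[].
    by move=> [-> ->].
  apply: measurableI.
    by apply: measurable_fst => //; exact: measurable_itv.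
  exact: measurable_fun_le.
pose f (z : measurableTypeR R * measurableTypeR R) : \bar R := (\1_D z * g z.2)%:E.
have mg : measurable_fun (setT : set (measurableTypeR R)) g.
  exact: continuous_measurable_fun.
have mf : measurable_fun setT f.
  apply/measurable_EFinP; apply: measurable_funM; first exact: measurable_indic.
  exact: (measurableT_comp mg measurable_snd).
have fE y x : f (y, x) = if 0 < y <= x then (g x)%:E else 0%E.
  rewrite /f indicE; case: ifPn => yx.
    by rewrite mem_set// mul1r.
  by rewrite memNset ?mul0r//; exact/negP.
have fi : (m \x mu)%E.-integrable setT f.
  apply/(integrable12ltyP m mu mf).
  apply: (@le_lt_trans _ _ (\int[m]_y (M * T)%:E)%E); last first.
    by rewrite integral_cst// ltey_eq fin_numM// fin_num_measure.
  apply: ge0_le_integral => //.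
  - by move=> y _; apply: integral_ge0.
  - apply: (@measurable_fun_fubini_tonelli_F _ _ _ _ _ mu (fun z => `|f z|)%E) => //.
    exact: measurableT_comp.
  move=> y _; apply: (@le_trans _ _ (\int[mu]_x (M%:E * (\1_Om x)%:E))%E).
    apply: ge0_le_integral => //.
    - apply: measurableT_comp => //; exact: (measurableT_comp mf (measurable_pair1 y)).
    - apply/measurable_EFinP; apply: measurable_funM => //; apply: measurable_indic; exact: measurable_Omega.
    move=> x _; rewrite fE; case: ifPn => _; last by rewrite abse0 lee_fin mulr_ge0.
    rewrite lee_fin indicE; have [xO|xO] := boolP (x \in Om); first by rewrite mulr1.
    by rewrite (test_out tg) ?normr0 ?mulr0//; move: xO; rewrite notin_setE.
  rewrite ge0_integralZl_EFin//; last first.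
    by apply/measurable_EFinP; apply: measurable_indic; exact: measurable_Omega.
  rewrite integral_indic//; last exact: measurable_Omega.
  by rewrite setIT [X in (_ * X <= _)%E](lebesgue_Omega T0).
(* For y in (0, T) this is the integral of v' from y to T, and v(T) = 0; for other y both sides
   vanish. *)
have inner y : (\int[mu]_x f (y, x) = (- v y)%:E)%E.
  have [y0|y0] := leP y 0.
    rewrite (test_out tv) ?oppr0; last by rewrite /Omega/= in_itv/= ltNge y0.
    by apply: integral0_eq => x _; rewrite fE ltNge y0.
  have [yT|Ty] := ltP y T; last first.
    rewrite (test_out tv) ?oppr0; last by rewrite /Omega/= in_itv/= !ltNge Ty andbF.
    apply: integral0_eq => x _; rewrite fE; case: ifPn => // /andP[_ yx].
    by rewrite (test_out tg)// /Omega/= in_itv/= !ltNge (le_trans Ty yx) andbF.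
  transitivity (\int[mu]_(x in `[y, T[) (g x)%:E)%E.
    rewrite [RHS]integral_mkcond; apply: eq_integral => x _.
    rewrite fE y0/= patchE mem_setE in_itv/=; case: (leP y x) => //= yx.
    case: ltP => // Tx; rewrite (test_out tg)// /Omega/= in_itv/= !ltNge Tx andbF//.
  rewrite -integral_itv_obnd_cbnd; last first.
    by apply: measurable_funTS; apply/measurable_EFinP.
  have -> : (- v y)%:E = (\int[mu]_(x in `]y, T[) g x)%:E.
    rewrite (Rintegral_derive (ltW yT) (fun x => test_is_derive x tv) cg).
    by rewrite (test_out tv (x := T)) ?sub0r// /Omega/= in_itv/= ltxx andbF.
  rewrite /Rintegral fineK//; apply: integrable_fin_num => //.
  by apply: (continuous_integrable_itv (a := y) (b := T)) cg _; exact: subset_itv_oo_cc.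
have inner2 x : (\int[m]_y f (y, x) = (fine (m `]0, x]%classic) * g x)%:E)%E.
  transitivity (\int[m]_y ((g x)%:E * (\1_(`]0, x]%classic) y)%:E))%E.
    apply: eq_integral => y _; rewrite fE indicE mem_setE in_itv/=.
    by case: ifPn; rewrite ?mule1 ?mule0.
  rewrite integralZl//; last first.
    apply: measurable_bounded_integrable => //.
    + by rewrite ltey_eq fin_num_measure.
    + exists 1; split => // N N1 z _ /=; rewrite (le_trans _ (ltW N1))//.
      by rewrite indicE; case: (z \in _); rewrite ?normr1 ?normr0.
  rewrite integral_indic// setIT EFinM fineK; first by rewrite muleC.
  by rewrite fin_num_measure//; exact: measurable_itv.
have := Fubini fi.
under eq_integral do rewrite inner.
under [RHS]eq_integral do rewrite inner2.
move=> h.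
transitivity (fine (\int[mu]_x (fine (m `]0, x]%classic) * g x)%:E)%E).
  rewrite /Rintegral [in LHS]integral_mkcond; congr fine; apply: eq_integral => x _.
  rewrite patchE; case: ifPn => //; rewrite notin_setE => xO.
  by rewrite (test_out tg xO) mulr0.
rewrite -h; transitivity (\int[m]_(x in Om) (- v x)).
  rewrite /Rintegral [in RHS]integral_mkcond; congr fine; apply: eq_integral => x _.
  rewrite patchE; case: ifPn => //; rewrite notin_setE => xO.
  by rewrite (test_out tv xO) oppr0.
have := RintegralZD T m (-1) cv (fun x => @cst_continuous R R 0 x).
rewrite Rintegral_cst ?mul0r ?addr0 ?mulN1r; last exact: measurable_Omega.
by move=> <-; apply: eq_Rintegral => x _; rewrite mulN1r addr0.
Qed.

End by_parts.

(** * The lemma of du Bois-Reymond *)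

Section du_bois_reymond.
Context {R : realType} (T : R) (T0 : 0 < T).
Local Notation mu := (@lebesgue_measure R).
Local Notation Om := (Omega T).

Let mO : measurable (Om : set (measurableTypeR R)) := measurable_Omega T.

(** The transition zone shrinks to c from the right and never contains c, so the limit at c is 1.
    The half-lines are thus closed, in accordance with right-continuous distribution functions. *)
Lemma cut_cvg (c d x : R) : 0 < d ->
  cut (c + d / n.+1%:R) (c + 2 * d / n.+1%:R) x @[n --> \oo] --> (\1_(`]-oo, c]%classic) x : R).
Proof.
move=> d0.
have lt_cd n : c + d / n.+1%:R < c + 2 * d / n.+1%:R.
  by rewrite ltrD2l ltr_pM2r ?invr_gt0// ltr_pMl// ltr1n.
rewrite indicE; have [xc|xc] := leP x c.
  rewrite mem_set/=; last by rewrite in_itv/=.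
  apply: cvg_near_cst; apply: nearW => n; rewrite cut_left//.
  by rewrite (le_trans xc)// lerDl divr_ge0// ltW.
rewrite memNset/=; last by rewrite in_itv/=; apply/negP; rewrite -ltNge.
apply: cvg_near_cst; near=> n; rewrite cut_right// -lerBrDl ler_pdivrMr// -ler_pdivrMl ?subr_gt0//.
rewrite -(natr1 n); apply: (@le_trans _ _ n%:R); last by rewrite lerDl.
near: n; exact: nbhs_infty_ger.
Unshelve. all: by end_near. Qed.

Lemma bump_integrable_mul (g psi : R -> R) : mu.-integrable Om (EFin \o g) -> continuous psi ->
  mu.-integrable Om (EFin \o (fun x => g x * psi x)).
Proof.
move=> ig cp.
have := @integrableMl _ (measurableTypeR R) R mu _ mO (EFin \o g) psi ig
  (continuous_measurable cp) (continuous_bounded T cp).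
exact.
Qed.

(* Indicators of half-open intervals are bounded pointwise limits of bumps. *)
Lemma bump_orthogonal_itv (g : R -> R) (a b : R) :
  mu.-integrable Om (EFin \o g) ->
  (forall psi, bump T psi -> \int[mu]_(x in Om) (g x * psi x) = 0) ->
  0 < a -> a < b -> b < T -> \int[mu]_(x in `]a, b]) g x = 0.
Proof.
move=> ig g0 a0 ab bT.
(* The transition zones end at [b + 2 * d] at the latest, which is below T. *)
pose d := (T - b) / 4.
have d0 : 0 < d by rewrite divr_gt0// subr_gt0.
pose psi n x := cut (b + d / n.+1%:R) (b + 2 * d / n.+1%:R) x - cut (a + d / n.+1%:R) (a + 2 * d / n.+1%:R) x.
have bump_shift e : 0 < e -> e <= d ->
    bump T (fun x => cut (b + e) (b + 2 * e) x - cut (a + e) (a + 2 * e) x).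
  by rewrite /d => e0 ed; apply: bump_cutB; lra.
have bpsi n : bump T (psi n).
  have n0 : 0 < n.+1%:R^-1 :> R by rewrite invr_gt0.
  have n1 : n.+1%:R^-1 <= 1 :> R by rewrite invf_le1// ler1n.
  have h1 : 0 < d / n.+1%:R by rewrite mulr_gt0.
  have h2 : d / n.+1%:R <= d by rewrite ler_piMr// ltW.
  have h3 : 2 * d / n.+1%:R = 2 * (d / n.+1%:R) by rewrite mulrA.
  by rewrite /psi h3; exact: bump_shift.
have cpsi n : continuous (psi n) by exact: test_continuousT (bump_test (bpsi n)).
have psi1 n x : `|psi n x| <= 1.
  have /andP[? ?] := cut_itv (b + d / n.+1%:R) (b + 2 * d / n.+1%:R) x.
  have /andP[? ?] := cut_itv (a + d / n.+1%:R) (a + 2 * d / n.+1%:R) x.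
  by rewrite /psi ler_norml; lra.
have psi_cvg x : psi n x @[n --> \oo] --> (\1_(`]a, b]%classic) x : R).
  have -> : \1_(`]a, b]%classic) x = \1_(`]-oo, b]%classic) x - \1_(`]-oo, a]%classic) x :> R.
    rewrite !indicE !mem_setE !in_itv/=; have [xa|xa] := leP x a.
      by rewrite (le_trans xa (ltW ab)) subrr.
    by rewrite subr0.
  by apply: cvgB; exact: cut_cvg.
pose f_ n x := (g x * psi n x)%:E.
pose f x := (g x * \1_(`]a, b]%classic) x)%:E.
have mg : measurable_fun Om g by apply/measurable_EFinP; case/integrableP : ig.
have := @dominated_convergence _ _ _ mu Om mO f_ f (EFin \o (fun x => `|g x|)).
case.
- move=> n; apply/measurable_EFinP; apply: measurable_funM => //.
  exact: continuous_measurable.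
- by apply/measurable_EFinP; apply: measurable_funM.
- apply: aeW => x _; apply: cvg_EFin; first exact: nearW.
  by apply: cvgM; [exact: cvg_cst|exact: psi_cvg].
- exact: (integrable_norm ig).
- apply: aeW => x n _; rewrite /f_ lee_fin/= normrM ler_piMr//.
move=> fi _.
have -> : (fun n => \int[mu]_(x in Om) f_ n x)%E = (fun=> 0%E).
  apply/funext => n.
  have <- : (\int[mu]_(x in Om) (g x * psi n x))%:E = 0%E by rewrite g0.
  rewrite /Rintegral fineK//; apply: integrable_fin_num => //.
  exact: bump_integrable_mul.
move=> /(cvg_unique _ (@cvg_cst _ _ _ _ _)) => /(_ (@ereal_hausdorff R)) h.
rewrite /Rintegral.
suff -> : (\int[mu]_(x in `]a, b]) (g x)%:E = \int[mu]_(x in Om) f x)%E by rewrite -h.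
rewrite [LHS]integral_mkcond [RHS]integral_mkcond; apply: eq_integral => x _.
rewrite !patchE /f indicE; case: ifPn => xab.
  rewrite mem_set ?mulr1//; move: xab; rewrite inE/= /Omega/= !in_itv/= => /andP[ax xb].
  by rewrite (lt_trans a0 ax) (le_lt_trans xb bT).
by rewrite mulr0; case: ifP.
Unshelve. all: by end_near. Qed.

(* By Lebesgue differentiation: the primitive of g is constant on (0, T). *)
Lemma bump_orthogonal_ae (g : R -> R) :
  mu.-integrable Om (EFin \o g) ->
  (forall psi, bump T psi -> \int[mu]_(x in Om) (g x * psi x) = 0) ->
  {ae mu, forall x, Om x -> g x = 0}.
Proof.
move=> ig g0.
(* Extension by 0, because the primitive to be differentiated starts at minus infinity. *)
pose f := g \_ Om.
have fi : mu.-integrable setT (EFin \o f).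
  by rewrite /f -restrict_EFin; apply/integrable_restrict => //; rewrite setTI.
have fiy (i : interval R) : mu.-integrable [set` i] (EFin \o f).
  by apply: integrableS fi => //; exact: measurable_itv.
have lf : locally_integrable setT f.
  have := integrable_locally measurableT fi.
  by rewrite (_ : f \_ setT = f)//; apply/funext => y; rewrite patchE in_setT.
have := @FTC1Ny R f (fun y => fiy _) lf.
apply: (@filterS _ _ (ae_filter_ringOfSetsType mu)) => x [dF F'x] Ox.
have fx : f x = g x by rewrite /f patchE mem_set.
rewrite -fx -F'x derive1E.
move: Ox; rewrite /Omega/= in_itv/= => /andP[x0 xT].
set F := fun x => _.
have Feq y z : 0 < y -> y < z -> z < T -> F y = F z.
  move=> y0 yz zT; apply/esym/eqP; rewrite -subr_eq0 /F.
  rewrite (Rintegral_itvB (a := -oo%O) (b := BRight z) (x := y))//; last by rewrite bnd_simp ltW.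
  rewrite -(bump_orthogonal_itv ig g0 y0 yz zT); apply/eqP; apply: eq_Rintegral => t.
  rewrite inE/= in_itv/= => /andP[yt tz]; rewrite /f patchE mem_set//.
  by rewrite /Omega/= in_itv/= (lt_trans y0 yt) (le_lt_trans tz zT).
have [_ ->//] : is_derive x (1 : R) F 0.
apply: (near_eq_is_derive _ (is_derive_cst (F x) x (1 : R))).
near=> y; rewrite /=.
have y0 : 0 < y by near: y; exact: lt_nbhsr.
have yT : y < T by near: y; exact: lt_nbhsl.
by have [xy|yx|->//] := ltgtP x y; [exact: Feq|exact/esym/Feq].
Unshelve. all: by end_near. Qed.

(** A bump psi minus its integral times the unit bump phi is the derivative of a test function.
    Hence w integrates psi like the constant d, the integral of w phi. *)
Lemma du_bois_reymond (w : R -> R) :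
  mu.-integrable Om (EFin \o w) ->
  (forall v, test_function T v -> \int[mu]_(x in Om) (w x * v^`()%classic x) = 0) ->
  exists d, {ae mu, forall x, Om x -> w x = d}.
Proof.
move=> iw w0.
have [phi bphi phi1] := exists_bump_unit T0.
have cphi := test_continuousT (bump_test bphi).
have ibump psi : continuous psi -> mu.-integrable Om (EFin \o psi).
  by move=> cpsi; apply: continuous_integrable_itv cpsi _; exact: subset_itv_oo_cc.
pose d := \int[mu]_(x in Om) (w x * phi x).
exists d.
have ic : mu.-integrable Om (EFin \o cst d) by apply: ibump => x; exact: cst_continuous.
have iwd : mu.-integrable Om (EFin \o (fun x => w x - d)).
  exact: (@integrableB _ _ _ mu _ mO _ _ iw ic).
suff : {ae mu, forall x, Om x -> w x - d = 0}.
  by apply: (@filterS _ _ (ae_filter_ringOfSetsType mu)) => x h /h/eqP; rewrite subr_eq0 => /eqP.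
apply: bump_orthogonal_ae => // psi bpsi.
have cpsi := test_continuousT (bump_test bpsi).
pose c := \int[mu]_(x in Om) psi x.
pose q x := - c * phi x + psi x.
have bq : bump T q by exact: bump_linear.
have iphi := ibump _ cphi; have ipsi := ibump _ cpsi.
have icphi : mu.-integrable Om (EFin \o (fun x => - c * phi x)).
  exact: (@integrableZl _ _ _ mu _ mO (- c) (EFin \o phi) iphi).
have q0 : \int[mu]_(x in Om) q x = 0.
  rewrite /q (@RintegralD _ _ _ mu _ _ _ mO icphi ipsi) (@RintegralZl _ _ _ mu _ _ _ mO iphi).
  by rewrite phi1 -/c; ring.
have [v [bv v'q _]] := bump_primitive bq q0.
have := w0 v (bump_test bv); rewrite v'q.
have iwphi := bump_integrable_mul iw cphi; have iwpsi := bump_integrable_mul iw cpsi.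
have icwphi : mu.-integrable Om (EFin \o (fun x => - c * (w x * phi x))).
  exact: (@integrableZl _ _ _ mu _ mO (- c) (EFin \o (fun x => w x * phi x)) iwphi).
have idpsi : mu.-integrable Om (EFin \o (fun x => d * psi x)).
  exact: (@integrableZl _ _ _ mu _ mO d (EFin \o psi) ipsi).
under eq_Rintegral do rewrite /q mulrDr mulrCA.
rewrite (@RintegralD _ _ _ mu _ _ _ mO icwphi iwpsi) (@RintegralZl _ _ _ mu _ _ _ mO iwphi) -/d.
under [in X in _ -> X]eq_Rintegral do rewrite mulrBl.
rewrite (@RintegralB _ _ _ mu _ _ _ mO iwpsi idpsi) (@RintegralZl _ _ _ mu _ _ _ mO ipsi) -/c.
by lra.
Qed.

End du_bois_reymond.

(** * Riesz representation *)

Section stieltjes.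
Context {R : realType}.

(** Restriction to ]a, b] makes the Lebesgue-Stieltjes measure finite without changing it on the
    intervals concerned. *)
Lemma exists_stieltjes_measure (G : R -> R) (a b : R) :
  nondecreasing G -> right_continuous G ->
  exists m : {finite_measure set (measurableTypeR R) -> \bar R},
    forall x y, a <= x -> x <= y -> y <= b -> m `]x, y]%classic = (G y - G x)%:E.
Proof.
move=> ndG rcG.
pose Gm := isCumulative.Build R _ R G ndG rcG.
pose Gc : cumulative R R := HB.pack G Gm.
pose D : set (measurableTypeR R) := `]a, b]%classic.
have GcE x y : x <= y -> lebesgue_stieltjes_measure Gc `]x, y]%classic = (G y - G x)%:E.
  move=> xy; rewrite /lebesgue_stieltjes_measure/= /measure_extension measurable_mu_extE/=; last exact: is_ocitv.
  by rewrite wlength_itv_bnd.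
have mD : measurable D by exact: measurable_itv.
have Dfin : (lebesgue_stieltjes_measure Gc D < +oo)%E.
  have [ab|ab] := leP a b; first by rewrite GcE ?ltry.
  by rewrite /D set_itv_ge ?measure0// bnd_simp -leNgt ltW.
exists (mfrestr mD Dfin) => x y ax xy yb.
rewrite -GcE//= /mfrestr/= /mrestr; congr (lebesgue_stieltjes_measure Gc _).
apply/setIidl => z; rewrite /D/= !in_itv/= => /andP[xz zy].
by rewrite (le_lt_trans ax xz) (le_trans zy yb).
Qed.

End stieltjes.

Lemma cvg_sum_ord {R : realType} (N : nat) (f : nat -> nat -> R) (l : nat -> R) :
  (forall i, f i n @[n --> \oo] --> l i) ->
  (\sum_(i < N) f i n) @[n --> \oo] --> \sum_(i < N) l i.
Proof.
move=> fl; elim: N => [|N IH].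
  rewrite big_ord0 (_ : (fun n => _) = fun=> 0); first exact: cvg_cst.
  by apply/funext => n; rewrite big_ord0.
rewrite big_ord_recr (_ : (fun n => _) = (fun n => \sum_(i < N) f i n + f N n)).
  exact: cvgD.
by apply/funext => n; rewrite big_ord_recr.
Qed.

Lemma Rintegral_sum_ord {R : realType} d (X : measurableType d) (m : {measure set X -> \bar R})
    (D : set X) (N : nat) (c : nat -> R) (s : nat -> X -> R) :
  measurable D -> (forall i, m.-integrable D (EFin \o s i)) ->
  m.-integrable D (EFin \o (fun x => \sum_(i < N) c i * s i x)) /\
  \int[m]_(x in D) (\sum_(i < N) c i * s i x) = \sum_(i < N) c i * \int[m]_(x in D) s i x.
Proof.
move=> mD si; elim: N => [|N [IH1 IH2]].
  rewrite (_ : (fun x => _) = fun=> 0); last by apply/funext => x; rewrite big_ord0.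
  split; first exact: integrable0.
  by rewrite big_ord0 Rintegral_cst// mul0r.
have ci : m.-integrable D (EFin \o (fun x => c N * s N x)).
  exact: (@integrableZl _ _ _ m _ mD (c N) (EFin \o s N) (si N)).
rewrite (_ : (fun x => _) = (fun x => \sum_(i < N) c i * s i x + c N * s N x)); last first.
  by apply/funext => x; rewrite big_ord_recr.
split; first exact: (@integrableD _ _ _ m _ mD _ _ IH1 ci).
by rewrite (RintegralD mD IH1 ci) IH2 (RintegralZl (c N) mD (si N)) big_ord_recr.
Qed.

(** * The positive part of a bounded functional and its measure *)

Section positive_part.
Context {R : realType} (T : R) (T0 : 0 < T).
Local Notation Om := (Omega T).
Variables (F : C0 T -> R) (K : R).
Hypothesis F_linear : forall a p q, F (a *: p + q) = a * F p + F q.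
Hypothesis F_bounded : forall p, `|F p| <= K * `|p|.

(* [sup_below] extends the positive part of F to nonnegative functions that need
   not vanish at the boundary, such as [cut a b]. *)
Definition admissible (g : R -> R) := continuous g /\ exists M, forall x, 0 <= g x <= M.

Definition sup_below (g : R -> R) : R :=
  sup [set F q | q in [set q : C0 T | forall x, Om x -> 0 <= q x <= g x]].

Let F0 : F 0 = 0.
Proof. by have := F_linear (-1) 0 0; rewrite scaler0 addr0 mulN1r addNr. Qed.

Let FD p q : F (p + q) = F p + F q.
Proof. by rewrite -[p in LHS]scale1r F_linear mul1r. Qed.

Let FZ a p : F (a *: p) = a * F p.
Proof. by rewrite -[a *: p]addr0 F_linear F0 addr0. Qed.

Let K0 : 0 <= K.
Proof.
have [v bv v1] := exists_bump_unit T0.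
pose p := test_C0 (bump_test bv).
have p0 : 0 < `|p|.
  rewrite normr_gt0; apply/eqP => p0.
  have : \int[lebesgue_measure]_(x in Om) v x = 0.
    transitivity (\int[lebesgue_measure]_(x in Om) (0 : R)).
      apply: eq_Rintegral => x _; rewrite -[LHS]/(p x) p0//.
    by rewrite Rintegral_cst ?mul0r//; exact: measurable_Omega.
  by rewrite v1 => /eqP; rewrite oner_eq0.
by have := le_trans (normr_ge0 _) (F_bounded p); rewrite pmulr_lge0.
Qed.

Lemma sup_below_has_sup g : admissible g ->
  has_sup [set F q | q in [set q : C0 T | forall x, Om x -> 0 <= q x <= g x]].
Proof.
move=> [_ [M gM]]; split.
  exists (F 0), 0 => // x _ /=; rewrite lexx/=.
  by have /andP[] := gM x.
exists (K * M) => _ [q q_ <-]; apply: le_trans (ler_norm _) _.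
apply: le_trans (F_bounded q) _; apply: ler_wpM2l => //.
apply: C0_norm_le => [|x Ox]; first by have /andP[/le_trans] := gM 0; exact.
have /andP[q0 qg] := q_ x Ox; have /andP[_ gMx] := gM x.
by rewrite ger0_norm// (le_trans qg).
Qed.

Lemma sup_below_ge g (q : C0 T) : admissible g -> (forall x, Om x -> 0 <= q x <= g x) ->
  F q <= sup_below g.
Proof.
move=> ag qg; apply: ub_le_sup; first by have [] := sup_below_has_sup ag.
by exists q.
Qed.

Lemma sup_below_le g r : admissible g ->
  (forall q : C0 T, (forall x, Om x -> 0 <= q x <= g x) -> F q <= r) -> sup_below g <= r.
Proof.
move=> ag gr; apply: ge_sup; first by have [] := sup_below_has_sup ag.
by move=> _ [q q_ <-]; exact: gr.
Qed.

Lemma sup_below_ge0 g : admissible g -> 0 <= sup_below g.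
Proof.
move=> ag; rewrite -F0; apply: sup_below_ge => // x _ /=; rewrite lexx/=.
by case: ag => _ [M /(_ x)/andP[]].
Qed.

Lemma sup_below_bound g M : admissible g -> 0 <= M -> (forall x, Om x -> g x <= M) ->
  sup_below g <= K * M.
Proof.
move=> ag M0 gM; apply: sup_below_le => // q q_.
apply: le_trans (ler_norm _) _; apply: le_trans (F_bounded q) _; apply: ler_wpM2l => //.
apply: C0_norm_le => // x Ox; have /andP[q0 qg] := q_ x Ox.
by rewrite ger0_norm// (le_trans qg)// gM.
Qed.

Lemma sup_below_mono g h : admissible g -> admissible h ->
  (forall x, Om x -> g x <= h x) -> sup_below g <= sup_below h.
Proof.
move=> ag ah gh; apply: sup_below_le => // q q_; apply: sup_below_ge => // x Ox.
by have /andP[-> qg] := q_ x Ox; rewrite (le_trans qg)// gh.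
Qed.

Lemma admissibleD g h : admissible g -> admissible h -> admissible (fun x => g x + h x).
Proof.
move=> [cg [M gM]] [ch [N hN]]; split; first by move=> x; exact: continuousD (cg x) (ch x).
exists (M + N) => x; have /andP[? ?] := gM x; have /andP[? ?] := hN x.
by rewrite addr_ge0// lerD.
Qed.

Lemma admissibleZ c g : 0 <= c -> admissible g -> admissible (fun x => c * g x).
Proof.
move=> c0 [cg [M gM]]; split.
  by move=> x; exact: continuousM (@cst_continuous R R c x) (cg x).
exists (c * M) => x; have /andP[? ?] := gM x.
by rewrite mulr_ge0//= ler_wpM2l.
Qed.

Lemma admissible_cst c : 0 <= c -> admissible (fun=> c).
Proof. by move=> c0; split; [move=> x; exact: cst_continuous|exists c => x; rewrite c0 lexx]. Qed.

Lemma admissible_cut a b : admissible (cut a b).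
Proof.
split; first exact: Ck_continuous (Ck_cut 0 a b).
by exists 1 => x; exact: cut_itv.
Qed.

(** Riesz decomposition: q below g + h splits into min(q, g), which is again in C_0 as g >= 0, and a
    remainder below h. *)
Lemma sup_belowD g h : admissible g -> admissible h ->
  sup_below (fun x => g x + h x) = sup_below g + sup_below h.
Proof.
move=> ag ah; have agh := admissibleD ag ah.
apply/eqP; rewrite eq_le; apply/andP; split.
  apply: sup_below_le => // q q_.
  have [cg [M gM]] := ag; have [ch [N hN]] := ah.
  have cq1 : continuous (fun x => Num.min (q x) (g x)).
    by move=> x; apply: (@continuous_min R R (C0_fun q) g x); [exact: C0_continuous|exact: cg].
  have q10 x : ~ Om x -> Num.min (q x) (g x) = 0.
    move=> nx; rewrite (C0_out q nx) min_l//.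
    by have /andP[] := gM x.
  pose q1 := toC0 cq1 q10.
  have -> : q = q1 + (q - q1) by rewrite addrC subrK.
  rewrite FD; apply: lerD; apply: sup_below_ge => // x Ox.
    have /andP[q0 _] := q_ x Ox; have /andP[g0 _] := gM x.
    by rewrite -[q1 x]/(Num.min (q x) (g x)) le_min q0 g0 ge_min lexx orbT.
  have /andP[q0 qgh] := q_ x Ox; have /andP[h0 _] := hN x.
  rewrite -[(q - q1) x]/(q x - Num.min (q x) (g x)).
  by rewrite subr_ge0 ge_min lexx/=; have [_|_] := leP (q x) (g x); lra.
rewrite -lerBrDr; apply: sup_below_le => // q q_.
rewrite lerBrDr -lerBrDl; apply: sup_below_le => // r r_.
rewrite lerBrDl -FD; apply: sup_below_ge => // x Ox.
have /andP[? ?] := q_ x Ox; have /andP[? ?] := r_ x Ox.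
by rewrite -[(q + r) x]/(q x + r x) addr_ge0//= lerD.
Qed.

Lemma sup_belowZ c g : 0 <= c -> admissible g -> sup_below (fun x => c * g x) = c * sup_below g.
Proof.
move=> c0 ag; have acg := admissibleZ c0 ag.
move: c0; rewrite le_eqVlt => /predU1P[c0|c0].
  rewrite -c0 mul0r in acg *; apply/eqP; rewrite eq_le sup_below_ge0// andbT.
  apply: le_trans (sup_below_bound acg (lexx 0) _) _; last by rewrite mulr0.
  by move=> x _; rewrite mul0r.
apply/eqP; rewrite eq_le; apply/andP; split.
  apply: sup_below_le => // q q_; rewrite -ler_pdivrMl// -FZ.
  apply: sup_below_ge => // x Ox; have /andP[q0 qg] := q_ x Ox.
  rewrite -[(c^-1 *: q) x]/(c^-1 * q x) ler_pdivrMl// qg andbT.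
  by rewrite mulr_ge0// invr_ge0 ltW.
rewrite -ler_pdivlMl//; apply: sup_below_le => // q q_; rewrite ler_pdivlMl// -FZ.
apply: sup_below_ge => // x Ox; have /andP[q0 qg] := q_ x Ox.
rewrite -[(c *: q) x]/(c * q x); apply/andP; split; last by rewrite ler_pM2l.
by rewrite mulr_ge0// ltW.
Qed.

Lemma sup_below_sum n (c : nat -> R) (g : nat -> R -> R) :
  (forall i, (i < n)%N -> 0 <= c i /\ admissible (g i)) ->
  admissible (fun x => \sum_(i < n) c i * g i x) /\
  sup_below (fun x => \sum_(i < n) c i * g i x) = \sum_(i < n) c i * sup_below (g i).
Proof.
elim: n => [|n IH] H.
  rewrite (_ : (fun x => _) = fun=> 0); last by apply/funext => x; rewrite big_ord0.
  split; first exact: admissible_cst.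
  rewrite big_ord0; have := @sup_belowZ 0 (fun=> 0) (lexx 0) (admissible_cst (lexx 0)).
  by rewrite !mul0r.
have [|IH1 IH2] := IH; first by move=> i ni; apply: H; exact/ltnW.
have [c0 ag] := H n (leqnn _).
rewrite (_ : (fun x => _) = (fun x => \sum_(i < n) c i * g i x + c n * g n x)); last first.
  by apply/funext => x; rewrite big_ord_recr.
have ag' := admissibleZ c0 ag; split; first exact: admissibleD.
by rewrite sup_belowD// IH2 sup_belowZ// big_ord_recr.
Qed.

(* The mass that the representing measure gives to ]-oo, x], as the infimum over
   continuous majorants of the indicator of that half-line. *)
Definition distfun (x : R) : R :=
  inf [set sup_below (cut ab.1 ab.2) | ab in [set ab : R * R | x < ab.1 /\ ab.1 < ab.2]].

Let dist_has_inf x :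
  has_inf [set sup_below (cut ab.1 ab.2) | ab in [set ab : R * R | x < ab.1 /\ ab.1 < ab.2]].
Proof.
split; first by exists (sup_below (cut (x + 1) (x + 2))), (x + 1, x + 2) => //=; lra.
by exists 0 => _ [ab _ <-]; apply: sup_below_ge0; exact: admissible_cut.
Qed.

Lemma distfun_le a b x : x < a -> a < b -> distfun x <= sup_below (cut a b).
Proof. by move=> xa ab; apply: ge_inf; [case: (dist_has_inf x)|exists (a, b)]. Qed.

Lemma distfun_ge0 x : 0 <= distfun x.
Proof.
apply: lb_le_inf; first by case: (dist_has_inf x).
by move=> _ [ab _ <-]; apply: sup_below_ge0; exact: admissible_cut.
Qed.

Lemma distfun_leK x : distfun x <= K.
Proof.
apply: le_trans (@distfun_le (x + 1) (x + 2) x _ _) _; [lra|lra|].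
rewrite -[leRHS]mulr1; apply: sup_below_bound => //; first exact: admissible_cut.
by move=> y _; case/andP: (cut_itv (x + 1) (x + 2) y).
Qed.

Lemma distfun_nondecreasing : nondecreasing distfun.
Proof.
move=> x y xy; apply: lb_le_inf; first by case: (dist_has_inf y).
move=> _ [[a b] /= [ya ab] <-]; apply: distfun_le => //.
exact: le_lt_trans ya.
Qed.

(** A cutoff whose transition ends before a lies below one whose transition starts at a, so
    near-minimizers can be moved as close to x as desired. *)
Lemma distfun_approx x e r : 0 < e -> 0 < r ->
  exists a b, [/\ x < a, a < b, b < x + r & sup_below (cut a b) <= distfun x + e].
Proof.
move=> e0 r0; have [_ [[a b] /= [xa ab] <-] h] := inf_adherent e0 (dist_has_inf x).
pose c := Num.min a (x + r).
have xc : x < c by rewrite lt_min xa ltrDl r0.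
exists (x + (c - x) / 3), (x + (c - x) / 2); split; [lra|lra| |].
  have : c <= x + r by rewrite ge_min lexx orbT.
  lra.
apply: le_trans (ltW h); apply: sup_below_mono; [exact: admissible_cut..|].
move=> y _; have ca : c <= a by rewrite ge_min lexx.
have [ya|ay] := leP y a.
  by rewrite (cut_left ab ya); case/andP: (cut_itv (x + (c - x) / 3) (x + (c - x) / 2) y).
rewrite cut_right; first by case/andP: (cut_itv a b y).
  lra.
lra.
Qed.

(** A near-minimizer for x starts its transition strictly to the right of x, hence competes also for
    every y in between. *)
Lemma distfun_right_continuous : right_continuous distfun.
Proof.
move=> x; apply/cvgrPdist_le => e e0.
have [a [b [xa ab _ h]]] := distfun_approx x e0 ltr01.
near=> y.
have xy : x <= y by near: y; exact: nbhs_right_ge.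
have ya : y < a by near: y; exact: nbhs_right_lt.
have h1 := distfun_nondecreasing xy; have h2 := distfun_le ya ab.
by rewrite ler_norml; lra.
Unshelve. all: by end_near. Qed.

(** As the transition zones shrink to the nodes, the cutoffs become indicators, and the uniform
    bound survives the pointwise limit. *)
Lemma step_approx (p : C0 T) (e : R) (N : nat) : (0 < N)%N ->
  (forall (a b : nat -> R),
    (forall i, node T N i < a i /\ a i < b i /\ b i < node T N i.+1) ->
    forall y, Om y ->
    `|p y - \sum_(i < N) p (node T N i.+1) * (cut (a i.+1) (b i.+1) y - cut (a i) (b i) y)| <= e) ->
  forall y, Om y ->
  `|p y - \sum_(i < N) p (node T N i.+1) *
     (\1_(`]-oo, node T N i.+1]%classic) y - \1_(`]-oo, node T N i]%classic) y)| <= e.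
Proof.
move=> N0' H y Oy.
pose d := T / N%:R / 4.
have h0 : 0 < T / N%:R by rewrite divr_gt0// ltr0n.
have d0 : 0 < d by rewrite divr_gt0.
pose a n i := node T N i + d / n.+1%:R.
pose b n i := node T N i + 2 * d / n.+1%:R.
have dn n : 0 < d / n.+1%:R <= d.
  by rewrite mulr_gt0 ?invr_gt0//= ler_pdivrMr// ler_peMr ?ler1n// ltW.
have {}H n := H (a n) (b n).
have {}H n : `|p y - \sum_(i < N) p (node T N i.+1) *
    (cut (a n i.+1) (b n i.+1) y - cut (a n i) (b n i) y)| <= e.
  apply: H => // i; rewrite /a /b -mulrA.
  have -> : node T N i.+1 = node T N i + 4 * d.
    by rewrite /node -(natr1 i) /d; field; rewrite pnatr_eq0 -lt0n.
  have := dn n; move: (d / n.+1%:R) => r /andP[? ?].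
  by split; [|split]; lra.
suff sc : `|p y - \sum_(i < N) p (node T N i.+1) *
    (cut (a n i.+1) (b n i.+1) y - cut (a n i) (b n i) y)| @[n --> \oo] -->
    `|p y - \sum_(i < N) p (node T N i.+1) *
     (\1_(`]-oo, node T N i.+1]%classic) y - \1_(`]-oo, node T N i]%classic) y)|.
  by apply: (cvgr_to_le sc); exact: nearW.
apply: cvg_norm; apply: cvgB; first exact: cvg_cst.
apply: (@cvg_sum_ord R N (fun i n => p (node T N i.+1) *
    (cut (a n i.+1) (b n i.+1) y - cut (a n i) (b n i) y)) (fun i => p (node T N i.+1) *
     (\1_(`]-oo, node T N i.+1]%classic) y - \1_(`]-oo, node T N i]%classic) y))) => i.
by apply: cvgM; [exact: cvg_cst|apply: cvgB; exact: cut_cvg].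
Qed.

(** Both sides are compared with the Riemann-Stieltjes sum [Z] of p against [distfun]. The step
    function with coefficients p(x_(i+1)) has integral exactly [Z]; the smooth sum [S] with the same
    coefficients and nearly optimal cutoffs has [sup_below] close to [Z]; both are uniformly close
    to p. *)
Lemma sup_below_representation : exists m : {finite_measure set (measurableTypeR R) -> \bar R},
  (forall x, 0 <= x <= T -> 0 <= fine (m `]0, x]%classic) <= K) /\
  forall p : C0 T, (forall x, 0 <= p x) -> \int[m]_(x in Om) p x = sup_below p.
Proof.
have [m mE] := exists_stieltjes_measure 0 T distfun_nondecreasing distfun_right_continuous.
have T0' := T0.
exists m; split.
  move=> x /andP[x0 xT]; rewrite mE//= subr_ge0 distfun_nondecreasing//=.
  by have := distfun_leK x; have := distfun_ge0 0; lra.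
move=> p p0.
have mO : measurable (Om : set (measurableTypeR R)) := measurable_Omega T.
have ap : admissible p.
  split; first exact: C0_continuous.
  by exists `|p| => x; rewrite p0 (le_trans (ler_norm _) (C0_le_norm p x)).
have [cp _] := ap.
suff close e : 0 < e -> `|\int[m]_(x in Om) p x - sup_below p| <= e * (fine (m Om) + `|p| + K).
  apply/eqP; rewrite -subr_eq0 -normr_le0; apply/ler_addgt0Pl => e e0; rewrite addr0.
  pose C := fine (m Om) + `|p| + K.
  have C0 : 0 <= C by rewrite !addr_ge0// fine_ge0.
  have C1 : 0 < C + 1 by rewrite ltr_wpDl.
  apply: le_trans (close (e / (C + 1)) _) _; first by rewrite divr_gt0.
  by rewrite -/C mulrAC ler_pdivrMr// ler_pM2l// lerDl.
move=> e0.
have [N0 N00 H] := partition_of_unity_approx T0 p e0.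
have {}H := H N0 _ _ (leqnn _).
pose x_ i := node T N0 i.
have h0 : 0 < T / N0%:R by rewrite divr_gt0// ltr0n.
have xS i : x_ i.+1 = x_ i + T / N0%:R.
  by rewrite /x_ /node -(natr1 i) mulrDl mul1r mulrDl.
have xN : x_ N0 = T by rewrite /x_ /node mulrAC divff ?mul1r// pnatr_eq0 -lt0n.
have x_le i j : (i <= j)%N -> x_ i <= x_ j.
  by move=> ij; rewrite /x_ /node ler_wpM2r ?invr_ge0 ?ler0n// ler_wpM2r ?ler_nat// ltW.
have x_0 : x_ 0 = 0 by rewrite /x_ /node !mul0r.
(* Each of the N0 terms of [Z] will be off by at most e' |p|, in total e |p|. *)
pose e' := e / N0%:R.
have e'0 : 0 < e' by rewrite divr_gt0// ltr0n.
have ex_ab i : exists c : R * R, [/\ x_ i < c.1, c.1 < c.2, c.2 < x_ i.+1 &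
     sup_below (cut c.1 c.2) <= distfun (x_ i) + e'].
  have [a [b [? ? ? ?]]] := distfun_approx (x_ i) e'0 h0.
  by exists (a, b); split => //=; rewrite xS.
have [ab abP] := choice ex_ab.
pose k i := cut (ab i).1 (ab i).2.
pose th i x := k i.+1 x - k i x.
have ak i : admissible (k i) by exact: admissible_cut.
have th_ge0 i x : 0 <= th i x.
  have [? ? ? _] := abP i; have [? ? ? _] := abP i.+1.
  have := cut_itv (ab i).1 (ab i).2 x; have := cut_itv (ab i.+1).1 (ab i.+1).2 x.
  rewrite /th /k; have [xb|xb] := leP (ab i).2 x.
    by rewrite [cut (ab i).1 _ _]cut_right//; lra.
  by rewrite [cut (ab i.+1).1 _ _]cut_left; lra.
have ath i : admissible (th i).
  split; first by move=> x; apply: continuousB; [exact: (ak i.+1).1|exact: (ak i).1].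
  exists 1 => x; rewrite th_ge0 /th /k.
  have := cut_itv (ab i).1 (ab i).2 x; have := cut_itv (ab i.+1).1 (ab i.+1).2 x; lra.
have sth i : sup_below (th i) = sup_below (k i.+1) - sup_below (k i).
  apply/eqP; rewrite eq_sym subr_eq -sup_belowD//; apply/eqP; congr sup_below.
  by apply/funext => x; rewrite /th subrK.
pose S x := \sum_(i < N0) p (x_ i.+1) * th i x.
have [aS sS] : admissible S /\ sup_below S = \sum_(i < N0) p (x_ i.+1) * sup_below (th i).
  by apply: (@sup_below_sum N0 (fun i => p (x_ i.+1))) => i _.
have ae : admissible (fun=> e) by apply: admissible_cst; exact: ltW.
have se : sup_below (fun=> e) <= K * e by apply: sup_below_bound => //; exact: ltW.
have pS y : Om y -> `|p y - S y| <= e.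
  move=> Oy; apply: (H (fun i => (ab i).1) (fun i => (ab i).2)) => // i.
  by have [] := abP i.
(* Constants are admissible although they do not vanish at the boundary, so a uniform error e is
   absorbed by monotonicity and additivity of [sup_below]. *)
have h1 : `|sup_below S - sup_below p| <= e * K.
  have l1 : sup_below p <= sup_below (fun x => S x + e).
    apply: sup_below_mono => //; first exact: admissibleD.
    by move=> y Oy; have := pS y Oy; rewrite ler_norml; lra.
  have l2 : sup_below S <= sup_below (fun x => p x + e).
    apply: sup_below_mono => //; first exact: admissibleD.
    by move=> y Oy; have := pS y Oy; rewrite ler_norml; lra.
  move: l1 l2 se; rewrite !sup_belowD// => l1 l2 se.
  by rewrite ler_norml; lra.
pose Z := \sum_(i < N0) p (x_ i.+1) * (distfun (x_ i.+1) - distfun (x_ i)).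
have h2 : `|Z - sup_below S| <= e * `|p|.
  rewrite /Z sS -sumrB; apply: le_trans (ler_norm_sum _ _ _) _.
  apply: (@le_trans _ _ (\sum_(i < N0) `|p| * e')); last first.
    by rewrite sumr_const card_ord -mulr_natr /e' -mulrA divfK ?pnatr_eq0 -?lt0n// mulrC.
  apply: ler_sum => i _; rewrite -mulrBr normrM; apply: ler_pM => //; first exact: C0_le_norm.
  have [a1 a2 _ a3] := abP i; have [b1 b2 _ b3] := abP i.+1.
  have := distfun_le a1 a2; have := distfun_le b1 b2.
  by rewrite sth /k ler_norml; lra.
pose s i x := \1_(`]-oo, x_ i.+1]%classic) x - \1_(`]-oo, x_ i]%classic) x : R.
have sE i x : s i x = \1_(`]x_ i, x_ i.+1]%classic) x.
  rewrite /s !indicE !mem_setE !in_itv/=; have [xa|xa] := leP x (x_ i).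
    by rewrite (le_trans xa) ?subrr// x_le.
  by rewrite subr0.
have si i : m.-integrable Om (EFin \o s i).
  apply: measurable_bounded_integrable => //.
  - by rewrite ltey_eq fin_num_measure.
  - rewrite (_ : s i = \1_(`]x_ i, x_ i.+1]%classic)); last by apply/funext => x; exact: sE.
    by apply: measurable_indic; exact: measurable_itv.
  - exists 1; split => // M M1 x _ /=; rewrite (le_trans _ (ltW M1))// sE indicE.
    by case: (x \in _); rewrite ?normr1 ?normr0.
have [iS intS] := Rintegral_sum_ord N0 (fun i => p (x_ i.+1)) mO si.
have ps y : Om y -> `|p y - \sum_(i < N0) p (x_ i.+1) * s i y| <= e.
  by apply: step_approx => // a b; exact: H.
have h3 : `|\int[m]_(x in Om) p x - Z| <= e * fine (m Om).
  have -> : Z = \int[m]_(x in Om) (\sum_(i < N0) p (x_ i.+1) * s i x).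
    rewrite intS; apply: eq_bigr => i _.
    (* The last interval contains T, which lies outside (0, T), so the mass formula does not apply
       to its trace there; but its coefficient p(T) is 0. *)
    have [iN|iN] := eqVneq i.+1 N0.
      by rewrite iN xN (C0_out p) ?mul0r// /Omega/= in_itv/= ltxx andbF.
    congr (_ * _); have lt_iN : (i.+1 < N0)%N by rewrite ltn_neqAle iN ltn_ord.
    have x_i0 : 0 <= x_ i by rewrite -x_0; exact: x_le.
    have x_iT : x_ i.+1 < T by rewrite -xN (lt_le_trans _ (x_le _ _ lt_iN))// (xS i.+1) ltrDl.
    rewrite (@eq_Rintegral _ _ _ m _ (\1_(`]x_ i, x_ i.+1]%classic))); last by move=> x _; exact: sE.
    rewrite /Rintegral integral_indic; [|exact: mO|exact: measurable_itv].
    rewrite (_ : _ `&` Om = `]x_ i, x_ i.+1]%classic).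
      by rewrite [X in fine X](mE _ _ x_i0 (x_le _ _ (leqnSn i)) (ltW x_iT)).
    apply/setIidl => x; rewrite /Omega/= !in_itv/= => /andP[? ?].
    by rewrite (le_lt_trans x_i0)//= (le_lt_trans _ x_iT).
  have ip := finite_measure_integrable T m cp.
  rewrite -(RintegralB mO ip iS).
  have iB := @integrableB _ _ _ m _ mO _ _ ip iS.
  apply: le_trans (le_normr_Rintegral mO iB) _.
  rewrite -Rintegral_cst//; apply: le_Rintegral => //.
  - exact: (integrable_norm iB).
  - by apply: finite_measure_integrable => x; exact: cst_continuous.
rewrite (_ : _ - _ = (\int[m]_(x in Om) p x - Z) + (Z - sup_below S) + (sup_below S - sup_below p)); last by ring.
by rewrite !mulrDr; apply: le_trans (ler_normD _ _) _; apply: lerD => //; apply: le_trans (ler_normD _ _) _; apply: lerD.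
Qed.

End positive_part.

(** * Functions of bounded variation *)

Section riesz.
Context {R : realType} (T : R) (T0 : 0 < T).
Local Notation Om := (Omega T).

(** For p >= 0 the substitution q -> p - q exchanges the competitors of F and of -F, which gives F p
    as the difference of the two positive parts. A general p is max(p, 0) minus the nonnegative
    max(p, 0) - p. The bounds on the masses of ]0, x] will bound the BV representative. *)
Lemma C0_riesz (F : C0 T -> R) (K : R) :
  (forall a p q, F (a *: p + q) = a * F p + F q) ->
  (forall p, `|F p| <= K * `|p|) ->
  exists m1 m2 : {finite_measure set (measurableTypeR R) -> \bar R},
    (forall x, 0 <= x <= T -> 0 <= fine (m1 `]0, x]%classic) <= K) /\
    (forall x, 0 <= x <= T -> 0 <= fine (m2 `]0, x]%classic) <= K) /\
    forall p, F p = \int[m1]_(x in Om) p x - \int[m2]_(x in Om) p x.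
Proof.
move=> FL FK.
have F0 : F 0 = 0 by have := FL (-1) 0 0; rewrite scaler0 addr0 mulN1r addNr.
have FD p q : F (p + q) = F p + F q by rewrite -[p in LHS]scale1r FL mul1r.
pose N p := - F p.
have NL a p q : N (a *: p + q) = a * N p + N q by rewrite /N FL; ring.
have NK p : `|N p| <= K * `|p| by rewrite /N normrN.
have [m1 [m1K m1E]] := sup_below_representation T0 FL FK.
have [m2 [m2K m2E]] := sup_below_representation T0 NL NK.
exists m1, m2; split => //; split => //.
have posE (p : C0 T) : (forall x, 0 <= p x) -> F p = sup_below F p - sup_below N p.
  move=> p0.
  have ap : admissible p.
    split; first exact: C0_continuous.
    by exists `|p| => x; rewrite p0 (le_trans (ler_norm _) (C0_le_norm p x)).
  have compl (q : C0 T) : (forall x, Om x -> 0 <= q x <= p x) ->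
      forall x, Om x -> 0 <= (p - q) x <= p x.
    move=> q_ x Ox; have /andP[q0 qp] := q_ x Ox.
    by rewrite -[(p - q) x]/(p x - q x) subr_ge0 qp lerBlDr lerDl.
  have FB q : F (p - q) = F p - F q.
    by apply/eqP; rewrite eq_sym subr_eq -FD subrK.
  apply/eqP; rewrite eq_sym subr_eq eq_le; apply/andP; split.
    apply: (sup_below_le T0 FK ap) => q q_.
    have := sup_below_ge T0 NK ap (compl q q_); rewrite /N FB; lra.
  rewrite -lerBrDl; apply: (sup_below_le T0 NK ap) => q q_.
  have := sup_below_ge T0 FK ap (compl q q_); rewrite /N FB; lra.
move=> p.
have cp : continuous p by exact: C0_continuous.
have c1 : continuous (fun x => Num.max (p x) 0).
  by move=> x; apply: (@continuous_max R R (C0_fun p) (cst 0) x); [exact: cp|exact: cst_continuous].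
have z1 x : ~ Om x -> Num.max (p x) 0 = 0 by move=> nx; rewrite (C0_out p nx) maxxx.
pose p1 := toC0 c1 z1.
have p1_0 x : 0 <= p1 x by rewrite -[p1 x]/(Num.max (p x) 0) le_max lexx orbT.
have p2_0 x : 0 <= (p1 - p) x.
  by rewrite -[(p1 - p) x]/(Num.max (p x) 0 - p x) subr_ge0 le_max lexx.
have pE : p = -1 *: (p1 - p) + p1 by rewrite scaleN1r opprB subrK.
have intE (m : {finite_measure set (measurableTypeR R) -> \bar R}) :
    \int[m]_(x in Om) p x = - (\int[m]_(x in Om) (p1 - p) x) + \int[m]_(x in Om) p1 x.
  have := @RintegralZD R T m (-1) (p1 - p) p1 (C0_continuous (p := _)) (C0_continuous (p := _)).
  rewrite mulN1r => <-; apply: eq_Rintegral => x _.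
  rewrite -[(p1 - p) x]/(p1 x - p x); ring.
rewrite !intE {1}pE FL !posE// !m1E// !m2E//; ring.
Qed.

End riesz.

(** * Density of test functions in C_0 *)

Section density.
Context {R : realType} (T : R) (T0 : 0 < T).
Local Notation mu := (@lebesgue_measure R).
Local Notation Om := (Omega T).

Lemma C0_dense_eq0 (L : (R -> R) -> R) (K : R) :
  (forall f g : R -> R, continuous f -> continuous g -> L (fun x => -1 * f x + g x) = - L f + L g) ->
  (forall (f : R -> R) M, continuous f -> (forall x, Om x -> `|f x| <= M) -> `|L f| <= M * K) ->
  (forall q, bump T q -> L q = 0) -> forall p : C0 T, L p = 0.
Proof.
move=> LB LK L0 p; apply/eqP; rewrite -normr_le0.
have cp : continuous p by exact: C0_continuous.
have close e : 0 < e -> `|L p| <= e * K.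
  move=> e0; have [q bq pq] := bump_dense T0 p e0.
  have cq := test_continuousT (bump_test bq).
  have <- : L (fun x => -1 * q x + p x) = L p by rewrite LB// L0// oppr0 add0r.
  apply: LK => [x|x Ox]; last by rewrite mulN1r addrC pq.
  have caf : continuous (fun x => -1 * q x).
    by move=> y; exact: continuousM (@cst_continuous R R (-1) y) (cq y).
  exact: continuousD (caf x) (cp x).
have K0 : 0 <= K by have := close _ ltr01; rewrite mul1r; exact: le_trans.
apply/ler_addgt0Pl => e e0; rewrite addr0.
apply: le_trans (close (e / (K + 1)) _) _; first by rewrite divr_gt0// ltr_wpDl.
by rewrite mulrAC ler_pdivrMr ?ltr_wpDl// ler_pM2l// lerDl.
Qed.

Lemma Rintegral_Omega_linear (a : R) (f g : R -> R) : continuous f -> continuous g ->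
  \int[mu]_(x in Om) (a * f x + g x) = a * \int[mu]_(x in Om) f x + \int[mu]_(x in Om) g x.
Proof.
move=> cf cg; have mO : measurable (Om : set (measurableTypeR R)) := measurable_Omega T.
have iO h : continuous h -> mu.-integrable Om (EFin \o h).
  by move=> ch; apply: continuous_integrable_itv ch _; exact: subset_itv_oo_cc.
have iaf : mu.-integrable Om (EFin \o (fun x => a * f x)).
  exact: (@integrableZl _ _ _ mu _ mO a (EFin \o f) (iO f cf)).
by rewrite (RintegralD mO iaf (iO g cg)) (RintegralZl a mO (iO f cf)).
Qed.

Lemma Rintegral_Omega_norm_le (f : R -> R) M : continuous f ->
  (forall x, Om x -> `|f x| <= M) -> `|\int[mu]_(x in Om) f x| <= M * T.
Proof.
move=> cf fM; have mO : measurable (Om : set (measurableTypeR R)) := measurable_Omega T.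
have iO h : continuous h -> mu.-integrable Om (EFin \o h).
  by move=> ch; apply: continuous_integrable_itv ch _; exact: subset_itv_oo_cc.
apply: le_trans (le_normr_Rintegral mO (iO f cf)) _.
have -> : M * T = \int[mu]_(x in Om) M.
  by rewrite Rintegral_cst// [X in fine X](lebesgue_Omega T0).
apply: le_Rintegral => //.
- by apply: iO => x; apply: continuous_comp; [exact: cf|exact: norm_continuous].
- by apply: iO => x; exact: cst_continuous.
Qed.

(** Used twice: c = 0 gives uniqueness of the distributional derivative on C_0, and n2 = 0
    identifies the derivative of an affine function. *)
Lemma charge_integral_dense (n1 n2 : {charge set (measurableTypeR R) -> \bar R}) (c : R) :
  (forall q, test_function T q ->
    charge_integral n1 Om q = charge_integral n2 Om q + c * \int[mu]_(x in Om) q x) ->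
  forall p : C0 T,
    charge_integral n1 Om p = charge_integral n2 Om p + c * \int[mu]_(x in Om) p x.
Proof.
move=> H p.
pose L (f : R -> R) := charge_integral n1 Om f - charge_integral n2 Om f - c * \int[mu]_(x in Om) f x.
suff : L p = 0 by move=> /eqP; rewrite /L subr_eq0 subr_eq addrC => /eqP.
apply: (@C0_dense_eq0 L (charge_mass T n1 + charge_mass T n2 + `|c| * T)).
- move=> f g cf cg; rewrite /L !charge_integralZD// Rintegral_Omega_linear//; ring.
- move=> f M cf fM; rewrite /L mulrDr mulrDr.
  apply: le_trans (ler_normB _ _) _; apply: lerD.
    apply: le_trans (ler_normB _ _) _.
    by apply: lerD; exact: charge_integral_norm_le.
  rewrite normrM mulrCA; apply: ler_wpM2l => //.
  exact: Rintegral_Omega_norm_le.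
- by move=> q bq; rewrite /L (H q (bump_test bq)); ring.
Qed.

End density.

(** * The distributional derivative as a functional on C_0 *)

Section BV_facts.
Context {R : realType} (T : R) (T0 : 0 < T).
Local Notation mu := (@lebesgue_measure R).
Local Notation Om := (Omega T).
Implicit Types (u w : BV T) (p q : C0 T).

Let mO : measurable (Om : set (measurableTypeR R)) := measurable_Omega T.

Lemma BV_integrable u : mu.-integrable Om (EFin \o u).
Proof. by case: u => u /=; rewrite inE => -[]. Qed.

Definition derivative_integral u (f : R -> R) : R := charge_integral (BV_deriv u) Om f.

Lemma derivative_integral_test u v : test_function T v ->
  derivative_integral u v = - \int[mu]_(x in Om) (u x * v^`()%classic x).
Proof.
move=> tv; have := projT2 (cid (BV_derivative u)) v tv.
by rewrite -/(BV_deriv u) => ->; rewrite opprK.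
Qed.

(** [BV_deriv] picks an arbitrary charge; any two derivatives of u agree on test functions, hence on
    C_0 by density. *)
Lemma derivative_integral_unique u nu : distributional_derivative T u nu ->
  forall p, derivative_integral u p = charge_integral nu Om p.
Proof.
move=> Du p; have := @charge_integral_dense R T T0 (BV_deriv u) nu 0.
move=> /(_ _ p); rewrite mul0r addr0; apply => q tq.
rewrite -/(derivative_integral u q) derivative_integral_test// Du// opprK; ring.
Qed.

Lemma derivative_integral_linear (a : R) u w p :
  derivative_integral (a *: u + w) p = a * derivative_integral u p + derivative_integral w p.
Proof.
have Du : distributional_derivative T u (BV_deriv u) := projT2 (cid (BV_derivative u)).
have Dw : distributional_derivative T w (BV_deriv w) := projT2 (cid (BV_derivative w)).
have D : distributional_derivative T (a *: u + w : BV T) (cadd (cscale a (BV_deriv u)) (BV_deriv w)).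
  exact: (distributional_derivative_linear a (BV_integrable u) (BV_integrable w) Du Dw).
rewrite (derivative_integral_unique D).
have cp : continuous p by exact: C0_continuous.
by rewrite (charge_integral_linear _ _ _ mO (continuous_measurable cp) (continuous_bounded T cp)).
Qed.

Lemma derivative_integral_C0ZD u (a : R) (f g : R -> R) : continuous f -> continuous g ->
  derivative_integral u (fun x => a * f x + g x) =
  a * derivative_integral u f + derivative_integral u g.
Proof. exact: charge_integralZD. Qed.

Lemma derivative_integral_affine u (c d : R) :
  {ae mu, forall x, Om x -> u x = c * x + d} ->
  forall p, derivative_integral u p = c * \int[mu]_(x in Om) p x.
Proof.
move=> uE p.
pose z0 : {charge set (measurableTypeR R) -> \bar R} := czero.
have z (f : R -> R) : continuous f -> charge_integral z0 Om f = 0.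
  by move=> cf; apply: charge_integral_czero => //; [exact: continuous_measurable|exact: continuous_bounded].
transitivity (charge_integral z0 Om p + c * \int[mu]_(x in Om) p x); last first.
  by rewrite (z p (C0_continuous (p := p))) add0r.
rewrite /derivative_integral; apply: (@charge_integral_dense R T T0 (BV_deriv u) z0 c) => q tq; rewrite (z q (test_continuousT tq)) add0r.
rewrite -/(derivative_integral u q) derivative_integral_test//.
rewrite -[RHS]opprK -(Rintegral_affine_test_derive T0 c d tq); congr (- _).
rewrite /Rintegral; congr fine; apply: ae_eq_integral => //.
- have := BV_test_integrable 1 (BV_integrable u) tq; rewrite derive1n1.
  by case/integrableP.
- apply/measurable_EFinP; apply: continuous_measurable.
  have caff : continuous (fun x : R => c * x + d).
    by move=> x; apply/differentiable_continuous/derivable1_diffP; case: (is_derive_affine c d x).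
  by move=> x; exact: continuousM (caff x) (test_continuousT (test_derive tq) (x := x)).
- apply: (@filterS _ _ (ae_filter_ringOfSetsType mu)) uE => x h Ox.
  by rewrite (h Ox).
Qed.

(** A functional that vanishes on mean-zero functions is c times the integral, c being its value at
    a unit bump. Then u - c x has zero derivative and is a.e. constant. *)
Lemma BV_affine_of_orthogonal u :
  (forall p : C0a T, derivative_integral u p = 0) -> u \in @affine_pred R T.
Proof.
move=> u0; have [phi bphi phi1] := exists_bump_unit T0.
pose phi0 := test_C0 (bump_test bphi).
have cphi : continuous phi by exact: (C0_continuous (p := phi0)).
pose c := derivative_integral u phi.
have uE (q : R -> R) : test_function T q -> derivative_integral u q = c * \int[mu]_(x in Om) q x.
  move=> tq; pose q0 := test_C0 tq; pose M := \int[mu]_(x in Om) q x.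
  have cq := test_continuousT tq.
  have m0 : - M *: phi0 + q0 \in @C0a_pred R T.
    rewrite inE/= (Rintegral_Omega_linear T (- M) cphi cq) phi1 -/M; ring.
  have := u0 (MkC0a m0).
  rewrite (derivative_integral_C0ZD u (- M) cphi cq) -/c -/M => /eqP.
  by rewrite mulNr addrC subr_eq0 mulrC => /eqP.
have caff : continuous (fun x : R => c * x + 0).
  by move=> x; apply/differentiable_continuous/derivable1_diffP; case: (is_derive_affine c 0 x).
have iaff : mu.-integrable Om (EFin \o (fun x => c * x + 0)).
  by apply: continuous_integrable_itv caff _; exact: subset_itv_oo_cc.
have iuaff := @integrableB _ _ _ mu _ mO _ _ (BV_integrable u) iaff.
have [||d ud] := @du_bois_reymond R T T0 (fun x => u x - (c * x + 0)).
- exact: iuaff.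
- move=> v tv.
  have iuv := BV_test_integrable 1 (BV_integrable u) tv.
  have icv := BV_test_integrable 1 iaff tv.
  rewrite derive1n1 in iuv icv.
  under eq_Rintegral do rewrite mulrBl.
  rewrite (@RintegralB _ _ _ mu _ _ _ mO iuv icv) (Rintegral_affine_test_derive T0 c 0 tv).
  have := derivative_integral_test u tv; rewrite uE//; lra.
rewrite inE; exists c, d; apply: (@filterS _ _ (ae_filter_ringOfSetsType mu)) ud => x h Ox.
by have := h Ox; lra.
Qed.

(* u(x) = nu(]0, x]) where nu is the signed measure representing F. *)
Lemma exists_BV_representative (F : C0 T -> R) (K : R) :
  (forall a p q, F (a *: p + q) = a * F p + F q) ->
  (forall p, `|F p| <= K * `|p|) ->
  exists2 u : BV T, (forall x, Om x -> `|u x| <= K) &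
    forall p, derivative_integral u p = F p.
Proof.
move=> FL FK; have [m1 [m2 [m1K [m2K FE]]]] := C0_riesz T0 FL FK.
pose u x : R := fine (m1 `]0, x]%classic) - fine (m2 `]0, x]%classic).
have nd (m : {finite_measure set (measurableTypeR R) -> \bar R}) :
    {homo (fun x : R => fine (m `]0, x]%classic)) : x y / x <= y}.
  move=> x y xy; apply: fine_le; rewrite ?fin_num_measure//; try exact: measurable_itv.
  by apply: le_measure; rewrite ?inE; [exact: measurable_itv|exact: measurable_itv|exact: subset_itvl].
have mm (m : {finite_measure set (measurableTypeR R) -> \bar R}) :
    measurable_fun (Om : set (measurableTypeR R)) (fun x : R => fine (m `]0, x]%classic)).
  by apply: nondecreasing_measurable; [exact: measurable_Omega|exact: nd].
have Om_cc x : Om x -> 0 <= x <= T by rewrite /Omega/= in_itv/= => /andP[? ?]; rewrite !ltW.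
(* A difference of two numbers in [0, K], hence K and not 2 K. *)
have uK x : Om x -> `|u x| <= K.
  move=> /Om_cc Ox; have /andP[? ?] := m1K _ Ox; have /andP[? ?] := m2K _ Ox.
  by rewrite /u ler_norml; lra.
have im (m : {finite_measure set (measurableTypeR R) -> \bar R}) :
    (forall x, 0 <= x <= T -> 0 <= fine (m `]0, x]%classic) <= K) ->
    mu.-integrable Om (EFin \o (fun x : R => fine (m `]0, x]%classic))).
  move=> mK; apply: measurable_bounded_integrable => //.
  - by rewrite [X in (X < _)%E](lebesgue_Omega T0) ltry.
  - exists K; split; first exact: num_real.
    move=> M KM x /Om_cc/mK/andP[x0 xK] /=.
    by rewrite ger0_norm// (le_trans xK)// ltW.
have iu : mu.-integrable Om (EFin \o u).
  exact: (@integrableB _ _ _ mu _ mO _ _ (im _ m1K) (im _ m2K)).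
pose nu := cadd (cscale (-1) (charge_of_finite_measure m2)) (charge_of_finite_measure m1).
have nuE f : continuous f ->
    charge_integral nu Om f = \int[m1]_(x in Om) f x - \int[m2]_(x in Om) f x.
  move=> cf; apply: charge_integralE => //.
  - exact: continuous_measurable.
  - exact: continuous_bounded.
  move=> A mA; transitivity ((-1)%:E * m2 A + m1 A)%E => //.
  by rewrite EFinN mulN1e addeC.
have Du : distributional_derivative T u nu.
  move=> v tv.
  have i1 := BV_test_integrable 1 (im _ m1K) tv.
  have i2 := BV_test_integrable 1 (im _ m2K) tv.
  rewrite derive1n1 in i1 i2.
  rewrite (nuE v (test_continuousT tv)).
  under eq_Rintegral do rewrite /u mulrBl.
  rewrite (@RintegralB _ _ _ mu _ _ _ mO i1 i2) !finite_measure_by_parts//; ring.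
have uBV : u \in BV_pred T by rewrite inE; split => //; exists nu.
exists (MkBV uBV) => // p.
rewrite (@derivative_integral_unique (MkBV uBV) nu Du) nuE ?FE//.
exact: C0_continuous.
Qed.

End BV_facts.

(** * The quotient space and its pairing *)

Section quotient_pairing.
Context {R : realType} (T : R) (T0 : 0 < T).
Local Notation mu := (@lebesgue_measure R).
Local Notation Om := (Omega T).
Implicit Types (u w : BV T) (x y : BVL T) (p q : C0a T).

Lemma BVL_class_repr x : BVL_class (repr x) = x.
Proof. exact: quot_piK. Qed.

Lemma BVL_class_eq u w : BVL_class u = BVL_class w <-> u - w \in @affine_pred R T.
Proof. by split => [/quot_piP|h]//; apply/quot_piP. Qed.

Lemma BVL_class_linear (a : R) u w : BVL_class (a *: u + w) = a *: BVL_class u + BVL_class w.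
Proof. exact: (quot_pi_is_linear (@affine_pred R T)). Qed.

(** The representative chosen in the class differs from u by an a.e. affine function, whose
    derivative c dx annihilates the mean-zero p. *)
Lemma pairing_class u p : pairing (BVL_class u) p = derivative_integral u p.
Proof.
set w := repr (BVL_class u).
have : w - u \in @affine_pred R T by apply/BVL_class_eq; exact: BVL_class_repr.
rewrite inE => -[c [d wu]].
have p0 : \int[mu]_(x in Om) p x = 0 by case: p => p /=; rewrite inE.
rewrite -[pairing _ _]/(derivative_integral w p).
have -> : w = 1 *: (w - u) + u by rewrite scale1r subrK.
by rewrite derivative_integral_linear// (derivative_integral_affine T0 wu) p0 mulr0 mulr0 add0r.
Qed.

Lemma pairing_linearl p (a : R) x y :
  pairing (a *: x + y) p = a * pairing x p + pairing y p.
Proof.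
rewrite -{1}(BVL_class_repr x) -{1}(BVL_class_repr y) -BVL_class_linear pairing_class.
exact: derivative_integral_linear.
Qed.

Lemma pairing_linearr x (a : R) p q : pairing x (a *: p + q) = a * pairing x p + pairing x q.
Proof.
exact: (@charge_integralZD R T (BV_deriv (repr x)) a p q (C0_continuous (p := p))
  (C0_continuous (p := q))).
Qed.

Lemma pairing_eq0 x : (forall p, pairing x p = 0) -> x = 0.
Proof.
move=> x0; rewrite -(BVL_class_repr x).
have -> : 0 = BVL_class (0 : BV T).
  by have := BVL_class_linear (-1) 0 0; rewrite scaler0 addr0 scaleN1r addNr.
apply/BVL_class_eq; rewrite subr0; exact: BV_affine_of_orthogonal.
Qed.

Lemma pairing_inj x y : (forall p, pairing x p = pairing y p) -> x = y.
Proof.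
move=> xy; apply/eqP; rewrite -subr_eq0; apply/eqP; apply: pairing_eq0 => p.
by rewrite addrC -scaleN1r pairing_linearl xy; ring.
Qed.

(** An upper bound of the dual norm, kept as a real inequality so that constants move freely without
    extended-real arithmetic. *)
Definition dual_bound x (C : R) := forall p, `|pairing x p| <= C * `|p|.

Lemma exists_dual_bound x : exists C, 0 <= C /\ dual_bound x C.
Proof.
exists (charge_mass T (BV_deriv (repr x))); split; first exact: charge_mass_ge0.
move=> p; rewrite mulrC; apply: charge_integral_norm_le; first exact: C0_continuous.
by move=> y _; exact: C0_le_norm.
Qed.

End quotient_pairing.

(** * Approximation and projection in C_{0,a} *)

Section mean_zero.
Context {R : realType} (T : R) (T0 : 0 < T).
Local Notation mu := (@lebesgue_measure R).
Local Notation Om := (Omega T).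

Lemma C0a_integral (p : C0a T) : \int[mu]_(x in Om) p x = 0.
Proof. by case: p => p /=; rewrite inE. Qed.

Lemma test_derive_mean0 (v : R -> R) (tv : test_function T v) :
  test_C0 (test_derive tv) \in @C0a_pred R T.
Proof. by rewrite inE; exact: Rintegral_test_derive. Qed.

Definition test_C0a (v : R -> R) (tv : test_function T v) : C0a T :=
  MkC0a (test_derive_mean0 tv).

(** Since p has mean zero, a bump within e / M of p has mean at most T e / M, and removing that mean
    costs at most T |phi0| e / M; this dictates M = 1 + T |phi0|. *)
Lemma bump_mean0_dense (p : C0a T) (e : R) : 0 < e ->
  exists q, [/\ bump T q, \int[mu]_(x in Om) q x = 0 & forall x, Om x -> `|p x - q x| <= e].
Proof.
move=> e0; have [phi bphi phi1] := exists_bump_unit T0.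
pose phi0 := test_C0 (bump_test bphi).
pose M := 1 + T * `|phi0|.
have M0 : 0 < M by rewrite ltr_wpDr// mulr_ge0// ltW.
have d0 : 0 < e / M by rewrite divr_gt0.
have [q bq pq] := bump_dense T0 p d0.
have cp : continuous p by exact: C0_continuous.
have cphi : continuous phi by exact: (C0_continuous (p := phi0)).
have cq := test_continuousT (bump_test bq).
have qm : `|\int[mu]_(x in Om) q x| <= e / M * T.
  have -> : \int[mu]_(x in Om) q x = \int[mu]_(x in Om) (-1 * p x + q x).
    by rewrite Rintegral_Omega_linear// C0a_integral mulr0 add0r.
  apply: Rintegral_Omega_norm_le => //.
    have cmp : continuous (fun x => -1 * p x).
      by move=> y; exact: continuousM (@cst_continuous R R (-1) y) (cp y).
    by move=> y; exact: continuousD (cmp y) (cq y).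
  by move=> x Ox; rewrite mulN1r addrC distrC pq.
exists (fun x => - (\int[mu]_(x in Om) q x) * phi x + q x); split.
- exact: bump_linear.
- by rewrite Rintegral_Omega_linear// phi1; ring.
- move=> x Ox.
  have -> : p x - (- (\int[mu]_(x in Om) q x) * phi x + q x) =
      (p x - q x) + (\int[mu]_(x in Om) q x) * phi x by ring.
  apply: le_trans (ler_normD _ _) _.
  apply: (@le_trans _ _ (e / M * (1 + T * `|phi0|))); last by rewrite -/M divfK// gt_eqF.
  rewrite mulrDr mulr1 mulrA; apply: lerD; first exact: pq.
  rewrite normrM; apply: ler_pM => //.
  exact: (C0_le_norm phi0).
Qed.

(* p |-> p - (\int p) phi0 with phi0 a bump of unit mass; it extends functionals
   from C_{0,a} to C_0 without Hahn-Banach. *)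
Lemma exists_C0a_projection : exists (proj : C0 T -> C0a T) (k : R),
  [/\ 0 < k, forall (a : R) p q, proj (a *: p + q) = a *: proj p + proj q,
   forall p : C0 T, `|proj p| <= k * `|p| & forall p : C0a T, proj p = p].
Proof.
have [phi bphi phi1] := exists_bump_unit T0.
pose phi0 := test_C0 (bump_test bphi).
pose mean (p : C0 T) := \int[mu]_(x in Om) p x.
have meanL a p q : mean (a *: p + q) = a * mean p + mean q.
  exact: (Rintegral_Omega_linear T a (C0_continuous (p := p)) (C0_continuous (p := q))).
have proj_mean p : - mean p *: phi0 + p \in @C0a_pred R T.
  rewrite inE; apply: (etrans (meanL (- mean p) phi0 p)).
  by rewrite [mean phi0]phi1; ring.
exists (fun p => MkC0a (proj_mean p)), (1 + T * `|phi0|); split.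
- by rewrite ltr_wpDr// mulr_ge0// ltW.
- move=> a p q; apply: val_inj => /=.
  rewrite -[RHS]/(a *: (- mean p *: phi0 + p) + (- mean q *: phi0 + q)) meanL.
  have -> : - (a * mean p + mean q) = a * - mean p - mean q by ring.
  by rewrite scalerDl -scalerA addrACA -scalerDr.
- move=> p; rewrite -[`|_|]/(`|- mean p *: phi0 + p|).
  apply: le_trans (ler_normD _ _) _; rewrite normrZ normrN mulrDl mul1r addrC lerD2l.
  rewrite mulrAC; apply: ler_wpM2r => //.
  rewrite mulrC; apply: Rintegral_Omega_norm_le => //; first exact: C0_continuous.
  by move=> x _; exact: C0_le_norm.
- move=> p; apply: val_inj => /=.
  by rewrite /mean C0a_integral oppr0 scale0r add0r.
Qed.

End mean_zero.

(** * TGV and the dual norm bound each other *)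

Section dual_bounds.
Context {R : realType} (T alpha beta : R) (T0 : 0 < T) (alpha0 : 0 < alpha) (beta0 : 0 < beta).
Local Notation mu := (@lebesgue_measure R).
Local Notation Om := (Omega T).
Implicit Types (u w : BV T) (x : BVL T).

Lemma test_functionN (v : R -> R) : test_function T v -> test_function T (fun y => - v y).
Proof.
move=> [dv cv sv]; have E : [set y | - v y != 0] = [set y | v y != 0].
  by apply/seteqP; split => y /=; rewrite oppr_eq0.
split; [|by rewrite E|by rewrite E]; apply/Ck_all => n.
apply: Ck_ext (CkM (Ck_cst n (-1)) ((Ck_all v).2 dv n)) => y /=.
by rewrite mulN1r.
Qed.

Lemma Rintegral_test_derive2 u (v : R -> R) (tv : test_function T v) :
  \int[mu]_(y in Om) (u y * v^`(2)%classic y) = - pairing (BVL_class u) (test_C0a T0 tv).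
Proof.
rewrite pairing_class// derivative_integral_test ?opprK//.
exact: test_derive.
Qed.

Definition TGV_bound x (t : R) := forall v (tv : test_function T v),
  supnorm T v <= alpha -> supnorm T v^`()%classic <= beta ->
  `|pairing x (test_C0a T0 tv)| <= t.

(** The supremum in TGV has no absolute value, but its constraints are invariant under v -> -v.
    Moreover the integral of u v'' is minus the pairing with v', so TGV depends only on the class of
    u. *)
Lemma TGV_leP u t : (TGV alpha beta u <= t%:E)%E <-> TGV_bound (BVL_class u) t.
Proof.
split=> [h|h].
  have {}h v (tv : test_function T v) : supnorm T v <= alpha -> supnorm T v^`()%classic <= beta ->
      - pairing (BVL_class u) (test_C0a T0 tv) <= t.
    move=> va vb; rewrite -Rintegral_test_derive2 -lee_fin; apply: le_trans h.
    by apply: ereal_sup_ubound; exists v.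
  move=> v tv va vb; rewrite ler_norml lerNl h//=.
  have tNv := test_functionN tv.
  have supN f : supnorm T (fun y => - f y) = supnorm T f.
    by rewrite /supnorm; congr sup; apply: eq_imagel => y _; rewrite normrN.
  have dN : (fun y => - v y)^`()%classic = fun y => - v^`()%classic y.
    apply/funext => y; rewrite !derive1E; apply: (@deriveN _ _ _ v).
    by case: (test_is_derive y tv).
  apply: le_trans (h _ tNv _ _); rewrite ?dN ?supN//.
  rewrite le_eqVlt; apply/orP; left; apply/eqP/esym.
  have -> : test_C0a T0 tNv = -1 *: test_C0a T0 tv + 0.
    apply: val_inj; apply: val_inj; apply/funext => y /=.
    rewrite -[RHS]/(-1 * v^`()%classic y + 0) dN; ring.
  rewrite pairing_linearr.
  have := pairing_linearr (BVL_class u) (-1) (0 : C0a T) 0; rewrite scaler0 addr0; lra.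
apply: ge_ereal_sup => _ [v [tv va vb] <-].
rewrite (Rintegral_test_derive2 u tv) lee_fin; apply: le_trans (h v tv va vb).
by rewrite -normrN ler_norm.
Qed.

Lemma TGVL_leP x t : (TGVL alpha beta x <= t%:E)%E <-> TGV_bound x t.
Proof. by rewrite /TGVL TGV_leP BVL_class_repr. Qed.

Lemma test_function0 : test_function T (fun=> 0).
Proof. exact/bump_test/bump0. Qed.

Lemma supnorm0 : supnorm T (fun=> 0 : R) = 0.
Proof.
by apply/eqP; rewrite eq_le supnorm_ge0 andbT; apply: supnorm_le => // y _; rewrite normr0.
Qed.

Lemma TGV_bound_ge0 x t : TGV_bound x t -> 0 <= t.
Proof.
move=> h; apply: le_trans (h _ test_function0 _ _) => //.
  by rewrite supnorm0 ltW.
rewrite (_ : _^`()%classic = fun=> 0) ?supnorm0 ?ltW//.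
by apply/funext => y; exact: (derive1_cst (0 : R) y).
Qed.

Lemma dual_bound_TGV x C : 0 <= C -> dual_bound x C -> TGV_bound x (beta * C).
Proof.
by move=> C0 xC v tv va vb; apply: le_trans (xC _) _; rewrite mulrC ler_wpM2r.
Qed.

(* Approximate p by the derivative of a test function v. Since |v| <= T |v'|, the
   rescaling of v with |v'| <= min(beta, alpha/T) satisfies both constraints. *)
Lemma TGV_dual_bound x t : TGV_bound x t ->
  dual_bound x (t / Num.min beta (alpha / T)).
Proof.
move=> xt p; have t0 := TGV_bound_ge0 xt.
set m := Num.min _ _.
have m0 : 0 < m by rewrite lt_min beta0 divr_gt0.
(* A crude constant for the error p - q; it is multiplied by e, so its dependence on the chosen
   representative disappears in the limit. *)
pose K := charge_mass T (BV_deriv (repr x)).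
have close e : 0 < e -> `|pairing x p| <= t / m * `|p| + e * (t / m + K).
  move=> e0; have [q [bq q0 pq]] := bump_mean0_dense T0 p e0.
  have [v [bv v'q vE]] := bump_primitive bq q0.
  have cq := test_continuousT (bump_test bq).
  (* s bounds |q| = |v'| on (0, T), hence s T bounds |v|. Scaling by m / s then meets both
     constraints, as m <= beta and m T <= alpha. *)
  pose s := `|p| + e.
  have s0 : 0 < s by rewrite ltr_wpDl.
  have qs y : Om y -> `|q y| <= s.
    move=> Oy; have -> : q y = p y - (p y - q y) by ring.
    by apply: le_trans (ler_normB _ _) _; apply: lerD; [exact: C0_le_norm|exact: pq].
  have vs y : Om y -> `|v y| <= s * T.
    move=> Oy; have := Oy; rewrite vE//.
    rewrite /Omega/= in_itv/= => /andP[y0 yT].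
    have iq : mu.-integrable `]0, y[ (EFin \o q).
      by apply: (continuous_integrable_itv (a := 0) (b := y)) cq _; exact: subset_itv_oo_cc.
    have my : measurable (`]0, y[%classic : set (measurableTypeR R)) by exact: measurable_itv.
    apply: le_trans (le_normr_Rintegral my iq) _.
    apply: (@le_trans _ _ (\int[mu]_(z in `]0, y[) s)).
      apply: le_Rintegral.
      - exact: measurable_itv.
      - exact: (integrable_norm iq).
      - apply: (continuous_integrable_itv (a := 0) (b := y)); last exact: subset_itv_oo_cc.
        by move=> z; exact: cst_continuous.
      - move=> z; rewrite /= in_itv/= => /andP[z0 zy]; apply: qs.
        by rewrite /Omega/= in_itv/= z0 (lt_trans zy).
    rewrite Rintegral_cst; last exact: measurable_itv.
    rewrite [X in fine X](lebesgue_measure_itv `]0, y[%R)/= lte_fin y0 -EFinB subr0/=.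
    by rewrite ler_wpM2l ?ltW.
  pose r := m / s; have r0 : 0 < r by rewrite divr_gt0.
  have brv : bump T (fun y => r * v y + 0) by by apply: bump_linear => //; exact: bump0.
  have trv := bump_test brv.
  have drv : (fun y => r * v y + 0)^`()%classic = fun y => r * q y + 0.
    apply/funext => y; rewrite derive1E -v'q.
    have dv := test_is_derive y (bump_test bv).
    have := is_deriveD (is_deriveZ r dv) (is_derive_cst (0 : R) y (1 : R)).
    by case.
  have := xt _ trv.
  have -> : supnorm T (fun y => r * v y + 0) <= alpha.
    apply: supnorm_le => [|y Oy]; first exact: ltW.
    rewrite addr0 normrM gtr0_norm//.
    apply: (@le_trans _ _ (r * (s * T))); first by rewrite ler_pM2l// vs.
    by rewrite /r mulrA divfK ?gt_eqF// -ler_pdivlMr// ge_min lexx orbT.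
  have -> : supnorm T (fun y => r * v y + 0)^`()%classic <= beta.
    rewrite drv; apply: supnorm_le => [|y Oy]; first exact: ltW.
    rewrite addr0 normrM gtr0_norm//.
    apply: (@le_trans _ _ (r * s)); first by rewrite ler_pM2l// qs.
    by rewrite /r divfK ?gt_eqF// ge_min lexx.
  move=> /(_ isT isT).
  have -> : pairing x (test_C0a T0 trv) = r * derivative_integral (repr x) q.
    have cst0 : continuous (fun _ : R => 0 : R) by move=> z; exact: (@cst_continuous R R 0 z).
    have := derivative_integral_C0ZD (repr x) r cq cst0.
    have := derivative_integral_C0ZD (repr x) (-1) cst0 cst0.
    rewrite (_ : (fun _ : R => -1 * 0 + 0 : R) = fun=> 0); last by apply/funext => y; ring.
    move=> h1 h2; transitivity (derivative_integral (repr x) (fun y => r * q y + 0)).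
      by apply: eq_charge_integral => y _; exact: (congr1 (fun f => f y) drv).
    rewrite h2; lra.
  rewrite normrM (gtr0_norm r0) -ler_pdivlMl// => h.
  have cp : continuous p by exact: C0_continuous.
  have cmq : continuous (fun y => -1 * q y).
    by move=> y; exact: continuousM (@cst_continuous R R (-1) y) (cq y).
  have -> : pairing x p = derivative_integral (repr x) q +
      derivative_integral (repr x) (fun y => -1 * q y + p y).
    by rewrite derivative_integral_C0ZD// -[pairing x p]/(derivative_integral (repr x) p); ring.
  apply: le_trans (ler_normD _ _) _.
  rewrite mulrDr addrA; apply: lerD.
    have -> : t / m * `|p| + e * (t / m) = r^-1 * t by rewrite /r invf_div /s; ring.
    exact: h.
  apply: charge_integral_norm_le; first by move=> y; exact: continuousD (cmq y) (cp y).
  by move=> y Oy; rewrite mulN1r addrC pq.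
have K0 : 0 <= K by exact: charge_mass_ge0.
have C0 : 0 <= t / m + K by rewrite addr_ge0// divr_ge0// ltW.
apply/ler_addgt0Pl => e e0; rewrite addrC.
apply: le_trans (close (e / (t / m + K + 1)) _) _; first by rewrite divr_gt0// ltr_wpDl.
by rewrite lerD2l mulrAC ler_pdivrMr ?ltr_wpDl// ler_pM2l// lerDl.
Qed.

End dual_bounds.

(** * Norms and duality *)

Section norm_bounds.
Context {R : realType} (T : R) (T0 : 0 < T).
Local Notation mu := (@lebesgue_measure R).
Local Notation Om := (Omega T).
Implicit Types (u : BV T) (x : BVL T) (p : C0a T).

Lemma normM_ge (nu : {charge set (measurableTypeR R) -> \bar R}) (p : C0 T) : `|p| <= 1 -> ((charge_integral nu Om p)%:E <= normM T nu)%E.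
Proof. by move=> p1; apply: ereal_sup_ubound; exists p. Qed.

Lemma normM_ge0 nu : (0 <= normM T nu)%E.
Proof.
have := @normM_ge nu 0; rewrite normr0 => /(_ ler01).
have cst0 : continuous (fun _ : R => 0 : R) by move=> z; exact: (@cst_continuous R R 0 z).
have := charge_integralZD T nu (-1) cst0 cst0.
rewrite (_ : (fun _ : R => -1 * 0 + 0 : R) = fun=> 0); last by apply/funext => y; ring.
move=> h; rewrite (_ : charge_integral nu Om (0 : C0 T) = 0)//.
by rewrite -[X in charge_integral _ _ X]/(fun _ : R => 0 : R); lra.
Qed.

Lemma normBV_ge0 u : (0 <= normBV u)%E.
Proof. by rewrite adde_ge0 ?normM_ge0//; apply: integral_ge0. Qed.

Lemma normM_le_normBV u : (normM T (BV_deriv u) <= normBV u)%E.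
Proof. by rewrite leeDr//; apply: integral_ge0. Qed.

Lemma normBVL_ge0 x : (0 <= normBVL x)%E.
Proof. by apply: le_ereal_inf_tmp => _ [u _ <-]; exact: normBV_ge0. Qed.

(** All representatives u of x induce the same functional, bounded by the mass of Du; so the infimum
    over u bounds it too. *)
Lemma normBVL_dual_bound x t : (normBVL x <= t%:E)%E -> dual_bound x t.
Proof.
move=> xt p; have [->|p0] := eqVneq p 0.
  have := pairing_linearr x (-1) (0 : C0a T) 0; rewrite scaler0 addr0 => h.
  by rewrite (_ : pairing x 0 = 0) ?normr0 ?mulr0//; lra.
have np : 0 < `|p| by rewrite normr_gt0.
rewrite -ler_pdivrMr// -lee_fin; apply: le_trans xt.
apply: le_ereal_inf_tmp => _ [u ux <-]; apply: le_trans (normM_le_normBV u).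
(* [normM] is a supremum without absolute value, so p is normalized with the sign of the pairing. *)
have [c [c1 cE]] : exists c : R, `|c| = 1 /\ `|pairing x p| = c * pairing x p.
  have [h|h] := leP 0 (pairing x p).
    by exists 1; rewrite normr1 mul1r ger0_norm.
  by exists (-1); rewrite normrN1 mulN1r ltr0_norm.
pose q := (c / `|p|) *: p.
have q1 : `|C0a_C0 q| <= 1.
  by rewrite -[leLHS]/(`|q|) normrZ normrM c1 mul1r normfV normr_id mulVf// gt_eqF.
apply: le_trans (normM_ge _ q1); rewrite lee_fin le_eqVlt; apply/orP; left; apply/eqP.
rewrite -[RHS]/(derivative_integral u q) -pairing_class// [BVL_class u]ux cE.
have := pairing_linearr x (c / `|p|) p 0; rewrite addr0 => ->.
have := pairing_linearr x (-1) (0 : C0a T) 0; rewrite scaler0 addr0 => h.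
rewrite (_ : pairing x 0 = 0); first by ring.
lra.
Qed.

(** Composed with the projection, f becomes a functional on C_0 bounded by k C. Its representative u
    has |u| <= k C, which contributes k T C to the norm through the L^1 part, and Du contributes k
    C. *)
Lemma exists_dual_representative : exists2 k : R, 0 < k &
  forall (f : C0a T -> R) (C : R), 0 <= C ->
    (forall a p q, f (a *: p + q) = a * f p + f q) -> (forall p, `|f p| <= C * `|p|) ->
    exists2 x : BVL T, (forall p, pairing x p = f p) & (normBVL x <= (k * C)%:E)%E.
Proof.
have [proj [k [k0 projL projK projE]]] := exists_C0a_projection T0.
exists (k * T + k) => [|f C Cge0 fL fC]; first by rewrite addr_gt0// mulr_gt0.
have FL (a : R) (p q : C0 T) : f (proj (a *: p + q)) = a * f (proj p) + f (proj q).
  by rewrite projL fL.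
have FK (p : C0 T) : `|f (proj p)| <= k * C * `|p|.
  apply: le_trans (fC _) _; rewrite mulrAC mulrC; apply: ler_wpM2r => //; exact: projK.
have [u uK uE] := exists_BV_representative T0 FL FK.
exists (BVL_class u) => [p|]; first by rewrite pairing_class// uE projE.
have kC0 : 0 <= k * C by rewrite mulr_ge0// ltW.
apply: (@le_trans _ _ (normBV u)); first by apply: ereal_inf_lbound; exists u.
have -> : (k * T + k) * C = k * C * T + k * C by ring.
rewrite EFinD; apply: leeD.
  apply: (@le_trans _ _ (\int[mu]_(y in Om) (k * C)%:E)%E).
    apply: ge0_le_integral => //.
    - exact: measurable_Omega.
    - have := BV_integrable u; case/integrableP => mu_ _.
      by apply/measurable_EFinP; apply: measurableT_comp => //; exact/measurable_EFinP.
  rewrite integral_cst; last exact: measurable_Omega.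
  by rewrite [X in (_ * X <= _)%E](lebesgue_Omega T0) EFinM.
apply: ge_ereal_sup => _ [p /= p1 <-]; rewrite lee_fin.
rewrite -[leLHS]/(derivative_integral u p) uE.
apply: le_trans (ler_norm _) _; apply: le_trans (FK p) _.
by rewrite ler_piMr.
Qed.

Lemma dual_norm_leP x t : (dual_norm (pairing x : C0a T -> R) <= t%:E)%E <-> 0 <= t /\ dual_bound x t.
Proof.
have pairing0 : pairing x 0 = 0.
  by have := pairing_linearr x (-1) (0 : C0a T) 0; rewrite scaler0 addr0 => h; lra.
split=> [h|[t0 h]].
  have {}h p : `|p| <= 1 -> `|pairing x p| <= t.
    by move=> p1; rewrite -lee_fin; apply: le_trans h; apply: ereal_sup_ubound; exists p.
  split; first by have := h 0; rewrite normr0 pairing0 normr0; exact.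
  move=> p; have [->|p0] := eqVneq p 0; first by rewrite pairing0 !normr0 mulr0.
  have np : 0 < `|p| by rewrite normr_gt0.
  have := h (`|p|^-1 *: p); rewrite normrZ normfV normr_id mulVf ?gt_eqF// => /(_ (lexx _)).
  have := pairing_linearr x (`|p|^-1) p 0; rewrite addr0 pairing0 addr0 => ->.
  by rewrite normrM normfV normr_id ler_pdivrMl// mulrC.
apply: ge_ereal_sup => _ [p /= p1 <-]; rewrite lee_fin; apply: le_trans (h p) _.
by rewrite ler_piMr.
Qed.

Lemma dual_norm_ge0 x : (0 <= dual_norm (pairing x : C0a T -> R))%E.
Proof.
apply: le_trans (_ : (`|pairing x 0|%:E <= _)%E); first by rewrite lee_fin.
by apply: ereal_sup_ubound; exists 0 => //=; rewrite normr0.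
Qed.

End norm_bounds.

(** The transfer of upper bounds is applied at the value of the norm itself, which is real by
    finiteness. *)
Lemma equivalent_norms_of_bounds {R : realType} (V : Type) (N1 N2 : V -> \bar R) (k1 k2 : R) :
  0 < k1 -> 0 < k2 -> (forall x, N1 x \is a fin_num) -> (forall x, N2 x \is a fin_num) ->
  (forall x t, (N1 x <= t%:E)%E -> (N2 x <= (k1 * t)%:E)%E) ->
  (forall x t, (N2 x <= t%:E)%E -> (N1 x <= (k2 * t)%:E)%E) -> equivalent_norms N1 N2.
Proof.
move=> k10 k20 f1 f2 h1 h2; exists k1^-1, k2; split; rewrite ?invr_gt0// => x.
have := h1 x (fine (N1 x)); have := h2 x (fine (N2 x)).
rewrite !fineK// => /(_ (lexx _)) l2 /(_ (lexx _)) l1.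
move: l1 l2; rewrite -(fineK (f1 x)) -(fineK (f2 x)) -!EFinM !lee_fin => l1 l2.
by rewrite ler_pdivrMl.
Qed.

Lemma linear_continuous_bound {R : realType} (E : normedModType R) (f : E -> R) :
  (forall a p q, f (a *: p + q) = a * f p + f q) -> continuous f ->
  exists C, 0 <= C /\ forall p, `|f p| <= C * `|p|.
Proof.
move=> fL cf.
have f0 : f 0 = 0 by have := fL (-1) 0 0; rewrite scaler0 addr0 => h; lra.
have fZ a p : f (a *: p) = a * f p by have := fL a p 0; rewrite addr0 f0 addr0.
have /cvgrPdist_lt/(_ 1 ltr01) := cf 0.
rewrite f0 => /nbhs_ballP[d /= d0 dP].
exists (2 / d); split=> [|p]; first by rewrite divr_ge0// ltW.
have [->|p0] := eqVneq p 0; first by rewrite f0 !normr0 mulr0.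
have np : 0 < `|p| by rewrite normr_gt0.
pose c := d / 2 / `|p|; have c0 : 0 < c by rewrite !divr_gt0.
have : `|0 - f (c *: p)| < 1.
  apply: dP; rewrite -ball_normE /ball_/= sub0r normrN normrZ gtr0_norm//.
  by rewrite /c divfK ?gt_eqF// ltr_pdivrMr// ltr_pMr// ltr1n.
rewrite sub0r normrN fZ normrM gtr0_norm// -ltr_pdivlMl// mulr1 => /ltW/le_trans; apply.
by rewrite /c !invf_div le_eqVlt; apply/orP; left; apply/eqP; ring.
Qed.

Lemma bounded_linear_continuous {R : realType} (E : normedModType R) (f : E -> R) (C : R) :
  (forall a p q, f (a *: p + q) = a * f p + f q) -> (forall p, `|f p| <= C * `|p|) ->
  continuous f.
Proof.
move=> fL fC p; apply/cvgrPdist_lt => e e0.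
have fB q : f p - f q = f (p - q).
  by rewrite [in RHS]addrC -(scaleN1r q) fL mulN1r addrC.
near=> q; rewrite fB; apply: le_lt_trans (fC _) _.
apply: (@le_lt_trans _ _ ((`|C| + 1) * `|p - q|)).
  by apply: ler_wpM2r => //; apply: (le_trans (ler_norm C)); rewrite lerDl.
rewrite -ltr_pdivlMl ?ltr_wpDl//.
near: q.
have d0 : 0 < (`|C| + 1)^-1 * e by rewrite mulr_gt0// invr_gt0 ltr_wpDl.
by have := nbhsx_ballx p _ d0; rewrite -ball_normE.
Unshelve. all: by end_near. Qed.

(** * Weak-* sequential compactness *)

(** Tychonoff on a product of segments. The index set may be uncountable, so compactness gives a
    cluster point and not yet a subsequence; the conclusion spells out basic neighbourhoods met at
    arbitrarily large n. *)
Lemma bounded_cluster_point {R : realType} (I : eqType) (b : nat -> I -> R) (M : I -> R) :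
  (forall n i, `|b n i| <= M i) ->
  exists g : I -> R, forall (s : seq I) (e : R) (m : nat), 0 < e ->
    exists2 n, (m <= n)%N & forall i, i \in s -> `|b n i - g i| < e.
Proof.
move=> bM.
have cpt := @tychonoff I (fun=> R) (fun i => `[- M i, M i]%classic)
  (fun i => @segment_compact R (- M i) (M i)).
pose F : set_system (forall i : I, R) := b n @[n --> \oo].
have FA : \forall n \near \oo, forall i, `[- M i, M i]%classic (b n i).
  by apply: nearW => n i /=; rewrite in_itv/= -ler_norml.
have [g [_ gF]] := cpt F _ FA.
exists g => s e m e0.
have Fg : Filter (nbhs g) by exact: nbhs_filter.
have gB : nbhs g [set f : forall i : I, R | forall i, i \in s -> `|f i - g i| < e].
  elim: s => [|i s IH]; first by apply: filterS filterT => f _ i; rewrite in_nil.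
  have gi : nbhs g [set f : forall i : I, R | `|f i - g i| < e].
    have := @proj_continuous I (fun=> R) i g; move=> /cvgrPdist_lt/(_ e e0).
    by apply: filterS => f; rewrite /proj distrC.
  apply: filterS (filterI gi IH) => f [f1 f2] j; rewrite in_cons => /predU1P[->//|].
  exact: f2.
have FB : \forall n' \near \oo, exists2 n, (m <= n)%N & b n' = b n.
  by near=> n; exists n => //; near: n; exact: nbhs_infty_ge.
have [f [[n mn fE] fs]] := gF [set f | exists2 n, (m <= n)%N & f = b n] _ FB gB.
by exists n => // i si; rewrite -fE; exact: fs.
Unshelve. all: by end_near. Qed.

Lemma initial_cvg (S : choiceType) (X : topologicalType) (f : S -> X) (F : set_system S)
    (s : S) : Filter F -> f @ F --> f s -> F --> (s : initial_topology f).
Proof.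
move=> FF fF A /= [_ [[B Bop <-] Bfs sBfA]].
have FB : nbhs (f s) B by rewrite nbhsE; exists B.
exact: filterS sBfA (fF _ FB).
Qed.

Lemma strictly_increasing_choice (P : nat -> nat -> Prop) :
  (forall j m, exists2 n, (m <= n)%N & P j n) ->
  exists s : nat -> nat, {homo s : m n / (m < n)%N} /\ forall j, P j (s j).
Proof.
move=> h.
have h' jm : exists n, (jm.2 <= n)%N /\ P jm.1 n.
  by have [n ? ?] := h jm.1 jm.2; exists n.
have [phi phiP] := choice h'.
pose fix s j := if j is i.+1 then phi (i.+1, (s i).+1) else phi (0%N, 0%N).
exists s; split.
  apply: homo_ltn; first exact: ltn_trans.
  by move=> n; have [] := phiP (n.+1, (s n).+1).
by case=> [|j]; [have [] := phiP (0, 0)%N|have [] := phiP (j.+1, (s j).+1)].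
Qed.

Section banach_alaoglu.
Context {R : realType} (E : normedModType R).

(** The common bound C makes the functionals equicontinuous, so convergence on the span of the [e k]
    extends to its closure. *)
Lemma dense_cvg (b : nat -> E -> R) (g : E -> R) (C : R) (e : nat -> E) : 0 <= C ->
  (forall n a p q, b n (a *: p + q) = a * b n p + b n q) ->
  (forall a p q, g (a *: p + q) = a * g p + g q) ->
  (forall n p, `|b n p| <= C * `|p|) -> (forall p, `|g p| <= C * `|p|) ->
  (forall p r, 0 < r -> exists N (c : nat -> R) (k : nat -> nat),
    `|p - \sum_(i < N) c i *: e (k i)| <= r) ->
  (forall k, b n (e k) @[n --> \oo] --> g (e k)) ->
  forall p, b n p @[n --> \oo] --> g p.
Proof.
move=> C0 bL gL bC gC e_dense be p.
have linear_sum (f : E -> R) N (c : nat -> R) (k : nat -> nat) :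
    (forall a p q, f (a *: p + q) = a * f p + f q) ->
    f (\sum_(i < N) c i *: e (k i)) = \sum_(i < N) c i * f (e (k i)).
  move=> fL; have f0 : f 0 = 0 by have := fL (-1) 0 0; rewrite scaler0 addr0 => h; lra.
  elim: N => [|N IH]; first by rewrite !big_ord0.
  by rewrite !big_ord_recr/= addrC fL IH addrC.
apply/cvgrPdist_lt => r r0.
(* With this distance from p to q, passing from p to q costs at most r / 4 both in g and in [b n]; C
   + 1 keeps the denominator positive. *)
have d0 : 0 < r / (4 * (C + 1)) by rewrite divr_gt0// mulr_gt0// ltr_wpDl.
have [N [c [k pE]]] := e_dense p _ d0.
pose q := \sum_(i < N) c i *: e (k i).
have close (f : E -> R) : (forall a p q, f (a *: p + q) = a * f p + f q) ->
    (forall p, `|f p| <= C * `|p|) -> `|f p - f q| <= r / 4.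
  move=> fL fC; have -> : f p - f q = f (p - q).
    by rewrite [in RHS]addrC -(scaleN1r q) fL mulN1r addrC.
  apply: le_trans (fC _) _; apply: (@le_trans _ _ (C * (r / (4 * (C + 1))))).
    exact: ler_wpM2l.
  have -> : C * (r / (4 * (C + 1))) = C / (C + 1) * (r / 4).
    by rewrite invfM; ring.
  apply: ler_piMl; first by rewrite divr_ge0// ltW.
  by rewrite ler_pdivrMr ?ltr_wpDl// mul1r lerDl.
have bq : b n q @[n --> \oo] --> g q.
  rewrite (linear_sum g)//; under eq_fun do rewrite linear_sum//.
  apply: (@cvg_sum_ord R N (fun i n => c i * b n (e (k i))) (fun i => c i * g (e (k i)))) => i.
  by apply: cvgM; [exact: cvg_cst|exact: be].
have r2 : 0 < r / 4 by rewrite divr_gt0.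
have /cvgrPdist_lt/(_ _ r2) := bq.
apply: filterS => n bqn.
have -> : g p - b n p = (g p - g q) + (g q - b n q) - (b n p - b n q) by ring.
apply: le_lt_trans (ler_normB _ _) _.
apply: le_lt_trans (lerD (ler_normD _ _) (lexx _)) _.
by have := close g gL gC; have := close (b n) (bL n) (bC n); lra.
Qed.

(* A pointwise cluster point g is linear and bounded; separability lets one choose
   a subsequence converging to g along a dense sequence. *)
Lemma bounded_weak_star_subsequence (b : nat -> E -> R) (C : R) (e : nat -> E) : 0 <= C ->
  (forall n a p q, b n (a *: p + q) = a * b n p + b n q) ->
  (forall n p, `|b n p| <= C * `|p|) ->
  (forall p r, 0 < r -> exists N (c : nat -> R) (k : nat -> nat),
    `|p - \sum_(i < N) c i *: e (k i)| <= r) ->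
  exists (s : nat -> nat) (g : E -> R), [/\ {homo s : m n / (m < n)%N},
    forall a p q, g (a *: p + q) = a * g p + g q, forall p, `|g p| <= C * `|p| &
    forall p, b (s n) p @[n --> \oo] --> g p].
Proof.
move=> C0 bL bC e_dense.
have [g gP] := bounded_cluster_point bC.
have gL a p q : g (a *: p + q) = a * g p + g q.
  apply/eqP; rewrite -subr_eq0 -normr_le0; apply/ler_addgt0Pl => r r0.
  (* The three errors enter with weights |a|, 1 and 1. *)
  have d0 : 0 < r / (`|a| + 2) by rewrite divr_gt0// ltr_wpDl.
  have [n _ nP] := gP [:: a *: p + q; p; q] _ 0%N d0.
  have h1 := nP (a *: p + q); have h2 := nP p; have h3 := nP q.
  have {}h1 := h1 (mem_head _ _).
  have {}h2 : `|b n p - g p| < r / (`|a| + 2) by apply: h2; rewrite !inE eqxx orbT.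
  have {}h3 : `|b n q - g q| < r / (`|a| + 2) by apply: h3; rewrite !inE eqxx !orbT.
  rewrite addr0.
  have -> : g (a *: p + q) - (a * g p + g q) =
      a * (b n p - g p) + (b n q - g q) - (b n (a *: p + q) - g (a *: p + q)).
    by rewrite bL; ring.
  have -> : r = `|a| * (r / (`|a| + 2)) + r / (`|a| + 2) + r / (`|a| + 2).
    by rewrite -[in LHS](divfK (x := `|a| + 2) _ r) ?gt_eqF ?ltr_wpDl//; ring.
  apply: le_trans (ler_normB _ _) _; apply: lerD; last exact: ltW.
  apply: le_trans (ler_normD _ _) _; apply: lerD; last exact: ltW.
  by rewrite normrM; apply: ler_wpM2l => //; exact: ltW.
have gC p : `|g p| <= C * `|p|.
  apply/ler_addgt0Pl => r r0; have [n _ nP] := gP [:: p] _ 0%N r0.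
  have -> : g p = b n p - (b n p - g p) by ring.
  apply: le_trans (ler_normB _ _) _; rewrite addrC; apply: lerD; last exact: bC.
  by apply/ltW/nP; rewrite mem_head.
(* Diagonal choice: term j is within 1 / (j + 1) of g on the first j + 1 vectors at once. *)
have hP j m : exists2 n, (m <= n)%N &
    forall k, (k <= j)%N -> `|b n (e k) - g (e k)| < j.+1%:R^-1.
  have j0 : 0 < j.+1%:R^-1 :> R by rewrite invr_gt0.
  have [n mn nP] := gP [seq e k | k <- iota 0 j.+1] _ m j0.
  by exists n => // k kj; apply: nP; apply: map_f; rewrite mem_iota.
have [s [s_mono sP]] := strictly_increasing_choice hP.
exists s, g; split=> //.
apply: (dense_cvg C0 _ gL _ gC e_dense) => [n|n|k]; [exact: bL|exact: bC|].
apply/cvgrPdist_lt => r r0.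
near=> n; rewrite distrC; apply: (@lt_trans _ _ n.+1%:R^-1).
  by apply: sP; near: n; exact: nbhs_infty_ge.
by near: n; exact: (near_infty_natSinv_lt (PosNum r0)).
Unshelve. all: by end_near. Qed.

End banach_alaoglu.

(** * The dual representation *)

(** TGV is handled only through its real upper bounds; these determine an extended real, infinite
    values included. *)
Lemma eq_ereal_real_bounds {R : realType} (a b : \bar R) :
  (forall t : R, (a <= t%:E)%E <-> (b <= t%:E)%E) -> a = b.
Proof.
move=> ab.
have le (x y : \bar R) : (forall t : R, (x <= t%:E)%E <-> (y <= t%:E)%E) -> (x <= y)%E.
  case: y => [r||] h; first exact/h.
    exact: leey.
  by rewrite (@eq_ninfty R x)// => t; apply/h; exact: leNye.
by apply/eqP; rewrite eq_le !le// => t; rewrite ab.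
Qed.

Section equivalences.
Context {R : realType} (T alpha beta : R).
Hypotheses (T0 : 0 < T) (alpha0 : 0 < alpha) (beta0 : 0 < beta).
Implicit Types x y : BVL T.
Local Notation m := (Num.min beta (alpha / T)).
Local Notation N := (@TGVL R T alpha beta).

Let m0 : 0 < m.
Proof. by rewrite lt_min beta0 divr_gt0. Qed.

Lemma TGVL_class (u : BV T) : N (BVL_class u) = TGV alpha beta u.
Proof. by apply: eq_ereal_real_bounds => t; rewrite (TGVL_leP _ _ T0) (TGV_leP _ _ T0). Qed.

Lemma TGVL_ge0 x : (0 <= N x)%E.
Proof.
have h (t : R) : (N x <= t%:E)%E -> 0 <= t.
  by move=> /(TGVL_leP _ _ T0)/(TGV_bound_ge0 alpha0 beta0).
case E : (N x) => [r||]; first by rewrite lee_fin h// E.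
  exact: leey.
by have := h (-1); rewrite E => /(_ (leNye _)); rewrite lerNr oppr0 ler10.
Qed.

Lemma TGVL_fin_num x : N x \is a fin_num.
Proof.
have [C [C0 xC]] := exists_dual_bound x.
rewrite ge0_fin_numE ?TGVL_ge0//; apply: le_lt_trans (ltry (beta * C)).
by apply/(TGVL_leP _ _ T0); apply: dual_bound_TGV.
Qed.

Lemma dual_norm_fin_num x : dual_norm (pairing x : C0a T -> R) \is a fin_num.
Proof.
have [C [C0 xC]] := exists_dual_bound x.
rewrite ge0_fin_numE ?dual_norm_ge0//; apply: le_lt_trans (ltry C).
by apply/dual_norm_leP.
Qed.

(** The representative constructed for the functional of x is x itself, by injectivity of the
    pairing, so the norm estimate of the construction holds for every class. *)
Lemma exists_dual_bound_normBVL : exists2 k : R, 0 < k &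
  forall x C, 0 <= C -> dual_bound x C -> (normBVL x <= (k * C)%:E)%E.
Proof.
have [k k0 kP] := exists_dual_representative T0; exists k => // x C C0 xC.
have [y yx yC] := kP (pairing x) C C0 (pairing_linearr x) xC.
have -> : x = y by apply: (pairing_inj T0) => p; exact: (esym (yx p)).
exact: yC.
Qed.

Lemma normBVL_fin_num x : normBVL x \is a fin_num.
Proof.
have [C [C0 xC]] := exists_dual_bound x.
have [k _ kP] := exists_dual_bound_normBVL.
by rewrite ge0_fin_numE ?normBVL_ge0//; apply: le_lt_trans (kP _ _ C0 xC) (ltry _).
Qed.

Lemma normBVL_le_ge0 x (t : R) : (normBVL x <= t%:E)%E -> 0 <= t.
Proof. by move=> xt; rewrite -lee_fin; apply: le_trans xt; exact: normBVL_ge0. Qed.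

Lemma TGVL_equivalent_norm : equivalent_norms N (@normBVL R T).
Proof.
have [k k0 kP] := exists_dual_bound_normBVL.
apply: (@equivalent_norms_of_bounds _ _ _ _ (k / m) beta) => //.
- by rewrite divr_gt0.
- exact: TGVL_fin_num.
- exact: normBVL_fin_num.
- move=> x t /(TGVL_leP _ _ T0) xt; rewrite -mulrA (mulrC m^-1); apply: kP.
    by rewrite divr_ge0// ?(TGV_bound_ge0 _ _ xt)// ltW.
  exact: TGV_dual_bound xt.
- move=> x t xt; apply/(TGVL_leP _ _ T0); apply: dual_bound_TGV.
    exact: normBVL_le_ge0 xt.
  exact: normBVL_dual_bound.
Qed.

Lemma dual_equivalent_norm :
  equivalent_norms (fun x => dual_norm (pairing x : C0a T -> R)) (@normBVL R T).
Proof.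
have [k k0 kP] := exists_dual_bound_normBVL.
apply: (@equivalent_norms_of_bounds _ _ _ _ k 1) => //.
- exact: dual_norm_fin_num.
- exact: normBVL_fin_num.
- by move=> x t /dual_norm_leP[t0 xt]; exact: kP.
- move=> x t xt; rewrite mul1r; apply/dual_norm_leP; split.
    exact: normBVL_le_ge0 xt.
  exact: normBVL_dual_bound.
Qed.

Lemma TGVL_is_norm : is_norm N.
Proof.
have pairingZ a x p : pairing (a *: x) p = a * pairing x p.
  have h0 : pairing (0 : BVL T) p = 0.
    by have := pairing_linearl T0 p (-1) 0 0; rewrite scaler0 addr0 => h; lra.
  have := pairing_linearl T0 p a x 0; rewrite addr0 => ->; rewrite h0; exact: addr0.
have NleZ a x (t : R) : (N x <= t%:E)%E -> (N (a *: x)%R <= (`|a| * t)%:E)%E.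
  move=> /(TGVL_leP _ _ T0) h; apply/(TGVL_leP _ _ T0) => v tv va vb.
  by rewrite pairingZ normrM; apply: ler_wpM2l => //; exact: h.
split.
- exact: TGVL_fin_num.
- move=> x y; rewrite -(fineK (TGVL_fin_num x)) -(fineK (TGVL_fin_num y)) -EFinD.
  have hx := (TGVL_leP alpha beta T0 x (fine (N x))).1.
  have hy := (TGVL_leP alpha beta T0 y (fine (N y))).1.
  rewrite fineK ?TGVL_fin_num// in hx; rewrite fineK ?TGVL_fin_num// in hy.
  apply/(TGVL_leP _ _ T0) => v tv va vb.
  have := pairing_linearl T0 (test_C0a T0 tv) 1 x y; rewrite scale1r mul1r => ->.
  apply: le_trans (ler_normD _ _) _.
  by apply: lerD; [exact: (hx (lexx _))|exact: (hy (lexx _))].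
- move=> a x; rewrite -(fineK (TGVL_fin_num x)) -EFinM.
  have [->|a0] := eqVneq a 0.
    rewrite normr0 mul0r scale0r; apply/eqP; rewrite eq_le TGVL_ge0 andbT.
    have := @NleZ 0 0 (fine (N (0 : BVL T))).
    by rewrite fineK ?TGVL_fin_num// normr0 mul0r scaler0; exact.
  apply/eqP; rewrite eq_le NleZ ?fineK ?TGVL_fin_num//=.
  (* The reverse inequality is the same one for the inverse scalar. *)
  have h := @NleZ a^-1 (a *: x) (fine (N (a *: x))).
  rewrite fineK ?TGVL_fin_num// scalerA mulVf// scale1r in h.
  have := h (lexx _); rewrite -(fineK (TGVL_fin_num x)) -(fineK (TGVL_fin_num (a *: x))).
  by rewrite !lee_fin normfV ler_pdivlMl ?normr_gt0.
- move=> x x0; apply: (pairing_eq0 T0) => p.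
  have /(TGVL_leP alpha beta T0 x 0) h : (N x <= 0%:E)%E by rewrite x0.
  have := TGV_dual_bound alpha0 beta0 h p; rewrite mul0r mul0r.
  by rewrite normr_le0 => /eqP.
Qed.

Lemma BVL_dual_representation : dual_representation (@normBVL R T) (@pairing R T).
Proof.
split.
- move=> p a x y; exact: pairing_linearl.
- move=> x; split; first by move=> a p q; exact: pairing_linearr.
  have [C [_ xC]] := exists_dual_bound x.
  exact: (bounded_linear_continuous (pairing_linearr x) xC).
- move=> f fL cf; have [C [C0 fC]] := linear_continuous_bound fL cf.
  have [k _ kP] := exists_dual_representative T0.
  have [x xf _] := kP f C C0 fL fC.
  exists x; split; first exact/funext.
  by move=> y yf; apply: (pairing_inj T0) => p; apply: (etrans (xf p)); rewrite yf.
- exact: dual_equivalent_norm.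
Qed.

(** Separability as a sequence with dense real span: the projections to C_{0,a} of the countably
    many hats, enumerated by [pickle]. *)
Lemma C0a_separable : exists e : nat -> C0a T, forall p (r : R), 0 < r ->
  exists n (c : nat -> R) (k : nat -> nat), `|p - \sum_(i < n) c i *: e (k i)| <= r.
Proof.
have [proj [k [k0 projL projK projE]]] := exists_C0a_projection T0.
(* Hats with i + 1 < n are bumps in (0, T); for pairs where the hat is not in C_0 the default 0 is
   taken, and the approximating sums use only genuine bumps. *)
pose h (n : nat * nat) : C0 T := insubd (0 : C0 T) (hat T n.1 n.2 : R -> R^o).
have hE n i : (i.+1 < n)%N -> h (n, i) = hat T n i :> (R -> R).
  move=> ilt; rewrite -[LHS]/(\val (h (n, i))) val_insubd/=.
  by have := valP (test_C0 (bump_test (hat_bump T0 ilt))) => /= ->.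
exists (fun j => proj (h (odflt (0, 0)%N (unpickle j)))) => p r r0.
have [n nP] := hat_dense T0 p (divr_gt0 r0 k0).
exists n.-1, (fun i => (p : C0 T) (node T n i.+1)), (fun i => pickle (n, i)).
have proj_sum l : \sum_(i < l) (p : C0 T) (node T n i.+1) *:
      proj (h (odflt (0, 0)%N (unpickle (pickle (n, nat_of_ord i))))) =
    proj (\sum_(i < l) (p : C0 T) (node T n i.+1) *: h (n, nat_of_ord i)).
  elim: l => [|l IH].
    rewrite !big_ord0; apply/esym/eqP; rewrite -normr_le0.
    by have := projK 0; rewrite normr0 mulr0.
  by rewrite !big_ord_recr/= addrC [in RHS]addrC projL IH pickleK.
rewrite proj_sum -[X in X - _]projE.
set q := \sum_(i < _) _.
have -> : proj p - proj q = proj ((p : C0 T) - q).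
  by rewrite [in RHS]addrC -(scaleN1r q) projL scaleN1r addrC.
apply: le_trans (projK _) _; rewrite -ler_pdivlMl// mulrC.
apply: C0_norm_le => [|y Oy]; first by rewrite divr_ge0// ltW.
have sum_at l : (l <= n.-1)%N -> (\sum_(i < l) (p : C0 T) (node T n i.+1) *: h (n, nat_of_ord i)) y =
    \sum_(i < l) (p : C0 T) (node T n i.+1) * hat T n i y.
  elim: l => [|l IH] ln; first by rewrite !big_ord0.
  rewrite !big_ord_recr/= -IH; last exact: ltnW.
  by rewrite -(hE n l) // -ltn_predRL.
have := nP y Oy.
by rewrite -sum_at.
Qed.

Lemma TGV_ball_sequentially_compact :
  sequentially_compact ([set x | (N x <= 1)%E] : set (weak_star (@pairing R T))).
Proof.
move=> u uB.
have uT n : TGV_bound alpha beta T0 (u n) 1 by apply/TGVL_leP; exact: uB.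
have [e e_dense] := C0a_separable.
have C0 : 0 <= 1 / m by rewrite divr_ge0// ltW.
have [s [g [s_mono gL gC gP]]] := bounded_weak_star_subsequence C0
  (fun n => pairing_linearr (u n)) (fun n => TGV_dual_bound alpha0 beta0 (uT n)) e_dense.
exists s; split => //.
have [k _ kP] := exists_dual_representative T0.
have [x xg _] := kP g _ C0 gL gC.
exists x.
  (* Weak-* lower semicontinuity: the TGV bound is a family of bounds on single pairings, each of
     which passes to the limit. *)
  apply/TGVL_leP => v tv va vb.
  rewrite (xg (test_C0a T0 tv)); apply: (cvgr_to_le (cvg_norm (gP (test_C0a T0 tv)))).
  by apply: nearW => n; exact: uT.
apply: (@initial_cvg _ _ (@pairing R T : _ -> {ptws C0a T -> R})).
apply/pointwise_cvgP => p.
by rewrite -[X in _ --> X]/(pairing x p) xg; exact: gP.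
Qed.

End equivalences.

Theorem proposition1 (R : realType) (T alpha beta : R)
    (T_gt0 : 0 < T) (alpha_gt0 : 0 < alpha) (beta_gt0 : 0 < beta) :
  [/\ (forall u : BV T, TGVL alpha beta (BVL_class u) = TGV alpha beta u) /\
      is_norm (TGVL alpha beta : BVL T -> \bar R) /\
      equivalent_norms (TGVL alpha beta : BVL T -> \bar R) (@normBVL R T),
      (forall (u : BV T) (p : C0a T),
        pairing (BVL_class u) p = charge_integral (BV_deriv u) (Omega T) p) /\
      dual_representation (@normBVL R T) (@pairing R T) &
      sequentially_compact
        ([set x : BVL T | (TGVL alpha beta x <= 1)%E] : set (weak_star (@pairing R T)))].
Proof.
split; [split; last split| |].
- exact: TGVL_class.
- exact: TGVL_is_norm.
- exact: TGVL_equivalent_norm.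
- split; last exact: BVL_dual_representation.
  by move=> u p; exact: pairing_class.
- exact: TGV_ball_sequentially_compact.
Qed.
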